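(* Let $p>5$ be a prime. If $p\equiv1\pmod3$ and $p=x^2+3y^2$ with $x,y\in\mathbb Z$, then $$\sum_{k=0}^{p-3}\frac{\binom{2k}k^2\binom{3k}k}{108^k(k+2)}\equiv\frac{29}{15}x^2-\frac{29}{30}p-\frac{3p^2}{80x^2}\pmod{p^3}.$$ If $p\equiv2\pmod3$, then $$\sum_{k=0}^{p-3}\frac{\binom{2k}k^2\binom{3k}k}{108^k(k+2)}\equiv-\frac23\binom{(p-1)/2}{(p-5)/6}^2\Big(1+p\Big(2+\frac43q_p(2)-\frac32q_p(3)\Big)+p^2\Big(1+\frac83q_p(2)+\frac29q_p(2)^2-3q_p(3)-2q_p(2)q_p(3)+\frac{15}8q_p(3)^2+\frac34U_{p-3}\Big)\Big)-\frac{29}{120}p^2\binom{(p-1)/2}{(p-5)/6}^{-2}\pmod{p^3}.$$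
   Context: Congruences modulo $p^3$ are between rational numbers whose denominators are not divisible by $p$. For $a$ not divisible by $p$, $q_p(a)=(a^{p-1}-1)/p$. The sequence $\{U_n\}$ is given by $U_{2n-1}=0$, $U_0=1$, $U_{2n}=-2\sum_{k=1}^n\binom{2n}{2k}U_{2n-2k}$ for $n=1,2,3,\ldots$. *)

(* Defs.v *)
From mathcomp Require Import all_boot all_order all_algebra.

Set Implicit Arguments.
Unset Strict Implicit.
Unset Printing Implicit Defensive.

Import Order.TTheory GRing.Theory Num.Theory.
Local Open Scope ring_scope.

(* [denq r] is the denominator of [r] in lowest terms. *)
Definition p_integral (p : nat) (r : rat) : Prop := ~~ (p%:Z %| denq r)%Z.

Definition congr_mod_pow (p m : nat) (a b : rat) : Prop :=
  [/\ p_integral p a, p_integral p b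
    & exists2 c : rat, p_integral p c & a - b = p%:R ^+ m * c].

(* The Fermat quotient; only meaningful when [p] is a prime not dividing [a]. *)
Definition fermat_quotient (p : nat) (a : int) : rat :=
  (a%:~R ^+ (p - 1) - 1) / p%:R.

(* [U_evens n] lists U_0, U_2, ..., U_(2n). The recursion of the sequence is
   recovered in [U0], [U_odd] and [U_even] below. *)
Fixpoint U_evens (n : nat) : seq int :=
  if n is m.+1 then
    rcons (U_evens m)
      (- 2 * \sum_(1 <= k < n.+1) 'C(2 * n, 2 * k)%:Z * (U_evens m)`_(n - k))
  else [:: 1].

Definition U (n : nat) : int := if odd n then 0 else (U_evens n./2)`_(n./2).

Lemma size_U_evens n : size (U_evens n) = n.+1.
Proof. by elim: n => //= n IHn; rewrite size_rcons IHn. Qed.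

Lemma nth_U_evens m n : (m <= n)%N -> (U_evens n)`_m = (U_evens m)`_m.
Proof.
elim: n => [|n IHn]; first by case: m.
rewrite leq_eqVlt => /predU1P[-> //|lt_mn].
by rewrite nth_rcons size_U_evens lt_mn IHn.
Qed.

Lemma U0 : U 0 = 1.
Proof. by []. Qed.

Lemma U_odd n : (0 < n)%N -> U (2 * n - 1) = 0.
Proof. by case: n => // n _; rewrite /U mulnS add2n subn1 /= mul2n odd_double. Qed.

Lemma U_double n : U (2 * n) = (U_evens n)`_n.
Proof. by rewrite /U mul2n odd_double doubleK. Qed.

Lemma U_even n : (0 < n)%N ->
  U (2 * n) =
  - 2 * \sum_(1 <= k < n.+1) 'C(2 * n, 2 * k)%:Z * U (2 * n - 2 * k).
Proof.
case: n => // n _; rewrite U_double /= nth_rcons size_U_evens ltnn eqxx.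
congr (_ * _); apply: eq_big_nat => -[//|k] _.
by rewrite -mulnBr U_double nth_U_evens // subSS leq_subr.
Qed.

(* Main.v *)
(* Write S(a) for the sum over k < p of (1/2)_k (-a)_k (1+a)_k / k!^3. Creative
   telescoping gives a^2 S(a) = (a-1)^2 S(a-2) modulo p^3 for a = n + p t with
   1 < n < p, so S is determined modulo p^3 by its values at p t and 1 + p t; the
   former follow from Morley's congruence and the latter by direct expansion.
   Gosper summation turns the sum of the theorem into 29/60 S(-1/3) - 2/3 S(2/3)
   modulo p^3. For p = 6m - 1 both values are products over residue classes
   modulo 6, whose logarithms modulo p^3 are expressed by Fermat quotients and by
   U_(p-3), the latter through umbral calculus. For p = 6m + 1 the value S(-1/3)
   is modulo p^3 the square of a cubic Jacobi sum K, expanded into binomial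
   coefficients by means of Teichmueller representatives. As K is an element of
   norm p of Z[w], with w a cube root of unity in Z/p^3, of trace 2x up to sign,
   (K^2 + p)^2 = 4 x^2 K^2; and S(-1/3) S(2/3) = -p^2/2. *)
From HB Require Import structures.
Require Import Defs.
From mathcomp Require Import all_boot all_order all_algebra cyclic.
From mathcomp Require Import zify ring lra.

Set Implicit Arguments.
Unset Strict Implicit.
Unset Printing Implicit Defensive.

Import Order.TTheory GRing.Theory Num.Theory.
Local Open Scope ring_scope.

(** The precision p^3 of the recursion comes from its boundary term: at a = n + p t it gains one
    factor p from the half-integers and one from each of the two products depending on a. For n = 0
    and n = 1 the last two factors are missing, so these arguments need their own evaluation. On p
    Z_(p) the sum S is, modulo p^3, a quadratic polynomial with constant term 1; two values, at p
    and -p, therefore fix it.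

    For p = 6m - 1 the argument -1/3 is linked to 1 + p t, where S is divisible by p^2, so its chain
    of steps is needed only modulo p; S(2/3) is a unit linked to p t and is needed to full
    precision. For p = 6m + 1 the roles are exchanged, and the unit S(-1/3) carries the square of
    C(4m, 2m), which the logarithms leave undetermined. An algebraic equation satisfied by this unit
    has to replace them there, and only its square root K satisfies one visibly. *)

(** * Congruences in the localization of the integers at p *)

(* [zp p] is the localization of Z at (p), [pk p k] its ideal generated by p^k,
   and [zu p] its unit group. *)
Definition zp (p : nat) : {pred rat} := fun r => coprimez p%:Z (denq r).

Definition pk (p k : nat) : {pred rat} := fun r => r / p%:R ^+ k \in zp p.

Definition zu (p : nat) : {pred rat} :=
  fun r => [&& r != 0, r \in zp p & r^-1 \in zp p].

(** The reduced denominator divides every other one, so closure properties can be proved with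
    unreduced fractions. *)
Lemma zp_mul_int p (a b : int) r : b != 0 -> coprimez p%:Z b ->
  r * b%:~R = a%:~R -> r \in zp p.
Proof.
move=> b0 cpb rb; rewrite unfold_in; apply: coprimez_dvdr cpb.
have cnd : coprimez (denq r) (numq r) by rewrite coprimez_sym coprimezE coprime_num_den.
rewrite -[(_ %| _)%N]/(denq r %| b)%Z -(Gauss_dvdzr _ cnd).
apply/dvdzP; exists a; apply/eqP; rewrite -(eqr_int rat) !rmorphM /= -rb numqE.
by rewrite mulrAC.
Qed.

Lemma zp_denq p r : r \in zp p ->
  exists2 b : int, coprimez p%:Z b & b != 0 /\ exists a : int, r * b%:~R = a%:~R.
Proof.
move=> rz; exists (denq r) => //; split; first exact: denq_neq0.
by exists (numq r); rewrite -numqE.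
Qed.

Lemma zp_subring_closed p : subring_closed (zp p).
Proof.
split=> [|x y xz yz|x y xz yz].
- by apply: (@zp_mul_int p 1 1); rewrite ?coprimezE ?coprimen1 ?mulr1.
- have [b pb [b0 [a xb]]] := zp_denq xz; have [d pd [d0 [c yd]]] := zp_denq yz.
  apply: (@zp_mul_int p (a * d - c * b) (b * d)).
  + by rewrite mulf_neq0.
  + by rewrite coprimezMr pb pd.
  + by rewrite !(rmorphB, rmorphM) /= -xb -yd; ring.
- have [b pb [b0 [a xb]]] := zp_denq xz; have [d pd [d0 [c yd]]] := zp_denq yz.
  apply: (@zp_mul_int p (a * c) (b * d)).
  + by rewrite mulf_neq0.
  + by rewrite coprimezMr pb pd.
  + by rewrite !rmorphM /= -xb -yd; ring.
Qed.

HB.instance Definition _ p := GRing.isSubringClosed.Build rat (zp p) (zp_subring_closed p).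

Lemma pk_zmod_closed p k : zmod_closed (pk p k).
Proof.
split=> [|x y xz yz]; rewrite unfold_in ?mul0r ?rpred0 //.
by rewrite mulrBl rpredB.
Qed.

HB.instance Definition _ p k := GRing.isZmodClosed.Build rat (pk p k) (pk_zmod_closed p k).

Lemma zpD p x y : x \in zp p -> y \in zp p -> x + y \in zp p.
Proof. exact: rpredD. Qed.

Lemma zpN p x : x \in zp p -> - x \in zp p.
Proof. by move=> xz; rewrite rpredN. Qed.

Lemma zpM p x y : x \in zp p -> y \in zp p -> x * y \in zp p.
Proof. exact: rpredM. Qed.

Lemma zpX p x k : x \in zp p -> x ^+ k \in zp p.
Proof. exact: rpredX. Qed.

Lemma zp_prod p I (r : seq I) (Q : pred I) (F : I -> rat) :
  (forall i, Q i -> F i \in zp p) -> \prod_(i <- r | Q i) F i \in zp p.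
Proof. exact: rpred_prod. Qed.

Lemma zp_sum p I (r : seq I) (Q : pred I) (F : I -> rat) :
  (forall i, Q i -> F i \in zp p) -> \sum_(i <- r | Q i) F i \in zp p.
Proof. exact: rpred_sum. Qed.

Lemma zp_nat p n : n%:R \in zp p.
Proof. exact: rpred_nat. Qed.

Lemma zp1 p : 1 \in zp p.
Proof. exact: rpred1. Qed.

Lemma zp_int p z : z%:~R \in zp p.
Proof. exact: rpred_int. Qed.

Lemma zuV_zp p x : x \in zu p -> x^-1 \in zp p. Proof. by case/and3P. Qed.

Lemma pkD p k x y : x \in pk p k -> y \in pk p k -> x + y \in pk p k.
Proof. exact: rpredD. Qed.

Lemma pkB p k x y : x \in pk p k -> y \in pk p k -> x - y \in pk p k.
Proof. exact: rpredB. Qed.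

Lemma pkN p k x : x \in pk p k -> - x \in pk p k.
Proof. by rewrite rpredN. Qed.

Ltac zpt := repeat first
  [ assumption
  | match goal with
    | |- is_true (_ + _ \in _) => apply: zpD
    | |- is_true (- _ \in _) => apply: zpN
    | |- is_true (_ * _ \in _) => apply: zpM
    | |- is_true (_ ^+ _ \in _) => apply: zpX
    | |- is_true (_%:R \in _) => exact: zp_nat
    | |- is_true (1 \in _) => exact: zp1
    | |- is_true (_%:~R \in _) => exact: zp_int
    | |- is_true (_^-1 \in _) => apply: zuV_zp
    end ].

Section Main.

Variable p : nat.
Hypothesis p_pr : prime p.
Hypothesis p_gt5 : (5 < p)%N.
Local Notation P := (p%:R : rat).
Local Notation h := (p./2).

Lemma P_neq0 : P != 0.
Proof. by rewrite pnatr_eq0 -lt0n prime_gt0 ?p_pr. Qed.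

Lemma p_integralE r : p_integral p r <-> r \in zp p.
Proof.
by rewrite /p_integral unfold_in coprimezE absz_nat prime_coprime ?p_pr.
Qed.

Lemma congr_mod_powE k a b : a \in zp p -> a - b \in pk p k ->
  congr_mod_pow p k a b.
Proof.
move=> az abk; have Pk0 : P ^+ k != 0 by rewrite expf_neq0 ?P_neq0.
have cz : (a - b) / P ^+ k \in zp p by [].
have abE : a - b = P ^+ k * ((a - b) / P ^+ k) by rewrite mulrC divfK.
split; first by apply/(p_integralE a).
  apply/(p_integralE b).
  rewrite -[b](subKr a) abE; apply: rpredB => //.
  by apply: rpredM cz; rewrite rpredX ?rpred_nat.
by exists ((a - b) / P ^+ k) => //; apply/(p_integralE _).
Qed.

Lemma pkE k r : r \in pk p k <-> exists2 c, c \in zp p & r = P ^+ k * c.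
Proof.
have Pk0 : P ^+ k != 0 by rewrite expf_neq0 ?P_neq0.
split=> [rk|[c cz ->]]; first by exists (r / P ^+ k); rewrite // mulrC divfK.
by rewrite unfold_in mulrAC mulfV ?mul1r.
Qed.

Lemma pk0 r : (r \in pk p 0) = (r \in zp p).
Proof. by rewrite [LHS]unfold_in expr0 divr1. Qed.

Lemma pkX k : P ^+ k \in pk p k.
Proof. by apply/pkE; exists 1; rewrite ?rpred1 ?mulr1. Qed.

Lemma pkP : P \in pk p 1.
Proof. exact: (pkX 1). Qed.

Lemma pkM i j x y : x \in pk p i -> y \in pk p j -> x * y \in pk p (i + j).
Proof.
move=> /pkE[c cz ->] /pkE[d dz ->]; apply/pkE; exists (c * d).
  exact: rpredM.
by rewrite exprD; ring.
Qed.

Lemma pkMl k x y : x \in zp p -> y \in pk p k -> x * y \in pk p k.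
Proof. by rewrite -pk0 => xz /(pkM xz). Qed.

Lemma pkMr k x y : x \in pk p k -> y \in zp p -> x * y \in pk p k.
Proof. by move=> xk yz; rewrite mulrC pkMl. Qed.

Lemma pk_le i j x : (j <= i)%N -> x \in pk p i -> x \in pk p j.
Proof.
move=> ji /pkE[c cz ->]; apply/pkE; exists (P ^+ (i - j) * c).
  by rewrite rpredM ?rpredX ?rpred_nat.
by rewrite mulrA -exprD subnKC.
Qed.

Lemma pkW k x : x \in pk p k -> x \in zp p.
Proof. by rewrite -pk0; apply: pk_le. Qed.

Lemma pk_exp i k x : x \in pk p i -> x ^+ k \in pk p (k * i).
Proof.
move=> xi; elim: k => [|k IHk]; first by rewrite mul0n expr0 pk0 rpred1.
by rewrite exprS mulSn pkM.
Qed.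

Lemma zpV_int (z : int) : coprimez p%:Z z -> z%:~R^-1 \in zp p.
Proof.
move=> pz; have z0 : z != 0.
  apply: contraTneq pz => ->.
  by rewrite coprimezE /coprime gcdn0 absz_nat; rewrite gtn_eqF ?prime_gt1 ?p_pr.
apply: (@zp_mul_int p 1 z) => //; by rewrite mulVf // intr_eq0.
Qed.

Lemma zuE x : reflect [/\ x != 0, x \in zp p & x^-1 \in zp p] (x \in zu p).
Proof. exact: and3P. Qed.

Lemma zu_neq0 x : x \in zu p -> x != 0. Proof. by case/zuE. Qed.
Lemma zu_zp x : x \in zu p -> x \in zp p. Proof. by case/zuE. Qed.

Lemma zuM x y : x \in zu p -> y \in zu p -> x * y \in zu p.
Proof.
move=> /zuE[x0 xz xVz] /zuE[y0 yz yVz]; apply/zuE.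
by rewrite mulf_neq0 ?invfM ?rpredM.
Qed.

Lemma zuV x : x \in zu p -> x^-1 \in zu p.
Proof. by move=> /zuE[x0 xz xVz]; apply/zuE; rewrite invr_eq0 invrK. Qed.

Lemma zuN x : x \in zu p -> - x \in zu p.
Proof. by move=> /zuE[x0 xz xVz]; apply/zuE; rewrite oppr_eq0 invrN !rpredN. Qed.

Lemma zu1 : 1 \in zu p.
Proof. by apply/zuE; rewrite invr1 oner_eq0 rpred1. Qed.

Lemma zuX x k : x \in zu p -> x ^+ k \in zu p.
Proof. by move=> xu; elim: k => [|k IHk]; rewrite ?zu1 // exprS zuM. Qed.

Lemma zu_prod I (r : seq I) (Q : pred I) (F : I -> rat) :
  (forall i, Q i -> F i \in zu p) -> \prod_(i <- r | Q i) F i \in zu p.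
Proof. by move=> FQ; apply: (big_ind (fun x => x \in zu p)); [exact: zu1|exact: zuM|]. Qed.

Lemma zu_int (z : int) : coprimez p%:Z z -> z%:~R \in zu p.
Proof.
move=> pz; apply/zuE; split; rewrite ?zpV_int ?zp_int //.
rewrite intr_eq0; apply: contraTneq pz => ->.
by rewrite coprimezE /coprime gcdn0 absz_nat; rewrite gtn_eqF ?prime_gt1 ?p_pr.
Qed.

Lemma zu_nat n : ~~ (p %| n)%N -> n%:R \in zu p.
Proof. by move=> pn; rewrite (@zu_int n) // coprimezE !absz_nat prime_coprime ?p_pr. Qed.

Lemma zu_small n : (0 < n < p)%N -> n%:R \in zu p.
Proof.
by move=> /andP[n0 np]; rewrite zu_nat // gtnNdvd.
Qed.

(** After division by x it remains to treat 1 + p c with c = a / d: the numerator d + p a stays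
    coprime to p. *)
Lemma zuD x y : x \in zu p -> y \in pk p 1 -> x + y \in zu p.
Proof.
suff H z : z \in pk p 1 -> 1 + z \in zu p.
  move=> xu yp; rewrite (_ : x + y = x * (1 + x^-1 * y)); last first.
    by rewrite mulrDr mulr1 mulVKf // zu_neq0.
  by rewrite zuM // H // pkMl // zuV_zp.
move=> /pkE[c cz ->]; rewrite expr1.
have [d pd [d0 [a cd]]] := zp_denq cz.
have E : (d + p%:Z * a)%:~R = d%:~R * (1 + P * c).
  by rewrite rmorphD rmorphM /= -cd; ring.
have du := zu_int pd.
have : (d + p%:Z * a)%:~R \in zu p.
  by rewrite zu_int // /coprimez addrC mulrC gcdzMDl.
rewrite E => /zuM/(_ (zuV du)).
by rewrite mulrAC mulfV ?mul1r // zu_neq0.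
Qed.

Lemma pk_divu k x y : x \in pk p k -> y \in zu p -> x / y \in pk p k.
Proof. by move=> xk yu; rewrite pkMr // zuV_zp. Qed.

Lemma pk_mulu k x y : y \in zu p -> (y * x \in pk p k) = (x \in pk p k).
Proof.
move=> yu; apply/idP/idP => [yx|xk]; last by rewrite pkMl ?zu_zp.
by rewrite -(mulKf (zu_neq0 yu) x) pkMl ?zuV_zp.
Qed.

Lemma eqp_trans k y x z : x - y \in pk p k -> y - z \in pk p k -> x - z \in pk p k.
Proof. by move=> xy yz; rewrite -[x](subrK y) -addrA rpredD. Qed.

Lemma eqp_sym k x y : x - y \in pk p k -> y - x \in pk p k.
Proof. by rewrite -rpredN opprB. Qed.

Lemma eqpM k x y z t : x \in zp p -> t \in zp p ->
  x - y \in pk p k -> z - t \in pk p k -> x * z - y * t \in pk p k.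
Proof.
move=> xz tz xy zt; rewrite (_ : _ - _ = x * (z - t) + (x - y) * t); last by ring.
by apply: rpredD; [exact: pkMl|exact: pkMr].
Qed.

Lemma eqpX k n x y : x \in zp p -> y \in zp p ->
  x - y \in pk p k -> x ^+ n - y ^+ n \in pk p k.
Proof.
move=> xz yz xy; elim: n => [|n IHn]; first by rewrite subrr rpred0.
by rewrite !exprS eqpM ?rpredX.
Qed.

Lemma eqp_zp k x y : x - y \in pk p k -> y \in zp p -> x \in zp p.
Proof. by move=> xy yz; rewrite -(subrK y x) rpredD // (pkW xy). Qed.

Lemma eqp_prod k I (r : seq I) (Q : pred I) (F G : I -> rat) :
  (forall i, Q i -> G i \in zp p) -> (forall i, Q i -> F i - G i \in pk p k) ->
  \prod_(i <- r | Q i) F i - \prod_(i <- r | Q i) G i \in pk p k.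
Proof.
move=> Gz FG; suff [] : \prod_(i <- r | Q i) G i \in zp p /\
  \prod_(i <- r | Q i) F i - \prod_(i <- r | Q i) G i \in pk p k by [].
elim: r => [|i r [IH1 IH2]]; first by rewrite !big_nil subrr rpred0 rpred1.
rewrite !big_cons; case: ifP => // Qi; split; first by rewrite rpredM ?Gz.
by rewrite eqpM ?FG // (eqp_zp (FG _ Qi)) ?Gz.
Qed.

Lemma eqpV k x y : x \in zu p -> y \in zu p -> x - y \in pk p k -> x^-1 - y^-1 \in pk p k.
Proof.
move=> xu yu xy; rewrite -(pk_mulu _ _ xu) -(pk_mulu _ _ yu).
rewrite (_ : _ * _ = y - x); first exact: eqp_sym.
by field; rewrite !zu_neq0.
Qed.

Lemma eqp_zu k x y : (0 < k)%N -> x - y \in pk p k -> y \in zu p -> x \in zu p.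
Proof. by move=> k0 xy yu; rewrite -(subrK y x) addrC zuD // (pk_le k0). Qed.

Lemma zu2 : 2 \in zu p.
Proof. by apply: zu_small; apply: ltn_trans p_gt5. Qed.

(* The logarithm on 1 + p Z_(p), truncated modulo p^3; additive there since p >
   3. *)
Definition ell (x : rat) : rat := (x - 1) - (x - 1) ^+ 2 / 2.

Definition u1 : {pred rat} := fun x => x - 1 \in pk p 1.

Lemma u1_zu x : x \in u1 -> x \in zu p.
Proof. by move=> xu; apply: eqp_zu xu zu1. Qed.

Lemma u1M x y : x \in u1 -> y \in u1 -> x * y \in u1.
Proof.
move=> xu yu; have := eqpM (zu_zp (u1_zu xu)) (rpred1 _) xu yu.
by rewrite mulr1.
Qed.

Lemma u1_1 : 1 \in u1. Proof. by rewrite unfold_in subrr rpred0. Qed.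

Lemma u1V x : x \in u1 -> x^-1 \in u1.
Proof. by move=> xu; have := eqpV (u1_zu xu) zu1 xu; rewrite invr1. Qed.

Lemma u1_prod I (r : seq I) (Q : pred I) (F : I -> rat) :
  (forall i, Q i -> F i \in u1) -> \prod_(i <- r | Q i) F i \in u1.
Proof. by move=> FQ; apply: (big_ind (fun x => x \in u1)); [exact: u1_1|exact: u1M|]. Qed.

Lemma u1X x k : x \in u1 -> x ^+ k \in u1.
Proof. by move=> xu; elim: k => [|k IHk]; rewrite ?u1_1 // exprS u1M. Qed.

Lemma half_pk k x : x \in pk p k -> x / 2 \in pk p k.
Proof. by move=> xk; apply: pk_divu zu2. Qed.

Lemma ell_pk1 x : x \in u1 -> ell x \in pk p 1.
Proof.
move=> xu; rewrite rpredB // half_pk // -[X in pk _ X]mul1n -[1%N]/(1 * 1)%N.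
exact: pk_le (pk_exp 2 xu).
Qed.

Lemma ellM x y : x \in u1 -> y \in u1 -> ell (x * y) - (ell x + ell y) \in pk p 3.
Proof.
move=> xu yu; rewrite /ell.
rewrite (_ : _ - _ = - ((x - 1) * (y - 1) * ((x - 1) + (y - 1)))
   - ((x - 1) ^+ 2 * (y - 1) ^+ 2) / 2); last by field.
rewrite rpredB ?rpredN //; first by apply: (pkM (pkM xu yu)); apply: rpredD.
rewrite half_pk // (@pk_le 4) //; exact: (pkM (pk_exp 2 xu) (pk_exp 2 yu)).
Qed.

Lemma ell1 : ell 1 = 0.
Proof. by rewrite /ell; field. Qed.

Lemma ellV x : x \in u1 -> ell x^-1 + ell x \in pk p 3.
Proof.
move=> xu; rewrite -rpredN -sub0r -ell1 -(mulVf (zu_neq0 (u1_zu xu))).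
exact: ellM (u1V xu) xu.
Qed.

Lemma ell_prod I (r : seq I) (Q : pred I) (F : I -> rat) :
  (forall i, Q i -> F i \in u1) ->
  ell (\prod_(i <- r | Q i) F i) - \sum_(i <- r | Q i) ell (F i) \in pk p 3.
Proof.
move=> FQ; elim: r => [|i r IHr]; first by rewrite !big_nil ell1 subrr rpred0.
rewrite !big_cons; case: ifP => // Qi.
have /(ellM (FQ _ Qi)) : \prod_(j <- r | Q j) F j \in u1 by apply: u1_prod.
move/eqp_trans; apply; rewrite opprD addrACA subrr add0r; exact: IHr.
Qed.

Lemma ellX x k : x \in u1 -> ell (x ^+ k) - k%:R * ell x \in pk p 3.
Proof.
move=> xu; have := @ell_prod _ (index_enum 'I_k) xpredT (fun=> x) (fun _ _ => xu).
by rewrite !(prodr_const, sumr_const) card_ord mulr_natl.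
Qed.

(** The difference of the logarithms is x - y times a unit congruent to 1 modulo p, so 1-units can
    be compared through their logarithms. *)
Lemma ell_inj k x y : (k <= 3)%N -> x \in u1 -> y \in u1 ->
  (ell x - ell y \in pk p k) = (x - y \in pk p k).
Proof.
move=> k3 xu yu; have -> : ell x - ell y = (1 - (x - 1 + (y - 1)) / 2) * (x - y).
  by rewrite /ell; field.
by rewrite pk_mulu // zuD ?zu1 // rpredN half_pk // rpredD.
Qed.

Lemma ell_congr k x y : (k <= 3)%N -> x \in u1 -> y \in u1 ->
  x - y \in pk p k -> ell x - ell y \in pk p k.
Proof. by move=> k3 xu yu; rewrite ell_inj. Qed.

Lemma ell1D x : ell (1 + x) = x - x ^+ 2 / 2.
Proof. by rewrite /ell; field. Qed.

(** * The truncated hypergeometric sum 3F2(1/2, -a, 1 + a; 1, 1; 1) *)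

Definition hterm (a : rat) (k : nat) : rat :=
  \prod_(j < k) ((j%:R + 1 / 2) * (j%:R - a) * (j%:R + 1 + a) / (j%:R + 1) ^+ 3).

Lemma hterm0 a : hterm a 0 = 1.
Proof. exact: big_ord0. Qed.

Lemma htermS a k : hterm a k.+1 =
  hterm a k * ((k%:R + 1 / 2) * (k%:R - a) * (k%:R + 1 + a) / (k%:R + 1) ^+ 3).
Proof. exact: big_ord_recr. Qed.

Lemma hterm_sym a k : hterm (- 1 - a) k = hterm a k.
Proof. by apply: eq_bigr => j _; congr (_ / _); ring. Qed.

Lemma addn_natr_neq0 n k : n%:R + k.+1%:R != 0 :> rat.
Proof. by rewrite -natrD addnS pnatr_eq0. Qed.

(* [hterm a (l + 2)] and [hterm (a - 2) (l + 2)] are multiples of [hcof a l] by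
   quadratic polynomials in [l]. *)
Definition hcof (a : rat) (l : nat) : rat :=
  (\prod_(j < l.+2) ((j%:R + 1 / 2) / (j%:R + 1) ^+ 3)) *
  \prod_(j < l) ((j%:R + 2 - a) * (j%:R + 1 + a)).

Lemma hcof0 a : hcof a 0 = 3 / 32.
Proof. by rewrite /hcof big_ord0 !big_ord_recr big_ord0 /=; field. Qed.

Lemma hcofS a l : hcof a l.+1 = hcof a l *
  ((l%:R + 5 / 2) / (l%:R + 3) ^+ 3 * ((l%:R + 2 - a) * (l%:R + 1 + a))).
Proof.
rewrite /hcof big_ord_recr (big_ord_recr l) /= -!natr1.
by field; rewrite ?addn_natr_neq0.
Qed.

Lemma hterm_hcof a l :
  hterm a l.+2 = hcof a l * (a * (a - 1) * (a + l%:R + 2) * (a + l%:R + 1)).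
Proof.
elim: l => [|l IHl].
  by rewrite hcof0 !htermS hterm0; field.
rewrite htermS IHl hcofS -!natr1.
by field; rewrite ?addn_natr_neq0.
Qed.

Lemma hterm_sub2_hcof a l :
  hterm (a - 2) l.+2 = hcof a l * (a * (a - 1) * (l%:R + 2 - a) * (l%:R + 3 - a)).
Proof.
elim: l => [|l IHl].
  by rewrite hcof0 !htermS hterm0; field.
rewrite htermS IHl hcofS -!natr1.
by field; rewrite ?addn_natr_neq0.
Qed.

(** The right side is the boundary term of the telescoping: its increment in l is the combination of
    the two new terms, both multiples of [hcof]. At l = p - 2 the cube of l + 2 cancels the only
    factors p in the denominators of [hcof]. *)
Lemma hterm_rec a l :
  a ^+ 2 * (\sum_(k < l.+2) hterm a k) - (a - 1) ^+ 2 * (\sum_(k < l.+2) hterm (a - 2) k)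
  = - 2 * (2 * a - 1) * (a * (a - 1)) * (l%:R + 2) ^+ 3 * hcof a l.
Proof.
elim: l => [|l IHl].
  by rewrite hcof0 !big_ord_recr !big_ord0 /= !htermS !hterm0; field.
rewrite !(big_ord_recr l.+2) /=.
rewrite hterm_hcof hterm_sub2_hcof.
rewrite (_ : _ - _ = (a ^+ 2 * (\sum_(k < l.+2) hterm a k)
    - (a - 1) ^+ 2 * (\sum_(k < l.+2) hterm (a - 2) k))
  + hcof a l * (a * (a - 1)) *
    (a ^+ 2 * ((a + l%:R + 2) * (a + l%:R + 1))
     - (a - 1) ^+ 2 * ((l%:R + 2 - a) * (l%:R + 3 - a)))); last by ring.
rewrite IHl hcofS -!natr1.
by field; rewrite ?addn_natr_neq0.
Qed.

Definition hsum (a : rat) : rat := \sum_(k < p) hterm a k.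

(** The map a -> -1 - a exchanges the parameters -a and 1 + a. It connects arguments that steps of
    length 2 alone do not. *)
Lemma hsum_sym a : hsum (- 1 - a) = hsum a.
Proof. by apply: eq_bigr => k _; rewrite hterm_sym. Qed.

Definition hbound (a : rat) : rat :=
  - 2 * (2 * a - 1) * (a * (a - 1)) * P ^+ 3 * hcof a (p - 2).

Lemma hsum_rec a : a ^+ 2 * hsum a - (a - 1) ^+ 2 * hsum (a - 2) = hbound a.
Proof.
have p2 : p = (p - 2).+2 by have := p_gt5; lia.
by rewrite /hsum /hbound [in LHS]p2 hterm_rec [in P]p2 -!natr1; congr (_ * _ * _); ring.
Qed.

Lemma hterm_eq0 n k : (n < k)%N -> hterm n%:R k = 0.
Proof.
move=> nk; rewrite /hterm (bigD1 (Ordinal nk)) //= subrr mulr0.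
by rewrite !mul0r.
Qed.

Lemma hcof_p a : P ^+ 3 * hcof a (p - 2) =
  (\prod_(j < p) (j%:R + 1 / 2)) / (p.-1`!)%:R ^+ 3 *
  \prod_(j < p - 2) ((j%:R + 2 - a) * (j%:R + 1 + a)).
Proof.
have p0 := P_neq0; rewrite /hcof (_ : (p - 2).+2 = p); last by have := p_gt5; lia.
rewrite mulrA; congr (_ * _).
rewrite big_split prodfV prodrXl /= mulrCA; congr (_ * _).
have -> : \prod_(j < p) (j%:R + 1) = (p`!)%:R :> rat.
  by rewrite fact_prod big_add1 big_mkord natr_prod; apply: eq_bigr => j _; rewrite natr1.
have -> : p`! = (p * p.-1`!)%N by rewrite -[in LHS](prednK (prime_gt0 p_pr)) factS prednK ?prime_gt0.
rewrite natrM; field; rewrite p0 /= pnatr_eq0; by rewrite -lt0n fact_gt0.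
Qed.

Lemma zu_fact n : (n < p)%N -> n`!%:R \in zu p.
Proof.
elim: n => [|n IHn] np; first by rewrite fact0 zu1.
by rewrite factS natrM zuM ?IHn ?zu_small //; have := p_gt5; lia.
Qed.

Lemma zu_natS j : (j.+1 < p)%N -> j%:R + 1 \in zu p.
Proof. by move=> jp; rewrite natr1 zu_small. Qed.

Lemma hterm_zp a k : a \in zp p -> (k < p)%N -> hterm a k \in zp p.
Proof.
move=> az kp; apply: zp_prod => j _; rewrite rpredM //.
  by zpt; exact: zu2.
by rewrite zuV_zp // zuX // zu_natS // (leq_ltn_trans (ltn_ord j)).
Qed.

Lemma eqp_hterm i a b k : a \in zp p -> b \in zp p -> (k < p)%N ->
  a - b \in pk p i -> hterm a k - hterm b k \in pk p i.
Proof.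
move=> az bz kp ab; apply: eqp_prod => j _.
  rewrite rpredM //.
    by zpt; exact: zu2.
  by rewrite zuV_zp // zuX // zu_natS // (leq_ltn_trans (ltn_ord j)).
rewrite -mulrBl pk_divu //; last first.
  by rewrite zuX // zu_natS // (leq_ltn_trans (ltn_ord j)).
rewrite -!mulrA -mulrBr pkMl //.
  by zpt; exact: zu2.
rewrite (_ : _ - _ = - (a - b) * (1 + a + b)); last by ring.
by rewrite pkMr ?rpredN //; zpt.
Qed.

Lemma hsum_zp a : a \in zp p -> hsum a \in zp p.
Proof. by move=> az; apply: rpred_sum => k _; apply: hterm_zp. Qed.

Lemma eqp_hsum i a b : a \in zp p -> b \in zp p ->
  a - b \in pk p i -> hsum a - hsum b \in pk p i.
Proof.
by move=> az bz ab; rewrite /hsum -sumrB; apply: rpred_sum => k _; apply: eqp_hterm.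
Qed.

Lemma half_prod n :
  \prod_(j < n) (j%:R + 1 / 2) = ('C(n.*2, n) * n`!)%:R / 4 ^+ n :> rat.
Proof.
elim: n => [|n IHn]; first by rewrite big_ord0 double0 bin0.
have n1 : n.+1%:R != 0 :> rat by rewrite pnatr_eq0.
have H : ('C(n.+1.*2, n.+1) * n.+1`!)%:R = 2 * (2 * n%:R + 1) * ('C(n.*2, n) * n`!)%:R :> rat.
  have b : ('C(n.+1.*2, n.+1) * n.+1`! * n.+1`! = (n.+1.*2)`!)%N.
    by rewrite -mulnA -[X in (_ * (_ * X))%N](congr1 factorial (_ : n.+1.*2 - n.+1 = n.+1)%N) ?bin_fact //; have := p_gt5; lia.
  have c : ('C(n.*2, n) * n`! * n`! = (n.*2)`!)%N.
    by rewrite -mulnA -[X in (_ * (_ * X))%N](congr1 factorial (_ : n.*2 - n = n)%N) ?bin_fact //; have := p_gt5; lia.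
  have d : n.+1`!%:R != 0 :> rat by rewrite pnatr_eq0 -lt0n fact_gt0.
  apply: (mulIf d); rewrite -[LHS]natrM b doubleS !factS -c !natrM -!natr1 -mul2n natrM; ring.
rewrite big_ord_recr /= IHn H exprS; field.
by rewrite expf_neq0.
Qed.

Lemma zu4 : 4 \in zu p.
Proof. by rewrite (_ : 4 = 2 * 2) // zuM ?zu2. Qed.

Lemma half_prod_p :
  \prod_(j < p) (j%:R + 1 / 2) = P * ('C(p.*2, p))%:R * (p.-1)`!%:R / 4 ^+ p :> rat.
Proof.
have pE : p`! = (p * p.-1`!)%N by rewrite -[in LHS](prednK (prime_gt0 p_pr)) factS prednK ?prime_gt0.
by rewrite half_prod pE !natrM; ring.
Qed.

Lemma half_prod_pk1 : \prod_(j < p) (j%:R + 1 / 2) \in pk p 1.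
Proof.
by rewrite half_prod_p pk_divu ?zuX ?zu4 // -mulrA pkMr ?pkP // rpredM ?rpred_nat.
Qed.

(** The three factors p: j = (p - 1) / 2 in the product of half-integers, j = n - 2 giving -p t, and
    j = p - n - 1 giving p (1 + t). The last two indices lie in range because 1 < n < p. *)
Lemma hbound_pk3 n t : (1 < n < p)%N -> t \in zp p ->
  hbound (n%:R + P * t) \in pk p 3.
Proof.
move=> n1p tz; rewrite /hbound -mulrA hcof_p.
have az : n%:R + P * t \in zp p by zpt.
rewrite pkMl //; first by zpt.
rewrite (_ : 3%N = (1 + 2)%N) // pkM //.
  by rewrite pk_divu ?half_prod_pk1 // zuX // zu_fact //; have := p_gt5; lia.
rewrite big_split /= (_ : 2%N = (1 + 1)%N) // pkM //.
  have lt : (n - 2 < p - 2)%N by have := p_gt5; lia.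
  rewrite (bigD1 (Ordinal lt)) //= pkMr //.
    rewrite natrB; last by have := p_gt5; lia.
    by rewrite (_ : _ - _ = - (P * t)) ?rpredN ?pkMr ?pkP //; ring.
  by apply: zp_prod => j _; zpt.
have lt : (p - n - 1 < p - 2)%N by have := p_gt5; lia.
rewrite (bigD1 (Ordinal lt)) //= pkMr //.
  rewrite natrB; last by have := p_gt5; lia.
  rewrite natrB; last by have := p_gt5; lia.
  by rewrite (_ : _ + _ = P * (1 + t)) ?pkMr ?pkP ?rpredD ?rpred1 //; ring.
by apply: zp_prod => j _; zpt.
Qed.

Lemma hsum_down n t : (1 < n < p)%N -> t \in zp p ->
  hsum (n%:R + P * t)
  - ((n%:R - 1 + P * t) / (n%:R + P * t)) ^+ 2 * hsum (n%:R - 2 + P * t) \in pk p 3.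
Proof.
move=> n1p tz; have au : n%:R + P * t \in zu p.
  by rewrite zuD ?pkMr ?pkP // zu_small; have := p_gt5; lia.
have := hbound_pk3 n1p tz; rewrite -hsum_rec => H.
rewrite -(pk_mulu _ _ (zuX 2 au)).
rewrite (_ : n%:R - 1 + P * t = n%:R + P * t - 1); last by ring.
rewrite (_ : n%:R - 2 + P * t = n%:R + P * t - 2); last by ring.
rewrite [X in X \in _](_ : _ = (n%:R + P * t) ^+ 2 * hsum (n%:R + P * t) -
  (n%:R + P * t - 1) ^+ 2 * hsum (n%:R + P * t - 2)) //.
by field; exact: zu_neq0 au.
Qed.

(** At an integer argument one factor of the boundary term is exactly 0, so the recursion holds over
    the rationals. *)
Lemma hsum_nat_rec n : (1 < n < p)%N ->
  n%:R ^+ 2 * hsum n%:R = (n%:R - 1) ^+ 2 * hsum (n%:R - 2).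
Proof.
move=> n1p; apply/eqP; rewrite -subr_eq0 hsum_rec /hbound -mulrA hcof_p.
have lt : (n - 2 < p - 2)%N by have := p_gt5; lia.
rewrite (bigD1 (Ordinal lt)) //= natrB; last by have := p_gt5; lia.
by rewrite subrK subrr !(mul0r, mulr0).
Qed.

(** * The congruences of Wolstenholme and Morley *)

Lemma big_ord_double (R : Type) (idx : R) (op : Monoid.com_law idx) n (F : nat -> R) :
  \big[op/idx]_(i < n.*2) F i = op (\big[op/idx]_(i < n) F i.*2) (\big[op/idx]_(i < n) F i.*2.+1).
Proof.
elim: n => [|n IHn]; first by rewrite double0 !big_ord0 Monoid.mul1m.
by rewrite doubleS !big_ord_recr IHn /= -Monoid.mulmA Monoid.mulmACA.
Qed.

Lemma big_ord_rev (R : Type) (idx : R) (op : Monoid.com_law idx) n (F : nat -> R) :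
  \big[op/idx]_(i < n) F i = \big[op/idx]_(i < n) F (n - i.+1)%N.
Proof. by rewrite (reindex_inj rev_ord_inj). Qed.

Definition hs (k n : nat) : rat := \sum_(i < n) i.+1%:R ^- k.

Lemma hs_zp k n : (n < p)%N -> hs k n \in zp p.
Proof.
move=> np; apply: zp_sum => i _; zpt; apply: zuX; apply: zu_small.
by have := ltn_ord i; lia.
Qed.


Lemma p_half : p = h.*2.+1.
Proof.
have op : odd p by case: (even_prime p_pr) => // p2; have := p_gt5; rewrite p2.
by rewrite -{1}[p]odd_double_half op.
Qed.

Lemma pk_rev k r : (0 < r < p)%N -> (p - r)%:R ^- k - (- r%:R) ^- k \in pk p 1.
Proof.
move=> rp; have rpu : (p - r)%:R \in zu p by rewrite zu_small //; lia.
have ru := zu_small rp.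
apply: eqpV; [exact: zuX|by apply/zuX/zuN|].
apply: eqpX; [exact: zp_nat|by apply/zpN/zp_nat|].
by rewrite natrB; [rewrite opprK subrK pkP|lia].
Qed.

Lemma sqr_rev r : (0 < r < p)%N -> (p - r)%:R ^- 2 - r%:R ^- 2 \in pk p 1.
Proof. by move=> /(pk_rev 2); rewrite sqrrN. Qed.

Lemma inv_rev r : (0 < r < p)%N ->
  (p - r)%:R^-1 + r%:R^-1 + P * r%:R ^- 2 \in pk p 2.
Proof.
move=> rp; have ru := zu_small rp.
have su : (p - r)%:R \in zu p by apply: zu_small; lia.
rewrite [X in X \in _](_ : _ = P ^+ 2 / (r%:R ^+ 2 * (p - r)%:R)).
  by apply: pk_divu; [exact: (pkX 2)|exact: zuM (zuX 2 ru) su].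
have := zu_neq0 ru; have := zu_neq0 su; rewrite natrB; last by lia.
by move: (r%:R : rat) => x x0 y0; field; rewrite x0 y0.
Qed.

Lemma inv_double_sqr r : r.*2%:R ^- 2 = r%:R ^- 2 / 4 :> rat.
Proof. by rewrite -mul2n natrM exprMn invfM mulrC; congr (_ * _); field. Qed.

Lemma hs2_odd n : \sum_(i < n) i.*2.+1%:R ^- 2 = hs 2 n.*2 - hs 2 n / 4 :> rat.
Proof.
rewrite /hs (big_ord_double _ n (fun i => i.+1%:R ^- 2 : rat)) /=.
rewrite [X in _ + X - _](_ : _ = (\sum_(i < n) i.+1%:R ^- 2) / 4) ?addrK //.
by rewrite mulr_suml; apply: eq_bigr => i _; rewrite -doubleS inv_double_sqr.
Qed.

(** Two linear relations modulo p come from r -> p - r: odd residues pair with even ones, and the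
    upper half with the lower half. Together they kill 3/2 times the half sum, and 3 is a unit. *)
Lemma hs2_half : hs 2 h \in pk p 1 /\ hs 2 p.-1 \in pk p 1.
Proof.
have ph := p_half; have pm1 : p.-1 = h.*2 by rewrite {1}ph.
have E1 : \sum_(i < h) i.*2.+1%:R ^- 2 - hs 2 h / 4 \in pk p 1.
  rewrite (big_ord_rev _ h (fun i => i.*2.+1%:R ^- 2 : rat)) mulr_suml -sumrB; apply: rpred_sum => i _.
  rewrite -inv_double_sqr (_ : (h - i.+1).*2.+1 = p - i.+1.*2)%N; last first.
    by have := ltn_ord i; lia.
  by apply: sqr_rev; have := ltn_ord i; lia.
have E2 : hs 2 p.-1 - hs 2 h *+ 2 \in pk p 1.
  rewrite pm1 -addnn /hs big_split_ord /= mulr2n opprD addrACA subrr add0r.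
  rewrite (big_ord_rev _ h (fun i => (h + i).+1%:R ^- 2 : rat)) -sumrB; apply: rpred_sum => i _.
  rewrite (_ : (h + (h - i.+1)).+1 = p - i.+1)%N; last first.
    by have := ltn_ord i; lia.
  by apply: sqr_rev; have := ltn_ord i; lia.
move: E1; rewrite hs2_odd -pm1 => E1.
have H : hs 2 h \in pk p 1.
  have u3 : 3 \in zu p by apply: zu_small; have := p_gt5; lia.
  have := rpredB E1 E2; rewrite (_ : _ - _ = (3 / 2) * hs 2 h); last by field.
  by rewrite pk_mulu // zuM // zuV // zu2.
by split=> //; rewrite -(subrK (hs 2 h *+ 2) (hs 2 p.-1)) rpredD // mulr2n rpredD.
Qed.

Lemma ell_small x : x \in pk p 2 -> ell (1 + x) - x \in pk p 3.
Proof.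
move=> x2; rewrite ell1D addrAC subrr add0r rpredN half_pk //.
by apply: (@pk_le 4) => //; apply: (pk_exp 2 x2).
Qed.

Lemma u1D x : x \in pk p 1 -> 1 + x \in u1.
Proof. by move=> x1; rewrite unfold_in addrC addKr. Qed.

Lemma ell_prod_small n (F : nat -> rat) :
  (forall i, (i < n)%N -> F i \in pk p 2) -> \sum_(i < n) F i \in pk p 3 ->
  ell (\prod_(i < n) (1 + F i)) \in pk p 3.
Proof.
move=> F2 sF.
have Fu : forall i : 'I_n, true -> 1 + F i \in u1.
  by move=> i _; apply: u1D; apply: (@pk_le 2) => //; apply: F2.
have := ell_prod (index_enum 'I_n) Fu; move/(eqp_trans) => /(_ (\sum_(i < n) F i)) H.
rewrite -(subrK (\sum_(i < n) F i) (ell _)) rpredD // H // -sumrB.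
by apply: rpred_sum => i _; apply: ell_small; apply: F2.
Qed.

Lemma ell_eq1 x : x \in u1 -> ell x \in pk p 3 -> x - 1 \in pk p 3.
Proof. by move=> xu xe; rewrite -ell_inj ?u1_1 ?ell1 ?subr0. Qed.

Lemma bin_p2_prod : 'C(p.*2, p)%:R = 2 * \prod_(i < p.-1) (1 + P / i.+1%:R) :> rat.
Proof.
have f0 n : n`!%:R != 0 :> rat by rewrite pnatr_eq0 -lt0n fact_gt0.
have F n : \prod_(i < n) i.+1%:R = n`!%:R :> rat.
  by rewrite fact_prod big_add1 big_mkord natr_prod.
have pE : p = p.-1.+1 by rewrite prednK ?prime_gt0.
have p0 := f0 p.
have E n : \prod_(i < n) (P + i.+1%:R) = (p + n)`!%:R / p`!%:R.
  elim: n => [|n IHn]; first by rewrite big_ord0 addn0 divff.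
  by rewrite big_ord_recr /= IHn addnS factS natrM -addnS natrD; field.
have -> : \prod_(i < p.-1) (1 + P / i.+1%:R) = (p + p.-1)`!%:R / p`!%:R / p.-1`!%:R.
  rewrite -E -F -prodf_div; apply: eq_bigr => i _.
  by rewrite mulrDl divff ?pnatr_eq0 // addrC.
have B : ('C(p.*2, p) * p`! * p`! = (p.*2)`!)%N.
  by rewrite -mulnA -[X in (_ * (_ * X))%N](congr1 factorial (_ : p.*2 - p = p)%N) ?bin_fact //; lia.
have D : (p.*2)`! = (2 * p * (p + p.-1)`!)%N.
  by rewrite -[in LHS]addnn {2}pE addnS factS -addnS -pE mul2n addnn.
have E2 : p`!%:R = P * p.-1`!%:R by rewrite {1}pE factS -pE natrM.
apply: (mulIf p0); apply: (mulIf p0); rewrite -[X in X * _ = _]natrM -[LHS]natrM B D !natrM E2.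
by field; rewrite f0 P_neq0.
Qed.

(** Multiplied by its own reversal, the product has factors 1 + 2 p^2 / (i (p - i)). Their
    logarithms already have order p^2, so only the sum of i^-2 modulo p matters. *)
Lemma wolstenholme : \prod_(i < p.-1) (1 + P / i.+1%:R) - 1 \in pk p 3.
Proof.
set W := \prod_(i < _) _.
have ru i : (i < p.-1)%N -> i.+1%:R \in zu p by move=> ip; apply: zu_small; lia.
have Wu : W \in u1.
  by apply: u1_prod => i _; apply: u1D; rewrite pk_divu ?pkP ?ru.
apply: ell_eq1 => //.
have := ellM Wu Wu.
pose F i : rat := 2 * P ^+ 2 / (i.+1%:R * (p - i.+1)%:R).
have rv i : (i < p.-1)%N -> (p - i.+1)%:R \in zu p by move=> ip; apply: zu_small; lia.
have -> : W * W = \prod_(i < p.-1) (1 + F i).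
  rewrite {2}/W (big_ord_rev _ p.-1 (fun i => 1 + P / i.+1%:R)) -big_split /=.
  apply: eq_bigr => i _; have ip := ltn_ord i.
  rewrite (_ : (p.-1 - i.+1).+1 = p - i.+1)%N; last by lia.
  have := zu_neq0 (ru i ip); have := zu_neq0 (rv i ip).
  rewrite /F natrB; last by lia.
  by move=> q1 q2; field; rewrite !nat1r q1 q2.
have F2 i : (i < p.-1)%N -> F i \in pk p 2.
  move=> ip; rewrite /F pk_divu ?zuM ?ru ?rv // pkMl ?zp_nat //; exact: (pkX 2).
move=> H; have : ell (\prod_(i < p.-1) (1 + F i)) \in pk p 3.
  apply: ell_prod_small => //; rewrite /F -mulr_sumr -mulrA pkMl ?zp_nat //.
  apply: (@pkM 2 1); first exact: (pkX 2).
  rewrite -(subrK (- hs 2 p.-1) (\sum_(i < _) _)) rpredD ?rpredN ?hs2_half.2 //.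
  rewrite opprK /hs -big_split; apply: rpred_sum => i _ /=; have ip := ltn_ord i.
  have rp : (0 < p - i.+1 < p)%N by lia.
  have -> : (i.+1%:R * (p - i.+1)%:R)^-1 + i.+1%:R ^- 2 = P / (i.+1%:R ^+ 2 * (p - i.+1)%:R) :> rat.
    have := zu_neq0 (ru i ip); have := zu_neq0 (rv i ip).
    rewrite natrB; last by lia.
    by move=> q1 q2; field; rewrite !nat1r q1 q2.
  by rewrite pk_divu ?pkP // zuM ?zuX ?ru ?rv.
move=> H2; have := rpredB H2 H; rewrite opprB addrC subrK -mulr2n -mulr_natl.
by rewrite pk_mulu ?zu2.
Qed.

Lemma bin_p2 : 'C(p.*2, p)%:R - 2 \in pk p 3.
Proof.
rewrite bin_p2_prod -[X in _ - X]mulr1 -mulrBr pkMl ?zp_nat //.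
exact: wolstenholme.
Qed.

(** Double the numbers 1, ..., p - 1: the lower half gives the even numbers below p, the upper half
    gives p plus the odd numbers below p. *)
Lemma two_pow_prod :
  2 ^+ p.-1 = \prod_(i < h) (1 + P / i.*2.+1%:R) :> rat.
Proof.
have pm1 : p.-1 = h.*2 by have := p_half; lia.
have ru n : n.+1%:R != 0 :> rat by rewrite pnatr_eq0.
have E : \prod_(j < p.-1) (2 * j.+1%:R) = 2 ^+ p.-1 * (\prod_(i < h) i.*2.+1%:R) * \prod_(i < h) i.*2.+2%:R :> rat.
  by rewrite big_split /= prodr_const card_ord pm1 -mulrA (big_ord_double _ h (fun i => i.+1%:R : rat)).
have n0 (f : nat -> nat) : \prod_(i < h) (f i).+1%:R != 0 :> rat by apply/prodf_neq0.
apply: (mulIf (n0 (fun i => i.*2))); apply: (mulIf (n0 (fun i => i.*2.+1))).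
rewrite -E pm1 -addnn big_split_ord /= mulrC; congr (_ * _).
  rewrite -big_split /=; apply: eq_bigr => i _.
  rewrite [RHS]mulrDl divfK ?ru // mul1r -natrM -natrD; congr (_%:R).
  by have := p_half; lia.
by apply: eq_bigr => i _; rewrite -natrM; congr (_%:R); lia.
Qed.

(** With r running over the odd numbers below p, the product is that of (r / (p - r))^2 and 4^(p-1)
    is that of ((p + r) / r)^2. Their quotient involves only the factors 1 - p^2 / r^2. *)
Lemma morley :
  \prod_(i < h) (i.*2.+1%:R / i.*2.+2%:R) ^+ 2 - 4 ^+ p.-1 \in pk p 3.
Proof.
have Yu : 2 ^+ p.-1 \in u1.
  rewrite two_pow_prod; apply: u1_prod => i _; apply: u1D; rewrite pk_divu ?pkP //.
  by apply: zu_small; have := p_half; have := ltn_ord i; lia.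
have Y4 : 4 ^+ p.-1 = (2 ^+ p.-1) ^+ 2 :> rat by rewrite -exprM mulnC exprM.
pose F i : rat := - P ^+ 2 / i.*2.+1%:R ^+ 2.
have ru i : (i < h)%N -> i.*2.+1%:R \in zu p.
  by move=> ih; apply: zu_small; have := p_half; lia.
have F2 i : (i < h)%N -> F i \in pk p 2.
  by move=> ih; rewrite /F pk_divu ?zuX ?ru // rpredN (pkX 2).
have Fe : ell (\prod_(i < h) (1 + F i)) \in pk p 3.
  apply: ell_prod_small => //; rewrite /F -mulr_sumr.
  apply: (@pkM 2 1); first by rewrite rpredN (pkX 2).
  have [H1 H2] := hs2_half.
  have pm1 : p.-1 = h.*2 by have := p_half; lia.
  by rewrite hs2_odd -pm1 rpredB // pk_divu ?zu4.
have Gu : \prod_(i < h) (1 + F i) \in u1.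
  by apply: u1_prod => i _; apply: u1D; apply: (@pk_le 2) => //; apply: F2.
have G1 := ell_eq1 Gu Fe.
have -> : \prod_(i < h) (i.*2.+1%:R / i.*2.+2%:R) ^+ 2 = 4 ^+ p.-1 * (\prod_(i < h) (1 + F i)) ^- 2.
  have -> : \prod_(i < h) (i.*2.+1%:R / i.*2.+2%:R) ^+ 2
      = \prod_(i < h) (i.*2.+1%:R / (P - i.*2.+1%:R)) ^+ 2 :> rat.
    rewrite !prodrXl !prodf_div; congr ((_ / _) ^+ 2).
    rewrite (big_ord_rev _ h (fun i => i.*2.+2%:R : rat)); apply: eq_bigr => i _.
    by rewrite -natrB; [congr (_%:R)|]; have := p_half; have := ltn_ord i; lia.
  rewrite Y4 two_pow_prod -prodrXl -exprVn -prodfV -prodrXl -big_split /=.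
  apply: eq_bigr => i _; have ih := ltn_ord i; rewrite /F.
  have r0 := zu_neq0 (ru i ih).
  have d0 : P - i.*2.+1%:R != 0.
    by rewrite subr_eq0 eqr_nat; have := p_half; lia.
  have s0 : P + i.*2.+1%:R != 0 by rewrite -natrD pnatr_eq0 addnS.
  move: (i.*2.+1%:R : rat) r0 d0 s0 => r r0 d0 s0.
  have -> : 1 + - P ^+ 2 / r ^+ 2 = - (P - r) * (P + r) / r ^+ 2 by field.
  by field; rewrite r0 d0 s0.
have G2 : (\prod_(i < h) (1 + F i)) ^- 2 - 1 \in pk p 3.
  have Gz := u1_zu Gu; move: (\prod_(i < h) (1 + F i)) G1 Gz => G G1 Gz.
  rewrite (_ : _ - _ = - (G - 1) * ((1 + G) / G ^+ 2)); last first.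
    by field; apply: zu_neq0 Gz.
  by rewrite pkMr ?rpredN //; zpt; rewrite ?(zu_zp Gz) ?zuX.
rewrite -[X in _ - X]mulr1 -mulrBr pkMl //; zpt.
Qed.

Lemma hs1_p : hs 1 p.-1 \in pk p 2.
Proof.
have [_ H2] := hs2_half.
have H : hs 1 p.-1 + hs 1 p.-1 + P * hs 2 p.-1 \in pk p 2.
  rewrite {1}/hs (big_ord_rev _ p.-1 (fun i => i.+1%:R ^- 1 : rat)) mulr_sumr -!big_split.
  apply: rpred_sum => i _ /=; have ip := ltn_ord i; rewrite !expr1.
  by rewrite (_ : (p.-1 - i.+1).+1 = p - i.+1)%N; [apply: inv_rev|]; lia.
have := pkB H (pkM pkP H2); rewrite addrK -mulr2n -mulr_natl.
by rewrite pk_mulu ?zu2.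
Qed.

Lemma hs_rev k : (k < p)%N ->
  hs 1 (p.-1 - k) - (hs 1 k + P * hs 2 k) \in pk p 2 /\
  hs 2 (p.-1 - k) + hs 2 k \in pk p 1.
Proof.
move=> kp; have S j : hs j p.-1 = hs j (p.-1 - k) + \sum_(i < k) (p - i.+1)%:R ^- j.
  rewrite -[in LHS](subnK (_ : k <= p.-1)%N); last by lia.
  rewrite [LHS]big_split_ord /=; congr (_ + _).
  rewrite (big_ord_rev _ k (fun i => (p.-1 - k + i).+1%:R ^- j : rat)); apply: eq_bigr => i _.
  by congr (_%:R ^- j); have := ltn_ord i; lia.
have [_ H2] := hs2_half; have H1 := hs1_p; split.
  have R : \sum_(i < k) (p - i.+1)%:R ^- 1 + hs 1 k + P * hs 2 k \in pk p 2.
    rewrite mulr_sumr -!big_split; apply: rpred_sum => i _ /=; rewrite !expr1.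
    by apply: inv_rev; have := ltn_ord i; lia.
  rewrite S in H1; have := pkB H1 R.
  rewrite [X in X \in _ -> _](_ : _ = hs 1 (p.-1 - k) - (hs 1 k + P * hs 2 k)) //.
  by move: (hs _ _) (hs _ _) (hs _ _) (\sum_(i < k) _) => *; ring.
have R : \sum_(i < k) (p - i.+1)%:R ^- 2 - hs 2 k \in pk p 1.
  rewrite -sumrB; apply: rpred_sum => i _ /=.
  by apply: sqr_rev; have := ltn_ord i; lia.
rewrite S in H2; have := pkB H2 R.
rewrite [X in X \in _ -> _](_ : _ = hs 2 (p.-1 - k) + hs 2 k) //.
by move: (hs _ _) (hs _ _) (\sum_(i < k) _) => *; ring.
Qed.

(** * Values of the hypergeometric sum at integers and p-adically near 0 and 1 *)

Lemma natr_sub1 n : (0 < n)%N -> n%:R - 1 = n.-1%:R :> rat.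
Proof. by case: n => // n _; rewrite -natr1 addrK. Qed.

Lemma natr_sub2 n : (1 < n)%N -> n%:R - 2 = n.-2%:R :> rat.
Proof. by case: n => [|[|n]] // _; rewrite -!natr1 -addrA addrK. Qed.

Lemma hsum0 : hsum 0 = 1.
Proof.
rewrite /hsum -(prednK (prime_gt0 p_pr)) big_ord_recl hterm0 big1 ?addr0 // => i _.
exact: (@hterm_eq0 0).
Qed.

Lemma hsum1 : hsum 1 = 0.
Proof.
rewrite /hsum (_ : p = (p - 2).+2); last by have := p_gt5; lia.
rewrite !big_ord_recl big1 ?addr0 => [|i _]; last exact: (@hterm_eq0 1).
by rewrite /= htermS !hterm0; field.
Qed.

Lemma hsum_nat s m : (s + m.*2 < p)%N ->
  hsum (s + m.*2)%:R =
  (\prod_(i < m) ((s + i.*2.+1)%:R / (s + i.*2.+2)%:R)) ^+ 2 * hsum s%:R.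
Proof.
elim: m => [|m IHm] smp; first by rewrite big_ord0 double0 addn0 expr1n mul1r.
have r : (1 < s + m.+1.*2 < p)%N by lia.
have d0 : (s + m.*2.+2)%:R != 0 :> rat by rewrite pnatr_eq0 !addnS.
have := hsum_nat_rec r.
rewrite (_ : (s + m.+1.*2)%:R - 1 = (s + m.*2.+1)%:R); last first.
  by rewrite doubleS !addnS natr_sub1.
rewrite (_ : (s + m.+1.*2)%:R - 2 = (s + m.*2)%:R); last first.
  by rewrite doubleS !addnS natr_sub2.
rewrite doubleS => E; apply: (mulfI (expf_neq0 2 d0)); rewrite addnS in d0 E *.
rewrite big_ord_recr /= E IHm; last by lia.
rewrite (addnS s m.*2.+1); move: (\prod_(i < m) _) (hsum _) => pr x.
by move: (_%:R) d0 => r0 d0; field.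
Qed.

Lemma hsum_even_nat m : (m.*2 < p)%N ->
  hsum m.*2%:R = \prod_(i < m) (i.*2.+1%:R / i.*2.+2%:R) ^+ 2.
Proof. by move=> mp; rewrite (@hsum_nat 0 m) // hsum0 mulr1 prodrXl. Qed.

Lemma hsum_odd_nat m : (m.*2.+1 < p)%N -> hsum m.*2.+1%:R = 0.
Proof. by move=> mp; rewrite (@hsum_nat 1 m) // hsum1 mulr0. Qed.

Lemma hsum_shift s m t : (s + m.*2 < p)%N -> t \in zp p ->
  hsum ((s + m.*2)%:R + P * t)
  - (\prod_(i < m) (((s + i.*2.+1)%:R + P * t) / ((s + i.*2.+2)%:R + P * t))) ^+ 2
    * hsum (s%:R + P * t) \in pk p 3.
Proof.
move=> smp tz; elim: m smp => [|m IHm] smp.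
  by rewrite big_ord0 double0 addn0 expr1n mul1r subrr rpred0.
have r : (1 < s + m.+1.*2 < p)%N by lia.
apply: eqp_trans (hsum_down r tz) _.
rewrite (_ : (s + m.+1.*2)%:R - 1 = (s + m.*2.+1)%:R); last first.
  by rewrite doubleS !addnS natr_sub1.
rewrite (_ : (s + m.+1.*2)%:R - 2 = (s + m.*2)%:R); last first.
  by rewrite doubleS !addnS natr_sub2.
rewrite big_ord_recr /= doubleS.
set q := (_ + _) / _; set pr := \prod_(i < m) _; set x := hsum _; set y := hsum _.
rewrite (_ : _ - _ = q ^+ 2 * (x - pr ^+ 2 * y)); last by ring.
rewrite pkMl //; last by apply: IHm; lia.
by rewrite /q; zpt; rewrite zuD ?pkMr ?pkP // zu_small //; lia.
Qed.

(** At a = p the boundary term for p + 1 terms vanishes, and so does S(p - 2) because p - 2 is odd.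
    Hence S(p) is the negative of the term of index p, which makes it C(2p, p)^2 / 4^p. *)
Lemma hsum_p : hsum P - 4 ^- p.-1 \in pk p 3.
Proof.
have p1 : p.-1.+2 = p.+1 by rewrite prednK ?prime_gt0.
have E : hsum P = - hterm P p.
  have c0 : hcof P p.-1 = 0.
    have lt : (p - 2 < p.-1)%N by have := p_gt5; lia.
    rewrite /hcof [X in _ * X](bigD1 (Ordinal lt)) //= natrB; last by have := p_gt5; lia.
    by rewrite subrK subrr !(mul0r, mulr0).
  have := hterm_rec P p.-1; rewrite c0 mulr0 p1 !big_ord_recr /= -!/(hsum _).
  have -> : P - 2 = (h.-1).*2.+1%:R.
    by rewrite natr_sub2; [congr (_%:R)|]; have := p_half; have := p_gt5; lia.
  rewrite hsum_odd_nat; last by have := p_half; have := p_gt5; lia.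
  rewrite (@hterm_eq0 (h.-1).*2.+1 p); last by have := p_half; have := p_gt5; lia.
  rewrite addr0 mulr0 subr0 => /eqP.
  by rewrite mulf_eq0 expf_eq0 /= (negPf P_neq0) /= addr_eq0 => /eqP.
have f0 n : n`!%:R != 0 :> rat by rewrite pnatr_eq0 -lt0n fact_gt0.
have F n : \prod_(i < n) (i%:R + 1) = n`!%:R :> rat.
  by rewrite fact_prod big_add1 big_mkord natr_prod; apply: eq_bigr => i _; rewrite natr1.
have G n : \prod_(i < n) (i%:R + 1 + P) = (p + n)`!%:R / p`!%:R.
  elim: n => [|n IHn]; first by rewrite big_ord0 addn0 divff.
  rewrite big_ord_recr /= IHn addnS factS natrM -addnS natrD -natr1.
  by move: (f0 p) => f0p; field.
have M : \prod_(j < p) (j%:R - P) = - p`!%:R.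
  rewrite -F [RHS](_ : _ = (-1) ^+ p * \prod_(i < p) (i%:R + 1)); last first.
    by rewrite -signr_odd p_half /= odd_double /= expr1 mulN1r.
  rewrite (big_ord_rev _ p (fun j => j%:R - P)) -[X in _ ^+ X]card_ord -prodr_const -big_split.
  by apply: eq_bigr => i _ /=; rewrite natrB ?ltn_ord // -natr1; ring.
have B : 'C(p.*2, p)%:R * p`!%:R * p`!%:R = (p + p)`!%:R :> rat.
  rewrite -!natrM addnn; congr (_%:R).
  by rewrite -mulnA -[X in (_ * (_ * X))%N](congr1 factorial (_ : p.*2 - p = p)%N) ?bin_fact //; lia.
have T : hterm P p = - ('C(p.*2, p)%:R ^+ 2 / 4 ^+ p).
  rewrite /hterm big_split prodfV prodrXl F !big_split half_prod natrM M G -B /=.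
  by move: (f0 p) => f0p; field; rewrite f0p expf_neq0.
rewrite E T opprK (_ : 4 ^- p.-1 = 4 / 4 ^+ p); last first.
  rewrite -[in X in _ = X](prednK (prime_gt0 p_pr)) exprS.
  by field; rewrite expf_neq0.
rewrite -mulrBl pk_divu ?zuX ?zu4 //.
rewrite (_ : _ - _ = ('C(p.*2, p)%:R - 2) * ('C(p.*2, p)%:R + 2)); last by ring.
by rewrite pkMr ?bin_p2 //; zpt.
Qed.

Lemma pow4_u1 : 4 ^+ p.-1 \in u1.
Proof.
rewrite (_ : 4 = 2 ^+ 2) // -exprM mulnC exprM u1X // two_pow_prod.
apply: u1_prod => i _; apply: u1D; rewrite pk_divu ?pkP //.
by apply: zu_small; have := p_half; have := ltn_ord i; lia.
Qed.

(** By symmetry this is S(p - 1), an exact product at an even integer, to which Morley's congruence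
    applies. *)
Lemma hsum_Np : hsum (- P) - 4 ^+ p.-1 \in pk p 3.
Proof.
rewrite -hsum_sym (_ : -1 - - P = (h.*2)%:R); last first.
  by rewrite opprK addrC natr_sub1 ?prime_gt0 //; congr (_%:R); have := p_half; lia.
by rewrite hsum_even_nat ?morley //; have := p_half; lia.
Qed.

(** Regrouped, the product of (j - x) (j + 1 + x) over j <= k is -x (k + 1 + x) times factors j^2 -
    x^2, that is -x (k + 1 + x) k!^2 modulo x^3. *)
Lemma hterm_small k x : (k.+1 < p)%N -> x \in pk p 1 ->
  hterm x k.+1 + (\prod_(j < k.+1) ((j%:R + 1 / 2) / (j%:R + 1))) * (x / (k%:R + 1) + x ^+ 2 / (k%:R + 1) ^+ 2)
  \in pk p 3.
Proof.
move=> kp x1; elim: k kp => [|k IHk] kp.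
  by rewrite htermS hterm0 big_ord_recr big_ord0 /= [X in X \in _](_ : _ = 0) ?rpred0 //; field.
have ku : k%:R + 1 \in zu p by rewrite zu_natS //; lia.
have k1u : k%:R + 2 \in zu p by rewrite (_ : 2 = 1 + 1) // addrA natr1 zu_natS.
have kp' : (k.+1 < p)%N by lia.
have k2u : (k.+1%:R + 1 / 2) / (k.+1%:R + 1) \in zp p.
  by zpt; [exact: zu2|rewrite -natr1 -addrA].
set q : rat := (k.+1%:R + 1 / 2) * (k.+1%:R - x) * (k.+1%:R + 1 + x) / (k.+1%:R + 1) ^+ 3.
have qz : q \in zp p.
  have xz := pkW x1; rewrite /q; zpt; first exact: zu2.
  by apply: zuX; rewrite -natr1 -addrA.
have := pkMr (IHk kp') qz; rewrite mulrDl -htermS => H.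
rewrite big_ord_recr /=.
set c := \prod_(j < k.+1) _ in H *; have cz : c \in zp p.
  apply: zp_prod => j _; zpt; first exact: zu2.
  by rewrite zu_natS //; have := ltn_ord j; lia.
move: (hterm x k.+2) H => A H.
set B := c * _ * q in H; set C := c * _ * _.
suff D : C - B \in pk p 3 by have := rpredD H D; rewrite -addrA (addrC B) subrK.
rewrite (_ : _ - _ = c * ((k.+1%:R + 1 / 2) / (k.+1%:R + 1)) * (x ^+ 3 * ((k%:R + 2 + x) / ((k%:R + 1) ^+ 2 * (k%:R + 2) ^+ 2)))); last first.
  rewrite /B /C /q -!natr1.
  by field; rewrite (zu_neq0 ku) (zu_neq0 k1u).
rewrite pkMl //; first by apply: zpM.
rewrite pkMr //; first by exact: (pk_exp 3 x1).
by have xz := pkW x1; zpt; rewrite zuM ?zuX.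
Qed.

Lemma hsum_quadratic : exists A B, [/\ A \in zp p, B \in zp p &
  forall x, x \in pk p 1 -> hsum x - (1 + A * x + B * x ^+ 2) \in pk p 3].
Proof.
pose c k : rat := \prod_(j < k.+1) ((j%:R + 1 / 2) / (j%:R + 1)).
have kz k : (k < p.-1)%N -> k%:R + 1 \in zu p by move=> kp; rewrite zu_natS //; lia.
have cz k : (k < p.-1)%N -> c k \in zp p.
  move=> kp; apply: zp_prod => j _; zpt; first exact: zu2.
  by apply: kz; have := ltn_ord j; lia.
exists (- \sum_(k < p.-1) c k / (k%:R + 1)), (- \sum_(k < p.-1) c k / (k%:R + 1) ^+ 2).
split=> [||x x1].
- by apply: zpN; apply: zp_sum => k _; zpt; [apply: cz|apply: kz].
- by apply: zpN; apply: zp_sum => k _; zpt; [apply: cz|apply: zuX; apply: kz].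
rewrite [hsum x](_ : _ = 1 + \sum_(k < p.-1) hterm x k.+1); last first.
  by rewrite /hsum -(prednK (prime_gt0 p_pr)) big_ord_recl hterm0.
set s := \sum_(k < _) _; set s1 := \sum_(k < _) _; set s2 := \sum_(k < _) _.
have -> : 1 + s - (1 + - s1 * x + - s2 * x ^+ 2) = s + (s1 * x + s2 * x ^+ 2) by ring.
rewrite /s /s1 /s2 !mulr_suml -!big_split; apply: rpred_sum => k _ /=.
have kp : (k.+1 < p)%N by have := ltn_ord k; lia.
rewrite [X in X \in _](_ : _ = hterm x k.+1
  + c k * (x / (k%:R + 1) + x ^+ 2 / (k%:R + 1) ^+ 2)); first exact: hterm_small.
by field; apply: zu_neq0; apply: kz.
Qed.

(** The quadratic polynomial 1 + A x + B x^2 takes mutually inverse values 4^(-(p-1)) and 4^(p-1) at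
    p and -p. This makes it agree modulo p^3 with the exponential of a linear function. *)
Lemma hsum_Pt t : t \in zp p ->
  hsum (P * t) \in u1 /\ ell (hsum (P * t)) + t * ell (4 ^+ p.-1) \in pk p 3.
Proof.
move=> tz; have [A [B [Az Bz AB]]] := hsum_quadratic.
have Yu := pow4_u1; set Y : rat := 4 ^+ p.-1 in Yu *.
have E1 : 1 + P * A + P ^+ 2 * B - Y^-1 \in pk p 3.
  have := rpredB hsum_p (AB _ pkP); rewrite -/Y => H.
  rewrite [X in X \in _](_ : _ = hsum P - Y^-1 - (hsum P - (1 + A * P + B * P ^+ 2))) //.
  by ring.
have E2 : 1 - P * A + P ^+ 2 * B - Y \in pk p 3.
  have N1 : - P \in pk p 1 by rewrite rpredN pkP.
  have := rpredB hsum_Np (AB _ N1); rewrite -/Y => H.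
  rewrite [X in X \in _](_ : _ = hsum (- P) - Y - (hsum (- P) - (1 + A * - P + B * (- P) ^+ 2))) //.
  by ring.
have := AB _ (pkMr pkP tz); set S := hsum _; rewrite exprMn.
have : P * A \in pk p 1 by rewrite pkMr ?pkP.
have : P ^+ 2 * B \in pk p 2 by rewrite pkMr ?(pkX 2).
move: E1 E2; rewrite [A * _]mulrA [B * _]mulrA [A * _]mulrC [B * _]mulrC.
move: (P * A) (P ^+ 2 * B) => a b E1 E2 b2 a1 Sab.
have b1 : b \in pk p 1 by apply: pk_le b2.
have ab1 : a * t + b * t ^+ 2 \in pk p 1 by rewrite rpredD // pkMr //; zpt.
have Sab' : S - (1 + (a * t + b * t ^+ 2)) \in pk p 3 by rewrite addrA.
have Su : S \in u1.
  by apply: eqp_trans (pk_le _ Sab') _; rewrite // addrC addKr.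
split=> //.
clearbody Y; pose y := Y - 1; have y1 : y \in pk p 1 by [].
have Yz := u1_zu Yu.
have Y0 := zu_neq0 Yz.
(* The half sum of the two values determines b, the half difference determines a; with Y = 1 + y
   they are y^2 / 2 and -[ell Y], up to multiples of y^3. *)
have b2y : b - y ^+ 2 / 2 \in pk p 3.
  have := rpredD E1 E2; rewrite [X in X \in _ -> _](_ : _ = 2 * (b - y ^+ 2 / 2) + y ^+ 3 / Y); last first.
    by rewrite /y; field.
  move=> H; rewrite -(pk_mulu _ _ zu2) -(addrK (y ^+ 3 / Y) (2 * _)) rpredB //.
  by rewrite pk_divu // (pk_exp 3 y1).
have ay : a + (y - y ^+ 2 / 2) \in pk p 3.
  have := rpredB E1 E2; rewrite [X in X \in _ -> _](_ : _ = 2 * (a + (y - y ^+ 2 / 2)) + y ^+ 3 / Y); last first.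
    by rewrite /y; field.
  move=> H; rewrite -(pk_mulu _ _ zu2) -(addrK (y ^+ 3 / Y) (2 * _)) rpredB //.
  by rewrite pk_divu // (pk_exp 3 y1).
have /(eqp_trans) : ell S - ell (1 + (a * t + b * t ^+ 2)) \in pk p 3.
  by apply: ell_congr => //; apply: u1D.
move=> H; have := H (- (t * ell Y)); rewrite opprK; apply.
rewrite ell1D /ell -/y.
rewrite (_ : _ - _ + _ = t * (a + (y - y ^+ 2 / 2)) + t ^+ 2 * (b - y ^+ 2 / 2)
   - t ^+ 2 / 2 * ((a + (y - y ^+ 2 / 2)) * (a - y)) - t ^+ 2 / 4 * (y ^+ 2 * (a - y)) - t ^+ 3 * (a * b) - t ^+ 4 / 2 * b ^+ 2); last by field.
have ay1 : a - y \in pk p 1 by rewrite rpredB.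
have y2 : y ^+ 2 \in pk p 2 by apply: (pk_exp 2 y1).
rewrite !rpredB // ?rpredD //.
- by rewrite pkMl.
- by rewrite pkMl //; zpt.
- by rewrite pkMl //; [zpt; exact: zu2|rewrite pkMr // (pkW ay1)].
- by rewrite pkMl //; [zpt; exact: zu4|exact: (pkM y2 ay1)].
- by rewrite pkMl //; [zpt|exact: (pkM a1 b2)].
- rewrite pkMl //; first by zpt; exact: zu2.
  by apply: (@pk_le 4) => //; exact: (pk_exp 2 b2).
Qed.

(** In the recursion at a = 1 + p t the coefficient of [hsum (a - 2)] is p^2 t^2, so this sum is
    needed only modulo p, where it is S(-1) = S(0) = 1. The boundary term is p^2 t times a factor
    that is 1 modulo p. *)
Lemma hsum_1Pt t : t \in zp p ->
  hsum (1 + P * t) - P ^+ 2 * (t * (t + 1)) \in pk p 3.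
Proof.
move=> tz; set a := 1 + P * t.
have Pt1 : P * t \in pk p 1 by rewrite pkMr ?pkP.
have au : a \in u1 by apply: u1D.
have az := u1_zu au.
have p1u : p.-1%:R \in zu p by apply: zu_small; have := p_gt5; lia.
pose pr := \prod_(j < p - 2) ((j%:R + 2 - a) * (j%:R + 1 + a)).
pose f : rat := p.-1`!%:R; have fu : f \in zu p by apply: zu_fact; have := p_gt5; lia.
have f0 := zu_neq0 fu.
pose U := - (2 * a - 1) * a * 'C(p.*2, p)%:R / (2 * 4 ^+ p.-1) * pr / f ^+ 2.
have F n : \prod_(i < n) i.+1%:R = n`!%:R :> rat.
  by rewrite fact_prod big_add1 big_mkord natr_prod.
have fE : f = (p - 2)`!%:R * p.-1%:R.
  by rewrite /f (_ : p.-1 = (p - 2).+1) ?factS ?natrM 1?mulrC //; have := p_gt5; lia.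
(* Modulo p the argument a is 1 and the factors become (j + 1) (j + 2); later 1 / (p - 1) counts as
   -1. *)
have prE : pr - f ^+ 2 / p.-1%:R \in pk p 1.
  have -> : f ^+ 2 / p.-1%:R = \prod_(j < p - 2) (j.+1%:R * j.+2%:R).
    rewrite big_split /= F.
    have -> : \prod_(i < p - 2) i.+2%:R = f.
      rewrite /f -F (_ : p.-1 = (p - 2).+1); last by have := p_gt5; lia.
      by rewrite big_ord_recl mul1r.
    by rewrite fE; field; apply: zu_neq0.
  apply: eqp_prod => j _; first by zpt.
  rewrite /a -!natr1 [X in X \in _](_ : _ = P * t * (- (j%:R + 2) + (j%:R + 1) - P * t)); last by ring.
  by rewrite pkMr //; zpt.
have Uz : U - 1 \in pk p 1.
  have E1 : - (2 * a - 1) * a + 1 \in pk p 1.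
    rewrite /a [X in X \in _](_ : _ = P * t * (- 3 - 2 * (P * t))); last by ring.
    by rewrite pkMr //; zpt.
  have E2 : 'C(p.*2, p)%:R / (2 * 4 ^+ p.-1) - 1 \in pk p 1.
    have Y0 := u1_zu pow4_u1.
    rewrite [X in X \in _](_ : _ = (('C(p.*2, p)%:R - 2) / (2 * 4 ^+ p.-1) - (4 ^+ p.-1 - 1) / 4 ^+ p.-1)); last first.
      by field; rewrite zu_neq0.
    apply: rpredB; apply: pk_divu => //; [exact: pk_le bin_p2|exact: zuM zu2 Y0|exact: pow4_u1].
  have E3 : pr / f ^+ 2 + 1 \in pk p 1.
    have := pk_divu prE (zuX 2 fu) => H.
    rewrite [X in X \in _](_ : _ = (pr - f ^+ 2 / p.-1%:R) / f ^+ 2 + P / p.-1%:R).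
      by rewrite rpredD // pk_divu ?pkP.
    rewrite -[in P / _](prednK (prime_gt0 p_pr)) -natr1.
    by field; rewrite f0 zu_neq0.
  have azz := zu_zp az.
  rewrite /U [X in X - 1](_ : _ = - (2 * a - 1) * a * ('C(p.*2, p)%:R / (2 * 4 ^+ p.-1)) * (pr / f ^+ 2)); last by rewrite !mulrA.
  rewrite -[X in _ - X](_ : -1 * 1 * -1 = 1); last by ring.
  apply: eqpM; first by zpt; exact: zuM zu2 (u1_zu pow4_u1).
  - by zpt.
  - by apply: eqpM; [zpt|zpt|rewrite opprK|].
  by rewrite opprK.
have B : hbound a = P ^+ 2 * t * U.
  rewrite /hbound -mulrA hcof_p half_prod_p -/pr -/f /U.
  rewrite -[in 4 ^+ p](prednK (prime_gt0 p_pr)) exprS.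
  rewrite (_ : a * (a - 1) = a * (P * t)); last by rewrite /a; ring.
  by field; rewrite f0 expf_neq0.
have := hsum_rec a; rewrite B => R.
have aE : a = 1 + P * t by [].
clearbody U; clearbody pr; clearbody a.
have hm : hsum (a - 2) - 1 \in pk p 1.
  rewrite -hsum_sym -[X in hsum _ - X]hsum0 aE; apply: eqp_hsum; [by zpt|exact: (zp_nat p 0)|].
  rewrite [X in X \in _](_ : _ = - (P * t)); last by ring.
  by rewrite rpredN.
rewrite -(pk_mulu _ _ (zuX 2 az)).
rewrite [X in X \in _](_ : _ = P ^+ 2 * (t ^+ 2 * (hsum (a - 2) - 1) + t * (U - 1) - (a ^+ 2 - 1) * (t * (t + 1)))); last first.
  rewrite mulrBr -[a ^+ 2 * hsum a](subrK ((a - 1) ^+ 2 * hsum (a - 2))) R.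
  by rewrite (_ : a - 1 = P * t); [ring|rewrite aE; ring].
apply: (@pkM 2 1); first exact: (pkX 2).
rewrite rpredB ?rpredD //.
- by rewrite pkMl //; zpt.
- by rewrite pkMl.
rewrite pkMr //; last by zpt.
rewrite [X in X \in _](_ : _ = P * t * (2 + P * t)); last by rewrite aE; ring.
by rewrite pkMr //; zpt.
Qed.

Lemma fact_neq0 n : n`!%:R != 0 :> rat.
Proof. by rewrite pnatr_eq0 -lt0n fact_gt0. Qed.

Lemma bin_factr n m : (m <= n)%N -> 'C(n, m)%:R = n`!%:R / (m`!%:R * (n - m)`!%:R) :> rat.
Proof.
move=> mn; rewrite -(bin_fact mn) !natrM mulfK //.
by rewrite mulf_neq0 ?fact_neq0.
Qed.

(** * Reduction of the sum to contiguous parameters *)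

Lemma hterm_third k : hterm (- (1 / 3)) k =
  ('C(2 * k, k) ^ 2 * 'C(3 * k, k))%:R / 108 ^+ k.
Proof.
rewrite natrM natrX !bin_factr; try lia.
rewrite (_ : 2 * k - k = k)%N; last by lia.
rewrite (_ : 3 * k - k = 2 * k)%N; last by lia.
rewrite [RHS](_ : _ = (2 * k)`!%:R * (3 * k)`!%:R / k`!%:R ^+ 5 / 108 ^+ k); last first.
  have := fact_neq0 k; have := fact_neq0 (2 * k).
  move: (_`!%:R) (_`!%:R) (_`!%:R) (108 ^+ k)^-1 => u v w z v0 u0.
  by field; rewrite v0 u0.
elim: k => [|k IHk]; first by rewrite hterm0 !muln0 fact0 expr0; field.
rewrite htermS IHk (_ : 2 * k.+1 = (2 * k).+2)%N; last by lia.
rewrite (_ : 3 * k.+1 = (3 * k).+3)%N; last by lia.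
have e2 : (2 * k).+2`!%:R = (2 * k%:R + 2) * (2 * k%:R + 1%:R) * (2 * k)`!%:R :> rat.
  rewrite !factS !natrM mulrA; congr (_ * _ * _); rewrite -?natrM -natrD; congr (_%:R); lia.
have e3 : (3 * k).+3`!%:R
    = (3 * k%:R + 3) * (3 * k%:R + 2) * (3 * k%:R + 1%:R) * (3 * k)`!%:R :> rat.
  rewrite !factS !natrM !mulrA; congr (_ * _ * _ * _); rewrite -natrM -natrD; congr (_%:R); lia.
have e1 : k.+1`!%:R = (k%:R + 1) * k`!%:R :> rat by rewrite factS natrM -[k.+1%:R]natr1.
have k1 : k%:R + 1 != 0 :> rat by rewrite natr1 pnatr_eq0.
have := fact_neq0 k; have : 108 ^+ k != 0 :> rat by rewrite expf_neq0.
rewrite e1 e2 e3 [108 ^+ k.+1]exprS; move: (_`!%:R) (_`!%:R) (_`!%:R) (108 ^+ k) => u v w z z0 w0.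
by field; rewrite k1 w0 z0.
Qed.

Lemma three_neq0 k : 2 - 3 * k%:R != 0 :> rat.
Proof.
rewrite subr_eq0 -natrM eqr_nat; apply/negP => /eqP; lia.
Qed.

(** Shifting a by 1 changes the rising factorials of -a and 1 + a only in their end factors. *)
Lemma hterm_contig k :
  hterm (2 / 3) k = hterm (- (1 / 3)) k * (3 * k%:R + 2) / (2 - 3 * k%:R).
Proof.
elim: k => [|k IHk]; first by rewrite !hterm0; field.
rewrite !htermS IHk -[k.+1%:R]natr1.
have := three_neq0 k.+1; have := three_neq0 k; rewrite -[k.+1%:R]natr1 => n1 n2.
have k1 : k%:R + 1 != 0 :> rat by rewrite natr1 pnatr_eq0.
by field; rewrite n1 n2 k1.
Qed.

(* Found by Gosper's algorithm: the summand divided by k + 2 is a combination of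
   two contiguous terms up to the difference of this rational multiple of the
   term. *)
Definition gosper (k : nat) : rat :=
  (- (3 / 10) * k%:R ^+ 3 / (k%:R + 1) - 27 / 10 * k%:R ^+ 2
   - 9 * k%:R ^+ 3 / (2 - 3 * k%:R)) * hterm (- (1 / 3)) k.

Lemma gosperP k : hterm (- (1 / 3)) k / (k + 2)%:R =
  29 / 60 * hterm (- (1 / 3)) k - 2 / 3 * hterm (2 / 3) k + (gosper k.+1 - gosper k).
Proof.
rewrite /gosper hterm_contig htermS natrD -[k.+1%:R]natr1.
have := three_neq0 k.+1; have := three_neq0 k; rewrite -[k.+1%:R]natr1 => n1 n2.
have k1 : k%:R + 1 != 0 :> rat by rewrite natr1 pnatr_eq0.
have k2 : k%:R + 2 != 0 :> rat by rewrite -natrD pnatr_eq0 addn2.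
by field; rewrite n1 n2 k1 -addrA k2.
Qed.

Lemma prod_pk1 n j0 (F : nat -> rat) : (j0 < n)%N -> F j0 \in pk p 1 ->
  (forall j, (j < n)%N -> F j \in zp p) -> \prod_(j < n) F j \in pk p 1.
Proof.
move=> jn F1 Fz; rewrite (bigD1 (Ordinal jn)) //= pkMr //.
by apply: zp_prod => j _; apply: Fz.
Qed.

Lemma zu3 : 3 \in zu p.
Proof. by apply: zu_small; have := p_gt5; lia. Qed.

Lemma p_mod3 : (p %% 3 != 0)%N.
Proof.
by rewrite -[_ == _]/(3 %| p)%N dvdn_prime2 //; apply: contraTneq p_gt5 => <-.
Qed.

Lemma P_half : P = 2 * h%:R + 1.
Proof. by rewrite -natrM natr1 mul2n -p_half. Qed.

(** Among the factors j + 1/2, j + 1/3 and j + 2/3 with j < p - 2, each of the three kinds contains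
    a multiple of p. *)
Lemma hterm_third_pk3 : hterm (- (1 / 3)) (p - 2) \in pk p 3.
Proof.
have p5 := p_gt5; have p3 := p_mod3.
have [j1 j1p [c1 E1]] : exists2 j, (j < p - 2)%N & exists c, (3 * j + 1 = c * p)%N.
  have := divn_eq p 3; set q := (p %/ 3)%N => E.
  have [p1|p2] : (p %% 3 = 1 \/ p %% 3 = 2)%N by have := ltn_pmod p (isT : 0 < 3)%N; lia.
    by exists q; [lia|exists 1%N; lia].
  by exists (2 * q + 1)%N; [lia|exists 2; lia].
have [j2 j2p [c2 E2]] : exists2 j, (j < p - 2)%N & exists c, (3 * j + 2 = c * p)%N.
  have := divn_eq p 3; set q := (p %/ 3)%N => E.
  have [p1|p2] : (p %% 3 = 1 \/ p %% 3 = 2)%N by have := ltn_pmod p (isT : 0 < 3)%N; lia.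
    by exists (2 * q)%N; [lia|exists 2; lia].
  by exists q; [lia|exists 1%N; lia].
rewrite /hterm big_split prodfV /= pk_divu //; last first.
  apply: zu_prod => j _; apply: zuX; apply: zu_natS.
  by have := ltn_ord j; lia.
rewrite !big_split /=; apply: (@pkM 2 1); first apply: (@pkM 1 1).
- apply: (@prod_pk1 _ h (fun j => j%:R + 1 / 2)) => [||j _]; first by have := p_half; lia.
    rewrite (_ : _ + _ = P / 2) ?pk_divu ?pkP ?zu2 //.
    by rewrite P_half; field.
  by zpt; exact: zu2.
- apply: (@prod_pk1 _ j1 (fun j => j%:R - - (1 / 3))) => [||j _] //.
    rewrite (_ : _ - _ = (c1 * p)%:R / 3).
      by apply: pk_divu zu3; rewrite natrM pkMl ?pkP ?zp_nat.
    by rewrite -E1 natrD natrM; field.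
  by zpt; exact: zu3.
- apply: (@prod_pk1 _ j2 (fun j => j%:R + 1 - 1 / 3)) => [||j _] //.
    rewrite (_ : _ - _ = (c2 * p)%:R / 3).
      by apply: pk_divu zu3; rewrite natrM pkMl ?pkP ?zp_nat.
    by rewrite -E2 natrD natrM; field.
  by zpt; exact: zu3.
Qed.

Lemma sum_telescope (R : comNzRingType) (c d : R) (a b e g : nat -> R) n :
  (forall k, a k = c * b k - d * e k + (g k.+1 - g k)) ->
  \sum_(k < n) a k = c * (\sum_(k < n) b k) - d * (\sum_(k < n) e k) + (g n - g 0).
Proof.
move=> aE; elim: n => [|n IHn]; first by rewrite !big_ord0; ring.
by rewrite !big_ord_recr /= IHn aE; ring.
Qed.

Lemma lhs_gosper n :
  \sum_(0 <= k < n) ('C(2 * k, k) ^ 2 * 'C(3 * k, k))%:R / (108 ^+ k * (k + 2)%:R)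
   = 29 / 60 * (\sum_(k < n) hterm (- (1 / 3)) k)
     - 2 / 3 * (\sum_(k < n) hterm (2 / 3) k) + gosper n.
Proof.
rewrite big_mkord (eq_bigr (fun k : 'I_n => hterm (- (1 / 3)) k / (k + 2)%:R)); last first.
  by move=> k _; rewrite invfM mulrA -hterm_third.
rewrite (sum_telescope _ gosperP) [gosper 0](_ : _ = 0) ?subr0 //.
by rewrite /gosper; move: (hterm _ _) => x; field.
Qed.

Lemma tail_pk k c d s s' g x y z w : c \in zp p -> d \in zp p ->
  g \in pk p k -> x \in pk p k -> y \in pk p k -> z \in pk p k -> w \in pk p k ->
  c * s - d * s' + g - (c * (s + x + y) - d * (s' + z + w)) \in pk p k.
Proof.
move=> cz dz gk xk yk zk wk.
rewrite [X in X \in _](_ : _ = g - c * (x + y) + d * (z + w)); last by ring.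
by rewrite rpredD ?rpredB // pkMl ?rpredD.
Qed.

Lemma zu60 : 60 \in zu p.
Proof.
have u5 : 5 \in zu p by apply: zu_small; have := p_gt5; lia.
by rewrite (_ : 60 = 4 * 3 * 5); [rewrite !zuM ?zu4 ?zu3|ring].
Qed.

Lemma twentynine_sixtieths_zp : 29 / 60 \in zp p. Proof. by zpt; exact: zu60. Qed.

Lemma two_thirds_zp : 2 / 3 \in zp p. Proof. by zpt; exact: zu3. Qed.

Lemma neg_third_zp : - (1 / 3) \in zp p.
Proof. by zpt; exact: zu3. Qed.

(** The sum stops just before k + 2 = p would enter a denominator. The boundary value of [gosper]
    and the two terms missing from each [hsum] vanish modulo p^3 because [hterm (- (1 / 3)) (p - 2)]
    does. *)
Lemma lhs_hsum :
  \sum_(0 <= k < (p - 3).+1) ('C(2 * k, k) ^ 2 * 'C(3 * k, k))%:R / (108 ^+ k * (k + 2)%:R)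
  - (29 / 60 * hsum (- (1 / 3)) - 2 / 3 * hsum (2 / 3)) \in pk p 3.
Proof.
have p5 := p_gt5.
have t1 := hterm_third_pk3.
have p2 : (p - 2)%:R = P - 2 by rewrite natrB //; lia.
have u8 : 8 - 3 * P \in zu p.
  rewrite zuD ?rpredN ?pkMl ?pkP ?zp_nat // (_ : 8 = 2 ^+ 3); last by ring.
  by rewrite zuX ?zu2.
have u5 : 5 - 3 * P \in zu p.
  by rewrite zuD ?rpredN ?pkMl ?pkP ?zp_nat // zu_small //; lia.
have u10 : 10 \in zu p.
  by rewrite (_ : 10 = 2 * 5); [rewrite zuM ?zu2 // zu_small //; lia|ring].
have u1' : P - 1 \in zu p.
  by rewrite addrC zuD ?pkP // zuN // zu1.
have t2 : hterm (- (1 / 3)) (p - 1) \in pk p 3.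
  rewrite (_ : p - 1 = (p - 2).+1)%N; last by lia.
  rewrite htermS pkMr // p2; zpt; [exact: zu2|exact: zu3|exact: zu3|].
  by rewrite zuX // (_ : P - 2 + 1 = P - 1) //; ring.
have t3 : hterm (2 / 3) (p - 2) \in pk p 3.
  rewrite hterm_contig -mulrA pkMr // p2; zpt.
  by rewrite (_ : 2 - _ = 8 - 3 * P) //; ring.
have t4 : hterm (2 / 3) (p - 1) \in pk p 3.
  rewrite hterm_contig -mulrA pkMr // natrB ?prime_gt0 //; zpt.
  by rewrite (_ : 2 - _ = 5 - 3 * P) //; ring.
have gp : gosper (p - 2) \in pk p 3.
  rewrite /gosper pkMl // p2; zpt.
  - by rewrite (_ : P - 2 + 1 = P - 1) //; ring.
  - by rewrite (_ : 2 - _ = 8 - 3 * P) //; ring.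
have split2 a : hsum a = \sum_(k < p - 2) hterm a k + hterm a (p - 2) + hterm a (p - 1).
  rewrite /hsum -(big_mkord xpredT (hterm a)).
  rewrite -[X in \sum_(0 <= i < X) _](_ : (p - 2).+2 = p)%N; last by lia.
  by rewrite !big_nat_recr //= big_mkord (_ : (p - 2).+1 = p - 1)%N //; lia.
rewrite (_ : (p - 3).+1 = p - 2)%N; last by lia.
rewrite lhs_gosper !split2.
exact: (tail_pk _ _ twentynine_sixtieths_zp two_thirds_zp gp t1 t2 t3 t4).
Qed.

(** * Reciprocal sums over residue classes modulo 6, for p = 6m - 1 *)

(* As N divides p + 1, the number r + (r mod N) p is a multiple of N, and r |->
   (r + (r mod N) p) / N permutes 1, ..., p - 1; multiplying over r gives
   N^(p-1). *)
Definition mulclass (N r : nat) : nat := (r + (r %% N) * p) %/ N.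

Lemma mulclassP N r : (N %| p.+1)%N -> (N * mulclass N r = r + (r %% N) * p)%N.
Proof.
move=> Np; rewrite mulnC divnK //.
have -> : (r + (r %% N) * p = r %/ N * N + (r %% N) * p.+1)%N.
  by rewrite mulnS addnA -divn_eq.
by rewrite dvdn_add ?dvdn_mull.
Qed.

Lemma mulclass_range N r : (N %| p.+1)%N -> (0 < r < p)%N -> (0 < mulclass N r < p)%N.
Proof.
move=> Np rp; have N0 : (0 < N)%N by case: N Np.
have := mulclassP r Np; have := ltn_pmod r N0; move: (r %% N)%N (mulclass N r) => c q cN E.
have cp : (c * p <= N.-1 * p)%N by rewrite leq_mul2r -ltnS prednK // cN orbT.
have Np' : (N.-1 * p + p = N * p)%N by rewrite -mulSnr prednK.
apply/andP; split; first by case: q E => // E; lia.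
by rewrite -(ltn_pmul2l N0) E; lia.
Qed.

Lemma mulclass_inj N r s : (N %| p.+1)%N -> (0 < r < p)%N -> (0 < s < p)%N ->
  mulclass N r = mulclass N s -> r = s.
Proof.
move=> Np rp sp E; have := congr1 (modn^~ p) (congr1 (muln N) E).
rewrite /= !mulclassP // ![(_ + _ * p)%N]addnC !modnMDl !modn_small //.
  by case/andP: sp.
by case/andP: rp.
Qed.

Lemma reindex_mulclass (R : Type) (idx : R) (op : Monoid.com_law idx) N (F : nat -> R) :
  (N %| p.+1)%N ->
  \big[op/idx]_(i < p.-1) F (mulclass N i.+1) = \big[op/idx]_(i < p.-1) F i.+1.
Proof.
move=> Np; have rg (i : 'I_p.-1) : (0 < i.+1 < p)%N by have := ltn_ord i; lia.
have lt (i : 'I_p.-1) : ((mulclass N i.+1).-1 < p.-1)%N.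
  by have := mulclass_range Np (rg i); lia.
pose f i := Ordinal (lt i).
have fI : injective f.
  move=> i j /(congr1 val) /= E; apply/val_inj/succn_inj.
  apply: (mulclass_inj Np (rg i) (rg j)).
  by have := mulclass_range Np (rg i); have := mulclass_range Np (rg j); lia.
rewrite [RHS](reindex_inj fI); apply: eq_bigr => i _ /=.
by congr F; have := mulclass_range Np (rg i); lia.
Qed.

Lemma natpow_prod N : (N %| p.+1)%N ->
  N%:R ^+ p.-1 = \prod_(i < p.-1) (1 + (i.+1 %% N)%:R * P / i.+1%:R) :> rat.
Proof.
move=> Np; have n0 : \prod_(i < p.-1) i.+1%:R != 0 :> rat.
  by apply/prodf_neq0 => i _; rewrite pnatr_eq0.
apply: (mulIf n0); rewrite -big_split /=.
rewrite -{1}[X in _ ^+ X](card_ord p.-1) -prodr_const.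
rewrite -(reindex_mulclass _ (fun i => i%:R) Np) -big_split /=; apply: eq_bigr => i _.
by rewrite [RHS]mulrDl divfK ?pnatr_eq0 // mul1r -!natrM mulclassP // natrD.
Qed.

Lemma ell_natpow N : (N %| p.+1)%N ->
  N%:R ^+ p.-1 \in u1 /\
  ell (N%:R ^+ p.-1)
  - (P * (\sum_(i < p.-1) (i.+1 %% N)%:R / i.+1%:R)
     - P ^+ 2 / 2 * (\sum_(i < p.-1) (i.+1 %% N)%:R ^+ 2 / i.+1%:R ^+ 2)) \in pk p 3.
Proof.
move=> Np; have Fu (i : 'I_p.-1) : true -> 1 + (i.+1 %% N)%:R * P / i.+1%:R \in u1.
  move=> _; apply: u1D; apply: pk_divu; first by rewrite pkMl ?pkP ?zp_nat.
  by apply: zu_small; have := ltn_ord i; lia.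
rewrite natpow_prod //; split; first exact: u1_prod.
have H := ell_prod (index_enum _) Fu; rewrite -[X in _ - X](_ : \sum_(i < p.-1)
  ell (1 + (i.+1 %% N)%:R * P / i.+1%:R) = _) //.
rewrite !mulr_sumr -sumrB; apply: eq_bigr => i _; rewrite ell1D.
have : i.+1%:R != 0 :> rat by rewrite pnatr_eq0.
by move: (i.+1%:R : rat) ((i.+1 %% N)%:R : rat) => x c x0; field.
Qed.

Section FiveModSix.

Variable m : nat.
Hypothesis pE : p.+1 = (6 * m)%N.

Lemma m_gt1 : (1 < m)%N. Proof. by have := p_gt5; lia. Qed.

(* The index r = p occurs in the last class; its term is set to 0. *)
Definition invp (k r : nat) : rat := if r == p then 0 else r%:R ^- k.

Definition classsum (k c : nat) : rat := \sum_(j < m) invp k (6 * j + c)%N.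

Local Notation T := classsum.

Lemma big_ord_mul6 n (F : nat -> rat) :
  \sum_(r < 6 * n) F r = \sum_(c < 6) \sum_(j < n) F (6 * j + c)%N.
Proof.
elim: n => [|n IHn].
  by rewrite muln0 big_ord0 big1 // => c _; rewrite big_ord0.
rewrite mulnSr big_split_ord /= IHn.
under [in RHS]eq_bigr do rewrite big_ord_recr.
by rewrite big_split.
Qed.

Lemma sum6 (F : nat -> rat) :
  \sum_(c < 6) F c = F 0 + F 1%N + F 2 + F 3 + F 4 + F 5.
Proof. by rewrite !big_ord_recr big_ord0 /= add0r. Qed.

Lemma invp0 k : (0 < k)%N -> invp k 0 = 0.
Proof. by case: k => // k _; rewrite /invp; case: eqP => // _; rewrite expr0n /= invr0. Qed.

Lemma invpp k : invp k p = 0.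
Proof. by rewrite /invp eqxx. Qed.

Lemma invpE k r : (r < p)%N -> invp k r = r%:R ^- k.
Proof. by move=> rp; rewrite /invp ltn_eqF. Qed.

Lemma class_weight k (w : nat -> rat) : (0 < k)%N ->
  \sum_(i < p.-1) w (i.+1 %% 6)%N / i.+1%:R ^+ k = \sum_(c < 6) w c * T k c.
Proof.
move=> k0; have pp : p = p.-1.+1 by rewrite prednK ?prime_gt0.
transitivity (\sum_(r < p.+1) w (r %% 6)%N * invp k r).
  rewrite big_ord_recr /= invpp mulr0 addr0.
  rewrite -(big_mkord xpredT (fun r => w (r %% 6)%N * invp k r)).
  rewrite [in RHS]pp big_nat_recl // invp0 // mulr0 add0r big_mkord.
  by apply: eq_bigr => i _; rewrite invpE //; have := ltn_ord i; lia.
rewrite pE (big_ord_mul6 m (fun r => w (r %% 6)%N * invp k r)); apply: eq_bigr => c _; rewrite mulr_sumr.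
apply: eq_bigr => j _; rewrite mulnC modnMDl modn_small ?ltn_ord //.
Qed.

Lemma class_rev k c : (c < 6)%N -> T k (5 - c) = \sum_(j < m) invp k (p - (6 * j + c)).
Proof.
move=> c6; rewrite /T (big_ord_rev _ m (fun j => invp k (6 * j + (5 - c)))).
by apply: eq_bigr => j _; congr invp; have := ltn_ord j; lia.
Qed.

Lemma class1_rev c : (c < 6)%N -> T 1 (5 - c) + T 1 c + P * T 2 c \in pk p 2.
Proof.
move=> c6; rewrite class_rev // /T mulr_sumr -!big_split; apply: rpred_sum => j _ /=.
have : (6 * j + c <= p)%N by have := ltn_ord j; lia.
move: (6 * j + c)%N => r; rewrite leq_eqVlt => /predU1P[->|rp].
  by rewrite subnn !invpp invp0 // mulr0 !addr0 rpred0.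
case: r rp => [|r] rp.
  by rewrite subn0 invpp !invp0 // mulr0 !addr0 rpred0.
rewrite !invpE //; last by lia.
by rewrite !expr1; apply: inv_rev.
Qed.

Lemma class2_rev c : (c < 6)%N -> T 2 (5 - c) - T 2 c \in pk p 1.
Proof.
move=> c6; rewrite class_rev // /T -sumrB; apply: rpred_sum => j _ /=.
have : (6 * j + c <= p)%N by have := ltn_ord j; lia.
move: (6 * j + c)%N => r; rewrite leq_eqVlt => /predU1P[->|rp].
  by rewrite subnn !invpp invp0 // subrr rpred0.
case: r rp => [|r] rp.
  by rewrite subn0 invpp !invp0 // subrr rpred0.
by rewrite !invpE //; [apply: sqr_rev|lia].
Qed.

(** The sum of r^-2 over all r below p vanishes modulo p, and the classes c and 5 - c contribute
    equally. *)
Lemma class2_total : T 2 0 + T 2 1 + T 2 2 \in pk p 1.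
Proof.
have [_ H] := hs2_half; have := @class_weight 2 (fun=> 1) isT.
rewrite (eq_bigr (fun i : 'I_p.-1 => i.+1%:R ^- 2)) => [|i _]; last by rewrite mul1r.
rewrite -/(hs 2 p.-1) !big_ord_recl big_ord0 /= !mul1r addr0 => E.
have R0 := class2_rev (isT : (0 < 6)%N); have R1 := class2_rev (isT : (1 < 6)%N).
have R2 := class2_rev (isT : (2 < 6)%N).
move: H R0 R1 R2; rewrite {}E /bump /=.
move: (T 2 0) (T 2 1) (T 2 2) (T 2 3) (T 2 4) (T 2 5) => a b c d e f H R0 R1 R2.
rewrite -(pk_mulu _ _ zu2) [X in X \in _](_ : _ = a + (b + (c + (d + (e + f)))) - (f - a) - (e - b) - (d - c)); last by ring.
apply: rpredB R2; apply: rpredB R1; apply: rpredB R0; exact: H.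
Qed.

(** For s = [mulclass 2 r] one has 2 s = r modulo p, and s is 1 modulo 3 exactly when r is 2 or 3
    modulo 6. Hence T_1 + T_4 = 4 (T_2 + T_3) modulo p, and reflection identifies the classes 4 and
    3 with 1 and 2. *)
Lemma class2_double : T 2 1 - 4 * T 2 2 \in pk p 1.
Proof.
have N2 : (2 %| p.+1)%N by rewrite pE (_ : 6 = 2 * 3)%N // -mulnA dvdn_mulr.
pose w c : rat := ((c %% 3 == 1)%N)%:R.
pose v c : rat := ((c == 2)%N || (c == 3)%N)%:R.
have E1 := @class_weight 2 w isT; have E2 := @class_weight 2 v isT.
have D : \sum_(i < p.-1) w (i.+1 %% 6)%N / i.+1%:R ^+ 2
   - 4 * \sum_(i < p.-1) v (i.+1 %% 6)%N / i.+1%:R ^+ 2 \in pk p 1.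
  rewrite -(reindex_mulclass _ (fun i => w (i %% 6)%N / i%:R ^+ 2) N2).
  rewrite mulr_sumr -sumrB; apply: rpred_sum => i _.
  have ip : (0 < i.+1 < p)%N by have := ltn_ord i; lia.
  have := mulclassP i.+1 N2; have := mulclass_range N2 ip.
  move: (mulclass 2 i.+1) => s sp sE.
  have -> : w (s %% 6)%N = v (i.+1 %% 6)%N.
    rewrite /w /v modn_dvdm //; congr (_%:R); congr (nat_of_bool _).
    move: sE; rewrite (_ : i.+1 %% 2 = i.+1 %% 6 %% 2)%N; last by rewrite modn_dvdm.
    have := divn_eq i.+1 6; have := ltn_pmod i.+1 (isT : 0 < 6)%N.
    move: (i.+1) (i.+1 %% 6)%N (i.+1 %/ 6)%N => r c q c6 -> sE.
    apply/idP/idP; move: sE c6; case: c => [|[|[|[|[|[|c]]]]]] //=; lia.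
  have su := zu_small sp; have ru := zu_small ip.
  rewrite (_ : _ - _ = 4 * v (i.+1 %% 6)%N * ((2 * s%:R) ^- 2 - i.+1%:R ^- 2)); last first.
    have := zu_neq0 su; have := zu_neq0 ru.
    move: (s%:R : rat) (i.+1%:R : rat) (v _) => x y z x0 y0.
    by field; rewrite x0 y0.
  rewrite pkMl //; first by rewrite /v; zpt.
  rewrite -natrM sE; apply: eqpV; [|exact: zuX|].
    by apply: zuX; rewrite natrD zuD // natrM pkMl ?pkP ?zp_nat.
  apply: eqpX; [exact: zp_nat|exact: zp_nat|].
  by rewrite natrD addrC addKr natrM pkMl ?pkP ?zp_nat.
move: D; rewrite {}E1 {}E2 !big_ord_recl !big_ord0 /bump /w /v /=.
rewrite !(mul0r, mul1r, addr0, add0r) => D.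
have R1 := class2_rev (isT : (1 < 6)%N).
have R2 := class2_rev (isT : (2 < 6)%N).
move: D R1 R2 => /=.
move: (T 2 1) (T 2 2) (T 2 3) (T 2 4) => b c d e D R1 R2.
rewrite -(pk_mulu _ _ zu2) [X in X \in _](_ : _ = b + e - 4 * (c + d) - (e - b) + 4 * (d - c)); last by ring.
apply: rpredD; last by rewrite pkMl ?zp_nat.
by apply: rpredB R1.
Qed.

(* Solving the three reflection relations and the doubling relation, every
   second-order class sum is a multiple of one of them. *)
Lemma class2_solve y : T 2 2 + y \in pk p 1 ->
  [/\ T 2 0 - 5 * y \in pk p 1, T 2 1 + 4 * y \in pk p 1 & T 2 3 + y \in pk p 1].
Proof.
move=> H; have := class2_double; have := class2_total.
have := class2_rev (isT : (2 < 6)%N) => /=.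
move: H; move: (T 2 0) (T 2 1) (T 2 2) (T 2 3) => a b c d H R tot dbl.
have Hb : b + 4 * y \in pk p 1.
  rewrite [X in X \in _](_ : _ = b - 4 * c + 4 * (c + y)); last by ring.
  by rewrite rpredD // pkMl ?zp_nat.
split=> //; last first.
  rewrite [X in X \in _](_ : _ = d - c + (c + y)); last by ring.
  by rewrite rpredD.
rewrite [X in X \in _](_ : _ = a + b + c - (b + 4 * y) - (c + y)); last by ring.
by apply: rpredB H; apply: rpredB Hb.
Qed.

Lemma ell_two : 2 ^+ p.-1 \in u1 /\
  ell (2 ^+ p.-1) - (P * (T 1 1 + T 1 3 + T 1 5) - P ^+ 2 / 2 * (T 2 1 + T 2 3 + T 2 5)) \in pk p 3.
Proof.
have N2 : (2 %| p.+1)%N by rewrite pE (_ : 6 = 2 * 3)%N // -mulnA dvdn_mulr.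
have [U E] := ell_natpow N2; split=> //; move: E.
have -> : \sum_(i < p.-1) (i.+1 %% 2)%:R / i.+1%:R = T 1 1 + T 1 3 + T 1 5.
  rewrite (eq_bigr (fun i : 'I_p.-1 => (i.+1 %% 6 %% 2)%:R / i.+1%:R ^+ 1)); last by move=> i _; rewrite modn_dvdm.
  rewrite (@class_weight 1 (fun c => (c %% 2)%:R)) // !big_ord_recl big_ord0 /bump /=.
  by rewrite !(mul0r, mul1r, addr0, add0r) addrA.
have -> : \sum_(i < p.-1) (i.+1 %% 2)%:R ^+ 2 / i.+1%:R ^+ 2 = T 2 1 + T 2 3 + T 2 5.
  rewrite (eq_bigr (fun i : 'I_p.-1 => (i.+1 %% 6 %% 2)%:R ^+ 2 / i.+1%:R ^+ 2)); last by move=> i _; rewrite modn_dvdm.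
  rewrite (@class_weight 2 (fun c => (c %% 2)%:R ^+ 2)) // !big_ord_recl big_ord0 /bump /=.
  by rewrite !(expr0n, expr1n, mul0r, mul1r, addr0, add0r) addrA.
by [].
Qed.

Lemma ell_three : 3 ^+ p.-1 \in u1 /\
  ell (3 ^+ p.-1) - (P * (T 1 1 + 2 * T 1 2 + T 1 4 + 2 * T 1 5)
    - P ^+ 2 / 2 * (T 2 1 + 4 * T 2 2 + T 2 4 + 4 * T 2 5)) \in pk p 3.
Proof.
have N3 : (3 %| p.+1)%N by rewrite pE (_ : 6 = 3 * 2)%N // -mulnA dvdn_mulr.
have [U E] := ell_natpow N3; split=> //; move: E.
have -> : \sum_(i < p.-1) (i.+1 %% 3)%:R / i.+1%:R = T 1 1 + 2 * T 1 2 + T 1 4 + 2 * T 1 5.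
  rewrite (eq_bigr (fun i : 'I_p.-1 => (i.+1 %% 6 %% 3)%:R / i.+1%:R ^+ 1)); last by move=> i _; rewrite modn_dvdm.
  rewrite (@class_weight 1 (fun c => (c %% 3)%:R)) // (sum6 (fun c => (c %% 3)%:R * T 1 c)).
  transitivity (0 * T 1 0 + 1 * T 1 1 + 2 * T 1 2 + 0 * T 1 3 + 1 * T 1 4 + 2 * T 1 5); first by [].
  by move: (T 1 0) (T 1 1) (T 1 2) (T 1 3) (T 1 4) (T 1 5) => *; ring.
have -> : \sum_(i < p.-1) (i.+1 %% 3)%:R ^+ 2 / i.+1%:R ^+ 2 = T 2 1 + 4 * T 2 2 + T 2 4 + 4 * T 2 5.
  rewrite (eq_bigr (fun i : 'I_p.-1 => (i.+1 %% 6 %% 3)%:R ^+ 2 / i.+1%:R ^+ 2)); last by move=> i _; rewrite modn_dvdm.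
  rewrite (@class_weight 2 (fun c => (c %% 3)%:R ^+ 2)) // (sum6 (fun c => (c %% 3)%:R ^+ 2 * T 2 c)).
  transitivity (0 ^+ 2 * T 2 0 + 1 ^+ 2 * T 2 1 + 2 ^+ 2 * T 2 2 + 0 ^+ 2 * T 2 3 + 1 ^+ 2 * T 2 4 + 2 ^+ 2 * T 2 5); first by [].
  by move: (T 2 0) (T 2 1) (T 2 2) (T 2 3) (T 2 4) (T 2 5) => *; ring.
by [].
Qed.

(** The choice N = 6 gives a third relation between the same two logarithms: r mod 6 is not a linear
    combination of r mod 2 and r mod 3. *)
Lemma ell_six : ell (2 ^+ p.-1) + ell (3 ^+ p.-1)
  - (P * (T 1 1 + 2 * T 1 2 + 3 * T 1 3 + 4 * T 1 4 + 5 * T 1 5)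
    - P ^+ 2 / 2 * (T 2 1 + 4 * T 2 2 + 9 * T 2 3 + 16 * T 2 4 + 25 * T 2 5)) \in pk p 3.
Proof.
have N6 : (6 %| p.+1)%N by rewrite pE dvdn_mulr.
have [U2 _] := ell_two; have [U3 _] := ell_three.
have [U E] := ell_natpow N6; move: E.
rewrite (_ : 6 ^+ p.-1 = 2 ^+ p.-1 * 3 ^+ p.-1); last by rewrite -exprMn -natrM.
move=> E; apply: eqp_trans (eqp_sym (ellM U2 U3)) _; apply: eqp_trans E _.
have -> : \sum_(i < p.-1) (i.+1 %% 6)%:R / i.+1%:R = T 1 1 + 2 * T 1 2 + 3 * T 1 3 + 4 * T 1 4 + 5 * T 1 5.
  rewrite (@class_weight 1 (fun c => c%:R)) // (sum6 (fun c => c%:R * T 1 c)).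
  transitivity (0 * T 1 0 + 1 * T 1 1 + 2 * T 1 2 + 3 * T 1 3 + 4 * T 1 4 + 5 * T 1 5); first by [].
  by move: (T 1 0) (T 1 1) (T 1 2) (T 1 3) (T 1 4) (T 1 5) => *; ring.
have -> : \sum_(i < p.-1) (i.+1 %% 6)%:R ^+ 2 / i.+1%:R ^+ 2 = T 2 1 + 4 * T 2 2 + 9 * T 2 3 + 16 * T 2 4 + 25 * T 2 5.
  rewrite (@class_weight 2 (fun c => c%:R ^+ 2)) // (sum6 (fun c => c%:R ^+ 2 * T 2 c)).
  transitivity (0 ^+ 2 * T 2 0 + 1 ^+ 2 * T 2 1 + 2 ^+ 2 * T 2 2 + 3 ^+ 2 * T 2 3 + 4 ^+ 2 * T 2 4 + 5 ^+ 2 * T 2 5); first by [].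
  by move: (T 2 0) (T 2 1) (T 2 2) (T 2 3) (T 2 4) (T 2 5) => *; ring.
by rewrite subrr rpred0.
Qed.

End FiveModSix.

(** * The numbers U_n modulo p by umbral calculus *)

Lemma U_odd_eq0 n : odd n -> U n = 0.
Proof. by rewrite /U => ->. Qed.

(** Umbrally, (U + 1)^k + (U - 1)^k = U^k + 0^k, in one formula for all k. Terms with k - i odd
    cancel and U_i vanishes for odd i, so odd k is trivial and even k is the defining recursion. *)
Lemma U_recurrence k :
  \sum_(i < k.+1) 'C(k, i)%:Z * (1 + (-1) ^+ (k - i)) * U i = U k + (k == 0)%:Z.
Proof.
case: (boolP (odd k)) => ok.
  rewrite [U k]U_odd_eq0 // big1 => [|i _]; first by case: k ok.
  case: (boolP (odd i)) => oi; first by rewrite U_odd_eq0 // mulr0.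
  by rewrite -signr_odd oddB ?leq_ord // ok (negPf oi) expr1 subrr mulr0 mul0r.
have -> : k = (2 * k./2)%N by rewrite mul2n even_halfK.
move: (k./2) => {k ok} n.
case: n => [|n]; first by rewrite big_ord_recr big_ord0 /= U0.
have EO : \sum_(i < n.+1) 'C(2 * n.+1, i.*2)%:Z * U i.*2 * 2 = - U (2 * n.+1).
  rewrite U_even // big_add1 big_mkord mulNr opprK mulr_sumr.
  rewrite (big_ord_rev _ n.+1 (fun i => 'C(2 * n.+1, i.*2)%:Z * U i.*2 * 2)).
  apply: eq_bigr => i _; have ni := ltn_ord i.
  rewrite (_ : (n.+1 - i.+1).*2 = 2 * n.+1 - 2 * i.+1)%N; last by lia.
  by rewrite bin_sub; [ring|lia].
rewrite big_ord_recr /= subnn expr0 binn mul1r.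
rewrite [X in X + _ = _](_ : _ = - U (2 * n.+1)); last first.
  rewrite -EO; set F := fun i => 'C(2 * n.+1, i)%:Z * (1 + (-1) ^+ (2 * n.+1 - i)) * U i.
  have -> : \sum_(i < 2 * n.+1) F i = \sum_(i < n.+1.*2) F i by rewrite mul2n.
  rewrite (big_ord_double _ n.+1 F) /F /=.
  rewrite [X in _ + X]big1 ?addr0 => [|i _]; last by rewrite [U _]U_odd_eq0 ?mulr0 //= odd_double.
  apply: eq_bigr => i _; rewrite -signr_odd oddB; last by have := ltn_ord i; lia.
  by rewrite mul2n !odd_double expr0; ring.
by rewrite addr0; ring.
Qed.

(* Umbral evaluation: the linear form on polynomials sending X^i to U_i. *)
Definition umbral (N : nat) (q : {poly int}) : int := \sum_(i < N.+1) q`_i * U i.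

Lemma coef_XaddC_exp (c : int) k i : (('X + c%:P) ^+ k)`_i = 'C(k, i)%:Z * c ^+ (k - i).
Proof.
rewrite addrC exprDn coef_sum.
under eq_bigr do rewrite coefMn -polyC_exp coefCM coefXn.
have [ik|ki] := leqP i k.
  rewrite (bigD1 (Ordinal (ik : (i < k.+1)%N))) //= eqxx big1 ?addr0 => [|j].
    by rewrite mulr1 -mulr_natl natz.
  by rewrite -val_eqE /= eq_sym => /negPf ->; rewrite mulr0 mul0rn.
rewrite big1 => [|j _]; first by rewrite bin_small ?mul0r.
by rewrite gtn_eqF ?mulr0 ?mul0rn // (leq_ltn_trans (leq_ord j)).
Qed.

(** The recurrence for monomials, extended by linearity so that it can be applied to translates of a
    power. *)
Lemma umbral_shift N (q : {poly int}) : (size q <= N.+1)%N ->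
  umbral N (q \Po ('X + 1%:P)) + umbral N (q \Po ('X + (-1)%:P)) = umbral N q + q.[0].
Proof.
move=> sq; have qE : q = \sum_(k < N.+1) q`_k *: 'X^k.
  apply/polyP => i; rewrite coef_sum; under eq_bigr do rewrite coefZ coefXn.
  have [iN|Ni] := leqP i N.
    rewrite (bigD1 (Ordinal (iN : (i < N.+1)%N))) //= eqxx mulr1 big1 ?addr0 // => j.
    by rewrite -val_eqE /= eq_sym => /negPf ->; rewrite mulr0.
  rewrite big1 => [|j _]; first by rewrite nth_default // (leq_trans sq).
  by rewrite gtn_eqF ?mulr0 // (leq_ltn_trans (leq_ord j)).
have uE (e : int) : umbral N (q \Po ('X + e%:P)) =
    \sum_(k < N.+1) q`_k * \sum_(i < k.+1) 'C(k, i)%:Z * e ^+ (k - i) * U i.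
  rewrite {1}qE /umbral.
  under eq_bigr => i _.
    rewrite rmorph_sum /= coef_sum mulr_suml.
    under eq_bigr do rewrite comp_polyZ rmorphXn /= comp_polyX coefZ coef_XaddC_exp.
    over.
  rewrite exchange_big /=; apply: eq_bigr => k _; rewrite mulr_sumr.
  under eq_bigr do rewrite -mulrA.
  rewrite -!(big_mkord xpredT (fun i => q`_k * ('C(k, i)%:Z * e ^+ (k - i) * U i))).
  rewrite (big_cat_nat (n := k.+1)) //= [X in _ + X]big_nat_cond.
  by rewrite [X in _ + X]big1 ?addr0 // => i /andP[/andP[ki _] _]; rewrite bin_small // !mul0r mulr0.
rewrite !uE -big_split /= horner_coef0 /umbral.
transitivity (\sum_(k < N.+1) q`_k * (U k + (k == 0 :> nat)%:Z)).
  apply: eq_bigr => k _; rewrite -mulrDr -big_split -U_recurrence; congr (_ * _).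
  by apply: eq_bigr => i _; rewrite /= expr1n; ring.
under eq_bigr do rewrite mulrDr; rewrite big_split /=; congr (_ + _).
by rewrite big_ord_recl /= mulr1 big1 ?addr0 // => i _; rewrite mulr0.
Qed.

(** In umbral notation (U + x)^n, an Appell polynomial in x. It sums n-th powers over classes modulo
    6 as Bernoulli polynomials sum consecutive n-th powers. *)
Definition umbral_pow (n : nat) (x : int) : int := umbral n (('X + x%:P) ^+ n).

Lemma umbral_pow_rec n (x : int) :
  umbral_pow n (x + 1) + umbral_pow n (x - 1) = umbral_pow n x + x ^+ n.
Proof.
have sz : (size (('X + x%:P) ^+ n) <= n.+1)%N.
  by rewrite (leq_trans (size_poly_exp_leq _ _)) // size_XaddC mul1n.
have := umbral_shift sz; rewrite !rmorphXn /= !comp_polyD !comp_polyX !comp_polyC.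
rewrite -!addrA -!polyCD horner_exp hornerD hornerX hornerC add0r => <-.
by rewrite /umbral_pow ![x + _]addrC.
Qed.

Lemma umbral_pow0 n : umbral_pow n 0 = U n.
Proof.
rewrite /umbral_pow /umbral big_ord_recr /= coef_XaddC_exp subnn binn !mul1r.
rewrite big1 ?add0r // => i _; rewrite coef_XaddC_exp expr0n.
by rewrite (_ : _ == 0 = false)%N ?mulr0 ?mul0r //; have := ltn_ord i; lia.
Qed.

Lemma umbral_powN n (x : int) : ~~ odd n -> umbral_pow n (- x) = umbral_pow n x.
Proof.
move=> en; apply: eq_bigr => i _; rewrite !coef_XaddC_exp.
case: (boolP (odd i)) => oi; first by rewrite U_odd_eq0 // !mulr0.
rewrite exprNn -signr_odd oddB ?leq_ord // (negPf en) (negPf oi) expr0 mul1r.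
by [].
Qed.

Lemma umbral_pow_periodic n : (umbral_pow n p)%:~R - (umbral_pow n 0)%:~R \in pk p 1.
Proof.
rewrite /umbral_pow /umbral -rmorphB -sumrB rmorph_sum; apply: rpred_sum => i _ /=.
rewrite !coef_XaddC_exp -mulrBl -mulrBr !rmorphM rmorphB /=.
rewrite mulrC pkMl ?zp_int // pkMl ?zp_int //.
rewrite !rmorphXn /=; case: (n - i)%N => [|k]; first by rewrite subrr rpred0.
by rewrite expr0n subr0 exprS pkMr ?pkP ?zpX ?zp_nat.
Qed.

(** In terms of the shift E, the operator E^2 - E + 1 of the recurrence divides E^3 + 1, so f(y + 3)
    + f(y) is a sum of two powers. Applied twice, this returns to f itself after 6 steps. *)
Lemma umbral_pow_step n (x : int) :
  umbral_pow n (x + 6) = umbral_pow n x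
   - (x + 1) ^+ n - (x + 2) ^+ n + (x + 4) ^+ n + (x + 5) ^+ n.
Proof.
have H y : umbral_pow n (y + 3) = - umbral_pow n y + (y + 1) ^+ n + (y + 2) ^+ n.
  have A1 : umbral_pow n (y + 3) + umbral_pow n (y + 1) = umbral_pow n (y + 2) + (y + 2) ^+ n.
    by rewrite -umbral_pow_rec; congr (umbral_pow n _ + umbral_pow n _); ring.
  have A2 : umbral_pow n (y + 2) + umbral_pow n y = umbral_pow n (y + 1) + (y + 1) ^+ n.
    by rewrite -umbral_pow_rec; congr (umbral_pow n _ + umbral_pow n _); ring.
  rewrite -(addrK (umbral_pow n (y + 1)) (umbral_pow n (y + 3))) A1.
  by rewrite -(addrK (umbral_pow n y) (umbral_pow n (y + 2))) A2; ring.
rewrite (_ : x + 6 = x + 3 + 3); last by ring.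
rewrite !H (_ : x + 3 + 1 = x + 4); last by ring.
by rewrite (_ : x + 3 + 2 = x + 5); ring.
Qed.

Section UFiveModSix.

Variable m : nat.
Hypothesis pE : p.+1 = (6 * m)%N.

Local Notation T := (classsum m).

Lemma umbral_pow_sum n k : umbral_pow n (6 * k%:Z - 1) = umbral_pow n (-1)
  - \sum_(i < k) ((6 * i)%N%:Z ^+ n - (6 * i + 3)%N%:Z ^+ n + ((6 * i + 1)%N%:Z ^+ n - (6 * i + 4)%N%:Z ^+ n)).
Proof.
elim: k => [|k IHk]; first by rewrite big_ord0 subr0 mulr0 add0r.
rewrite big_ord_recr /= (_ : 6 * k.+1%:Z - 1 = 6 * k%:Z - 1 + 6); last by rewrite -[k.+1]addn1 PoszD; ring.
rewrite umbral_pow_step IHk. 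
have e c : (6 * k + c)%N%:Z = 6 * k%:Z + c%:Z by rewrite PoszD PoszM.
rewrite !e [(6 * k)%N%:Z](PoszM 6 k); move: (\sum_(i < k) _) => s.
rewrite (_ : 6 * k%:Z - 1 + 1 = 6 * k%:Z); last by ring.
rewrite (_ : 6 * k%:Z - 1 + 2 = 6 * k%:Z + 1); last by ring.
rewrite (_ : 6 * k%:Z - 1 + 4 = 6 * k%:Z + 3); last by ring.
rewrite (_ : 6 * k%:Z - 1 + 5 = 6 * k%:Z + 4); last by ring.
ring.
Qed.

Lemma pow_invp r : (r < p)%N -> r%:R ^+ (p - 3) - invp 2 r \in pk p 1.
Proof.
have p5 := p_gt5; move=> rp; rewrite invpE //; case: r rp => [|r] rp.
  by rewrite !expr0n invr0 subr0 (_ : _ == 0 = false)%N ?rpred0 //; lia.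
have ru : r.+1%:R \in zu p by apply: zu_small.
rewrite -(pk_mulu _ _ (zuX 2 ru)) mulrBr divff ?expf_neq0 ?zu_neq0 //.
rewrite -exprD (_ : 2 + (p - 3) = p.-1)%N; last by lia.
have : (p %| r.+1 ^ p.-1 - 1)%N.
  have cp : coprime r.+1 p by rewrite coprime_sym prime_coprime // gtnNdvd.
  have := Euler_exp_totient cp; rewrite totient_prime // => /eqP.
  by rewrite eqn_mod_dvd ?expn_gt0.
move=> /dvdnP[c E]; rewrite -natrX -[X in _ - X]/(1%:R) -natrB ?expn_gt0 //.
by rewrite E natrM pkMl ?pkP ?zp_nat.
Qed.

(** Let f be [umbral_pow n] with n = p - 3. Modulo p, f(p) = f(0) = U_n, while evenness and the
    recurrence at 0 give f(-1) = U_n / 2. Stepping from -1 to p = 6m - 1 thus evaluates a signed sum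
    of powers r^(p-3), that is of r^-2 modulo p, in which the classes 1 and 4 cancel. *)
Lemma class2_U : T 2 0 - T 2 3 + (U (p - 3))%:~R / 2 \in pk p 1.
Proof.
have p5 := p_gt5; set n := (p - 3)%N.
have en : ~~ odd n by rewrite /n p_half; lia.
have pE' : p%:Z = 6 * m%:Z - 1.
  by rewrite -[6 * _]/((6 * m)%N%:Z) -pE -[p.+1]addn1 PoszD addrK.
have fN1 : umbral_pow n (-1) *+ 2 = U n.
  have := umbral_pow_rec n 0; rewrite add0r sub0r umbral_pow0 expr0n.
  rewrite (_ : n == 0 = false)%N; last by rewrite /n; lia.
  by rewrite addr0 -{1}[1](opprK 1) umbral_powN // -mulr2n.
have S := umbral_pow_sum n m; rewrite -pE' in S.
have := umbral_pow_periodic n; rewrite S umbral_pow0 -fN1 => H.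
have E c : (c < 5)%N -> (\sum_(i < m) (6 * i + c)%N%:Z ^+ n)%:~R - T 2 c \in pk p 1.
  move=> c5; rewrite rmorph_sum /= -sumrB; apply: rpred_sum => i _.
  by rewrite rmorphXn /=; apply: pow_invp; have := ltn_ord i; lia.
have R1 : T 2 4 - T 2 1 \in pk p 1 := class2_rev pE (isT : (1 < 6)%N).
move: H; rewrite big_split /= !sumrB => H.
have E0 := E 0 isT; rewrite [X in X%:~R - _](eq_bigr (fun i : 'I_m => (6 * i)%N%:Z ^+ n)) in E0; last by move=> i _; rewrite addn0.
have E1 := E 1 isT; have E3 := E 3 isT; have E4 := E 4 isT.
have -> : (umbral_pow n (-1) *+ 2)%:~R / 2 = (umbral_pow n (-1))%:~R :> rat.
  by rewrite rmorphMn /= -mulr_natr; field.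
move: H E0 E1 E3 E4 R1; rewrite !(rmorphB, rmorphD, rmorphMn) /=.
move: (T 2 0) (T 2 1) (T 2 3) (T 2 4) (umbral_pow n (-1))%:~R => t0 t1 t3 t4 f.
move: (_%:~R) (_%:~R) (_%:~R) (_%:~R) => s4 s1 s3 s0 H E0 E1 E3 E4 R1.
rewrite [X in X \in _](_ : _ = - (f - (s0 - s3 + (s1 - s4)) - (f + f)) - (s0 - t0) + (s3 - t3) - (s1 - t1) + (s4 - t4) + (t4 - t1)); last by ring.
exact: (pkD (pkD (pkB (pkD (pkB (pkN H) E0) E3) E1) E4) R1).
Qed.

End UFiveModSix.

(* The coefficients 1/2, -5/3, 1/6 eliminate the six first-order class sums. *)
Lemma class_algebra a0 a1 a2 a3 a4 a5 b0 b1 b2 b3 b4 b5 q2 q3 u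
    (l2 := ell (1 + P * q2)) (l3 := ell (1 + P * q3)) (y := - u / 12)
    (c1 := 2 + 4 / 3 * q2 - 3 / 2 * q3)
    (c2 := 1 + 8 / 3 * q2 + 2 / 9 * q2 ^+ 2 - 3 * q3
                     - 2 * q2 * q3 + 15 / 8 * q3 ^+ 2 + 3 / 4 * u) :
  q2 \in zp p -> q3 \in zp p -> u \in zp p ->
  a5 + a0 + P * b0 \in pk p 2 -> a4 + a1 + P * b1 \in pk p 2 ->
  a3 + a2 + P * b2 \in pk p 2 ->
  b5 - b0 \in pk p 1 -> b4 - b1 \in pk p 1 ->
  b0 - 5 * y \in pk p 1 -> b1 + 4 * y \in pk p 1 ->
  b2 + y \in pk p 1 -> b3 + y \in pk p 1 ->
  l2 - (P * (a1 + a3 + a5) - P ^+ 2 / 2 * (b1 + b3 + b5)) \in pk p 3 ->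
  l3 - (P * (a1 + 2 * a2 + a4 + 2 * a5)
    - P ^+ 2 / 2 * (b1 + 4 * b2 + b4 + 4 * b5)) \in pk p 3 ->
  l2 + l3 - (P * (a1 + 2 * a2 + 3 * a3 + 4 * a4 + 5 * a5)
    - P ^+ 2 / 2 * (b1 + 4 * b2 + 9 * b3 + 16 * b4 + 25 * b5)) \in pk p 3 ->
  4 * P * a3 + 8 * P ^+ 2 * b3 + 2 * P * (a0 + (P + 1)^-1)
    + P ^+ 2 * (b0 + (P + 1) ^- 2) + 2 / 3 * l2
    - (P * c1 + P ^+ 2 * (c2 - c1 ^+ 2 / 2)) \in pk p 3.
Proof.
move=> q2z q3z uz R0 R1 R2 S0 S1 V0 V1 V2 V3.
set D2 := _ - _; set D3 := _ - _; set D6 := _ - _; move=> D2k D3k D6k.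
have P1u : P + 1 \in zu p by rewrite addrC zuD ?zu1 ?pkP.
set Z := - (b5 - b0) + (b4 - b1) / 2 + 9 * (b3 + y) - 6 * (b2 + y)
         - 2 * (b0 - 5 * y) - (b1 + 4 * y).
have Zk : Z \in pk p 1.
  have n k x : x \in pk p 1 -> k%:R * x \in pk p 1 by move=> xk; rewrite pkMl ?zp_nat.
  exact: (pkB (pkB (pkB (pkD (pkD (pkN S0) (half_pk S1)) (n 9 _ V3)) (n 6 _ V2)) (n 2 _ V0)) V1).
set W := 2 / (P + 1) - (2 + P) / (P + 1) ^+ 2.
have Wz : W \in zp p by rewrite /W; zpt; exact: zuX.
have E : 4 * P * a3 + 8 * P ^+ 2 * b3 + 2 * P * (a0 + (P + 1)^-1)
    + P ^+ 2 * (b0 + (P + 1) ^- 2) + 2 / 3 * l2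
    - (P * c1 + P ^+ 2 * (c2 - c1 ^+ 2 / 2))
  = - (1 / 2) * D2 + 5 / 3 * D3 - 1 / 6 * D6
    + P * (3 * (a3 + a2 + P * b2) + (a4 + a1 + P * b1) + 2 * (a5 + a0 + P * b0))
    + P ^+ 2 * Z + P ^+ 3 * W.
  rewrite /D2 /D3 /D6 /Z /W /l2 /l3 /y /c1 /c2 !ell1D.
  clear -P1u; have P0 := zu_neq0 P1u.
  by move: P P0 => x x0; field.
rewrite E; clear E; clearbody D2 D3 D6 Z W.
have u6 : 6 \in zu p by rewrite (_ : 6 = 2 * 3); [exact: zuM zu2 zu3|ring].
have t k c x : c \in zp p -> x \in pk p k -> c * x \in pk p k by move=> cz xk; apply: pkMl.
have k1 : - (1 / 2) \in zp p by apply/zpN/zpM; [exact: zp1|exact: zuV_zp zu2].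
have k2 : 5 / 3 \in zp p by apply: zpM; [exact: zp_nat|exact: zuV_zp zu3].
have k3 : 1 / 6 \in zp p by apply: zpM; [exact: zp1|exact: zuV_zp u6].
have k4 : P * (3 * (a3 + a2 + P * b2) + (a4 + a1 + P * b1) + 2 * (a5 + a0 + P * b0)) \in pk p 3.
  apply: (@pkM 1 2); first exact: pkP.
  exact: (pkD (pkD (t _ _ _ (zp_nat p 3) R2) R1) (t _ _ _ (zp_nat p 2) R0)).
have k5 : P ^+ 2 * Z \in pk p 3 := pkM (pkX 2) Zk.
have k6 : P ^+ 3 * W \in pk p 3 := pkMr (pkX 3) Wz.
exact: (pkD (pkD (pkD (pkB (pkD (t _ _ _ k1 D2k) (t _ _ _ k2 D3k)) (t _ _ _ k3 D6k)) k4) k5) k6).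
Qed.

Lemma bin_prod n k : (k <= n)%N ->
  'C(n, k)%:R = \prod_(i < k) ((n - i)%:R / i.+1%:R) :> rat.
Proof.
elim: k => [|k IHk] kn; first by rewrite bin0 big_ord0.
have k0 : k.+1%:R != 0 :> rat by rewrite pnatr_eq0.
rewrite big_ord_recr /= -IHk; last by lia.
apply: (mulfI k0); rewrite -natrM mul_bin_left natrM.
by move: (k.+1%:R : rat) k0 => x x0; field.
Qed.

(** * The case p = 2 modulo 3 *)

Section FinalFiveModSix.

Variable m : nat.
Hypothesis pE : p.+1 = (6 * m)%N.

Local Notation T := (classsum m).
Local Notation B := ('C((p - 1) %/ 2, (p - 5) %/ 6)%:R : rat).
Local Notation t := (- (1 / 3) : rat).

(** Here (p - 1) / 2 = 3m - 1, which gives C(3m - 1, m) = 2 C(3m - 1, m - 1). The former has as many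
    factors as the chain of m steps with which it is compared. *)
Lemma bin_half_prod : 2 * B = \prod_(i < m) ((P - i.*2.+1%:R) / i.*2.+2%:R).
Proof.
have m1 := m_gt1 pE; have hE : (p - 1 = h.*2)%N by have := p_half; lia.
have hm : h.+1 = (3 * m)%N by have := p_half; lia.
have -> : ((p - 1) %/ 2 = h)%N by rewrite hE -muln2 mulnK.
have -> : ((p - 5) %/ 6 = m.-1)%N.
  by rewrite (_ : p - 5 = m.-1 * 6)%N ?mulnK //; lia.
have -> : 2 * 'C(h, m.-1)%:R = 'C(h, m)%:R :> rat.
  have m0 : m%:R != 0 :> rat by rewrite pnatr_eq0; lia.
  apply: (mulfI m0); rewrite -!natrM; congr (_%:R).
  have := mul_bin_left h m.-1; rewrite prednK; last by lia.
  by move=> ->; rewrite (_ : h - m.-1 = m * 2)%N ?mulnA //; lia.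
rewrite bin_prod; last by lia.
apply: eq_bigr => i _; have im := ltn_ord i.
have -> : P - i.*2.+1%:R = 2 * (h - i)%:R.
  by rewrite -natrB; [rewrite -natrM; congr (_%:R)|]; have := p_half; lia.
have -> : i.*2.+2%:R = 2 * i.+1%:R :> rat by rewrite -natrM; congr (_%:R); lia.
have i0 : i.+1%:R != 0 :> rat by rewrite pnatr_eq0.
by move: (i.+1%:R : rat) i0 => x x0; field.
Qed.

Lemma zu_lin a s : (0 < a < p)%N -> s \in zp p -> a%:R + P * s \in zu p.
Proof. by move=> ap sz; rewrite zuD ?zu_small // pkMr ?pkP. Qed.

Lemma zu_bin : B \in zu p.
Proof.
have : 2 * B \in zu p.
  rewrite bin_half_prod; apply: zu_prod => i _; have im := ltn_ord i.
  apply: zuM; last by apply/zuV/zu_small; lia.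
  by rewrite addrC zuD ?pkP // zuN // zu_small //; lia.
by move/(zuM (zuV zu2)); rewrite mulKf // zu_neq0 ?zu2.
Qed.

(** The 1-unit by which S(1/3) differs from (2 B)^2 modulo p^3: the m steps from 1/3 down to -p/3,
    divided factor by factor by 2 B. *)
Definition fiveR : rat :=
  (\prod_(i < m) ((i.*2.+1%:R + P * t) / (i.*2.+2%:R + P * t)
     * (i.*2.+2%:R / (P - i.*2.+1%:R)))) ^+ 2 * hsum (P * t).

(** As p + 1 = 6m, 2/3 is 4m - 2p/3; one step down and the reflection lead to 1/3 = 2m - p/3, from
    which m steps reach -p/3. The first step contributes ((-1/3) / (2/3))^2 = 1/4, which turns (2
    B)^2 into B^2. *)
Lemma hsum_two_thirds : hsum (2 / 3) - B ^+ 2 * fiveR \in pk p 3.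
Proof.
have m1 := m_gt1 pE; have tz := neg_third_zp.
have pR : P = 6 * m%:R - 1 by rewrite -natrM -pE -natr1 addrK.
have r1 : (1 < 4 * m < p)%N by lia.
have s1 : - (2 / 3) \in zp p by apply/zpN; exact: two_thirds_zp.
have := hsum_down r1 s1.
have -> : (4 * m)%:R + P * - (2 / 3) = 2 / 3 by rewrite natrM pR; field.
have -> : (4 * m)%:R - 1 + P * - (2 / 3) = - (1 / 3) by rewrite natrM pR; field.
have -> : (4 * m)%:R - 2 + P * - (2 / 3) = - 1 - 1 / 3 by rewrite natrM pR; field.
rewrite hsum_sym => H1.
have m2p : (0 + m.*2 < p)%N by lia.
have := hsum_shift m2p tz; rewrite [0%:R + _]add0r.
have -> : (0 + m.*2)%:R + P * t = 1 / 3 by rewrite add0n -mul2n natrM pR; field.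
move=> H2.
have {}H2 : hsum (1 / 3) - (2 * B) ^+ 2 * fiveR \in pk p 3.
  rewrite bin_half_prod /fiveR mulrA -exprMn -big_split /=.
  rewrite (eq_bigr (fun i : 'I_m => (i.*2.+1%:R + P * t) / (i.*2.+2%:R + P * t))).
    exact: H2.
  move=> i _; have im := ltn_ord i.
  have n1 : i.*2.+2%:R != 0 :> rat by rewrite pnatr_eq0.
  have n2 : P - i.*2.+1%:R != 0 by rewrite subr_eq0 eqr_nat; lia.
  have n3 : i.*2.+2%:R + P * t != 0 by apply/zu_neq0/zu_lin => //; lia.
  move: (P * t) n3 => s n3; move: (i.*2.+1%:R : rat) (i.*2.+2%:R : rat) n1 n2 n3.
  by move=> x z n1 n2 n3; field; rewrite n1 n2 n3.
apply: eqp_trans H1 _.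
rewrite [X in X \in _](_ : _ = (hsum (1 / 3) - (2 * B) ^+ 2 * fiveR) / 4); last by field.
exact: pk_divu H2 zu4.
Qed.

(** Tripling 2i + 2 gives 6 (i + 1). The last of these is 6m = p + 1, beyond class 0, hence the
    extra term; the index 0 of class 0 contributes nothing. *)
Lemma class_even k : (0 < k)%N ->
  \sum_(i < m) i.*2.+2%:R ^- k = 3 ^+ k * (T k 0 + (P + 1) ^- k).
Proof.
move=> k0; have m1 := m_gt1 pE.
have H (n : nat) : n.*2%:R ^- k = 3 ^+ k * (6 * n)%N%:R ^- k :> rat.
  rewrite (_ : 6 * n = 3 * n.*2)%N; last by lia.
  by rewrite natrM exprMn invfM mulVKf // expf_neq0.
have mE : m = m.-1.+1 by lia.
rewrite /classsum [in LHS]mE [in X in _ * (X + _)]mE big_ord_recr big_ord_recl /=.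
rewrite (invp0 k0) add0r mulrDr mulr_sumr; congr (_ + _).
  apply: eq_bigr => i _; have im := ltn_ord i.
  by rewrite -doubleS H addn0 invpE //; rewrite /bump; lia.
by rewrite -doubleS -mE H -pE -[p.+1%:R]natr1.
Qed.

Lemma class_odd k : \sum_(i < m) i.*2.+1%:R ^- k = 3 ^+ k * T k 3.
Proof.
rewrite mulr_sumr; apply: eq_bigr => i _; have im := ltn_ord i.
rewrite invpE; last by lia.
rewrite (_ : 6 * i + 3 = 3 * i.*2.+1)%N; last by lia.
by rewrite natrM exprMn invfM mulVKf // expf_neq0.
Qed.

Lemma fermat_q (a : nat) : a%:R ^+ p.-1 = 1 + P * fermat_quotient p a.
Proof. by rewrite /fermat_quotient subn1 mulrC divfK ?P_neq0 // addrC subrK. Qed.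

Lemma fermat_q_zp (a : nat) : a%:R ^+ p.-1 \in u1 -> fermat_quotient p a \in zp p.
Proof.
move=> au; have : (a%:R ^+ p.-1 - 1) / P ^+ 1 \in zp p by [].
by rewrite expr1 /fermat_quotient subn1.
Qed.

Lemma ell_quot x y z : x \in u1 -> y \in u1 -> z \in u1 ->
  ell (x * (y^-1 * z^-1)) - (ell x - ell y - ell z) \in pk p 3.
Proof.
move=> xu yu zu'; have h1 := ellM xu (u1M (u1V yu) (u1V zu')).
have := pkD (pkD (pkD h1 (ellM (u1V yu) (u1V zu'))) (ellV yu)) (ellV zu').
rewrite [X in X \in _ -> _](_ : _ = ell (x * (y^-1 * z^-1)) - (ell x - ell y - ell z)) //.
by move: (ell _) (ell _) (ell _) (ell _) (ell _) (ell _) (ell _) => *; ring.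
Qed.

(** The square makes the sign of p - (2i + 1) harmless, so only 1-units are multiplied. Their
    logarithms are reciprocal sums over odd and even numbers, which after tripling are the classes 3
    and 0. *)
Lemma ell_fiveR : fiveR \in u1 /\
  ell fiveR - (4 * P * T 1 3 + 8 * P ^+ 2 * T 2 3 + 2 * P * (T 1 0 + (P + 1)^-1)
    + P ^+ 2 * (T 2 0 + (P + 1) ^- 2) + 2 / 3 * ell (2 ^+ p.-1)) \in pk p 3.
Proof.
have m1 := m_gt1 pE; have tz := neg_third_zp.
pose o (i : nat) : rat := i.*2.+1%:R; pose e (i : nat) : rat := i.*2.+2%:R.
have ou (i : 'I_m) : o i \in zu p by apply: zu_small; have := ltn_ord i; lia.
have eu (i : 'I_m) : e i \in zu p by apply: zu_small; have := ltn_ord i; lia.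
have Ptk : P * t \in pk p 1 by apply: pkMr pkP tz.
have oP (i : 'I_m) : 1 + P * t / o i \in u1 by apply/u1D/pk_divu.
have eP (i : 'I_m) : 1 + P * t / e i \in u1 by apply/u1D/pk_divu.
have oN (i : 'I_m) : 1 + - P / o i \in u1 by apply/u1D/pk_divu => //; exact: pkN pkP.
pose F (i : 'I_m) := (1 + P * t / o i) * ((1 + P * t / e i)^-1 * (1 + - P / o i)^-1).
have Fu (i : 'I_m) : true -> F i \in u1.
  by move=> _; exact: (u1M (oP i) (u1M (u1V (eP i)) (u1V (oN i)))).
have Fe (i : 'I_m) : ell (F i) - (ell (1 + P * t / o i) - ell (1 + P * t / e i) - ell (1 + - P / o i)) \in pk p 3.
  exact: ell_quot.
pose L := \sum_(i < m) (ell (1 + P * t / o i) - ell (1 + P * t / e i) - ell (1 + - P / o i)).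
have PFu : \prod_i F i \in u1 by apply: u1_prod.
have PFe : ell (\prod_i F i) - L \in pk p 3.
  apply: eqp_trans (ell_prod _ Fu) _.
  by rewrite /L -sumrB; apply: rpred_sum => i _; exact: Fe.
have LE : L = 2 * P * T 1 3 + 4 * P ^+ 2 * T 2 3 + P * (T 1 0 + (P + 1)^-1)
    + P ^+ 2 / 2 * (T 2 0 + (P + 1) ^- 2).
  have o1 := class_odd 1; have o2 := class_odd 2.
  have e1 := @class_even 1 isT; have e2 := @class_even 2 isT.
  transitivity (P * t * (\sum_(i < m) (o i) ^- 1) - (P * t) ^+ 2 / 2 * (\sum_(i < m) (o i) ^- 2)
    - P * t * (\sum_(i < m) (e i) ^- 1) + (P * t) ^+ 2 / 2 * (\sum_(i < m) (e i) ^- 2)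
    + P * (\sum_(i < m) (o i) ^- 1) + P ^+ 2 / 2 * (\sum_(i < m) (o i) ^- 2)).
    rewrite /L !mulr_sumr -!sumrN -!big_split; apply: eq_bigr => i _ /=.
    rewrite !ell1D; move: (zu_neq0 (ou i)) (zu_neq0 (eu i)).
    by move: (o i) (e i) => x y x0 y0; field; rewrite x0 y0.
  rewrite o1 o2 e1 e2 !expr1 -!exprVn; move: (T 1 0) (T 2 0) (T 1 3) (T 2 3) (P + 1)^-1 => *.
  by field.
have Su := hsum_Pt tz; case: Su => Su Se.
have RE : fiveR = (\prod_i F i) ^+ 2 * hsum (P * t).
  rewrite /fiveR -!prodrXl; congr (_ * _); apply: eq_bigr => i _.
  rewrite -/(o i) -/(e i) /F.
  have n1 := zu_neq0 (ou i); have n2 := zu_neq0 (eu i).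
  have n3 : e i + P * t != 0 by apply/zu_neq0/zuD.
  have n4 : P - o i != 0 by rewrite addrC; apply/zu_neq0; exact: (zuD (zuN (ou i)) pkP).
  have n5 : o i - P != 0 by rewrite -oppr_eq0 opprB.
  have -> : 1 + P * t / o i = (o i + P * t) / o i by rewrite mulrDl divff.
  have -> : 1 + P * t / e i = (e i + P * t) / e i.
    by rewrite mulrDl divff.
  have -> : 1 + - P / o i = (o i - P) / o i by rewrite mulrDl divff.
  have -> : P - o i = - (o i - P) by rewrite opprB.
  move: (o i) (e i) (o i + P * t) (e i + P * t) (o i - P) n1 n2 n3 n5.
  by move=> d f a b c n1 n2 n3 n5; field; rewrite n1 n2 n3 n5.
have Ru : fiveR \in u1 by rewrite RE; exact: (u1M (u1X 2 PFu) Su).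
split=> //.
have h1 := ellM (u1X 2 PFu) Su; rewrite -RE in h1.
have h2 := ellX 2 PFu.
have l4 : ell (4 ^+ p.-1) - 2 * ell (2 ^+ p.-1) \in pk p 3.
  have [U2 _] := ell_two pE.
  by rewrite (_ : 4 = 2 ^+ 2) -?exprM 1?mulnC ?exprM ?ellX // expr2; ring.
move: h1 h2 Se l4 PFe; rewrite LE -!exprVn.
move: (ell fiveR) (ell (_ ^+ 2)) (ell (hsum _)) (ell (\prod_i F i)) (ell (4 ^+ _)) (ell (2 ^+ _)).
move: (T 1 0) (T 2 0) (T 1 3) (T 2 3) (P + 1)^-1.
move=> a0 b0 a3 b3 ip r f2 sp f l4 l2 h1 h2 Se hl4 PFe.
rewrite [X in X \in _](_ : _ = (r - (f2 + sp)) + (f2 - 2 * f) + 2 * (f - (2 * P * a3 + 4 * P ^+ 2 * b3 + P * (a0 + ip)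
    + P ^+ 2 / 2 * (b0 + ip ^+ 2))) + (sp + t * l4) - t * (l4 - 2 * l2)); last first.
  by field.
exact: (pkB (pkD (pkD (pkD h1 h2) (pkMl (zp_nat p 2) PFe)) Se) (pkMl tz hl4)).
Qed.

Local Notation q2 := (fermat_quotient p 2).
Local Notation q3 := (fermat_quotient p 3).
Local Notation u := ((U (p - 3))%:~R : rat).
Local Notation c1 := (2 + 4 / 3 * q2 - 3 / 2 * q3).
Local Notation c2 := (1 + 8 / 3 * q2 + 2 / 9 * q2 ^+ 2 - 3 * q3
                     - 2 * q2 * q3 + 15 / 8 * q3 ^+ 2 + 3 / 4 * u).

Lemma c1_zp : q2 \in zp p -> q3 \in zp p -> c1 \in zp p.
Proof.
move: q2 q3 => x y xz yz.
have i3 := zuV_zp zu3; have i2 := zuV_zp zu2.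
by zpt.
Qed.

Lemma c2_zp : q2 \in zp p -> q3 \in zp p -> c2 \in zp p.
Proof.
move: q2 q3 => x y xz yz.
have i3 := zuV_zp zu3; have i2 := zuV_zp zu2; have i4 := zuV_zp zu4.
have i9 : 9^-1 \in zp p by apply: zuV_zp; rewrite (_ : 9 = 3 * 3); [exact: zuM zu3 zu3|ring].
have i8 : 8^-1 \in zp p by apply: zuV_zp; rewrite (_ : 8 = 2 * 4); [exact: zuM zu2 zu4|ring].
by zpt.
Qed.

Lemma fiveR_congr : fiveR - (1 + P * c1 + P ^+ 2 * c2) \in pk p 3.
Proof.
have [Ru Re] := ell_fiveR.
have [U2 E2] := ell_two pE; have [U3 E3] := ell_three pE; have E6 := ell_six pE.
have q2z : q2 \in zp p := fermat_q_zp U2.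
have q3z : q3 \in zp p := fermat_q_zp U3.
have uz : u \in zp p := zp_int p _.
have f2 : 2 ^+ p.-1 = 1 + P * q2 := fermat_q 2.
have f3 : 3 ^+ p.-1 = 1 + P * q3 := fermat_q 3.
rewrite f2 in E2 E6 Re; rewrite f3 in E3 E6.
have R0 := @class1_rev m pE 0 isT; have R1 := @class1_rev m pE 1 isT.
have R2 := @class1_rev m pE 2 isT.
have S0 := @class2_rev m pE 0 isT; have S1 := @class2_rev m pE 1 isT.
have S2 := @class2_rev m pE 2 isT.
(* Taking y = -[T 2 2] in [class2_solve] expresses the classes 0 and 3 through class 2: T_0 - T_3 =
   -6 T_2, so [class2_U] becomes T_2 = U_(p-3) / 12. *)
have V2 : T 2 2 + - u / 12 \in pk p 1.
  have W : T 2 2 - T 2 2 \in pk p 1 by rewrite subrr rpred0.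
  have [W0 _ W3] := class2_solve pE W.
  have := pkB (pkB (class2_U pE) W0) (pkN W3).
  move: (T 2 0) (T 2 2) (T 2 3) u => a b d v H.
  have := pk_divu (pkN H) (zuM zu2 zu3).
  rewrite [X in X \in _ -> _](_ : _ = b + - v / 12) //.
  by field.
have [V0 V1 V3] := class2_solve pE V2.
have main := class_algebra q2z q3z uz R0 R1 R2 S0 S1 V0 V1 V2 V3 E2 E3 E6.
have c1z := c1_zp q2z q3z; have c2z := c2_zp q2z q3z.
have H := eqp_trans Re main.
move: H; clear - p_pr p_gt5 c1z c2z Ru; move: c1 c2 c1z c2z fiveR Ru => x y xz yz R Ru H.
have Pk1 : P * x + P ^+ 2 * y \in pk p 1.
  by apply: pkD (pkMr pkP xz) (pk_le _ (pkMr (pkX 2) yz)).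
rewrite -addrA -ell_inj //; last exact: u1D.
apply: eqp_trans H _; rewrite ell1D.
rewrite [X in X \in _](_ : _ = P ^+ 3 * (x * y + P * y ^+ 2 / 2)); last by field.
apply: pkMr (pkX 3) _; have i2 := zuV_zp zu2; by zpt.
Qed.

(** The reflection of -1/3 is -2/3 = 2m - 1 - p/3, from which m - 1 steps reach 1 - p/3. There S is
    p^2 t (t + 1) = -2 p^2 / 9, so the product of the steps matters only modulo p, where its square
    is 9 / (4 B^2). *)
Lemma hsum_third_five : hsum (- (1 / 3)) + P ^+ 2 / 2 * B ^- 2 \in pk p 3.
Proof.
have m1 := m_gt1 pE; have tz := neg_third_zp.
have pR : P = 6 * m%:R - 1 by rewrite -natrM -pE -natr1 addrK.
have m1p : (1 + m.-1.*2 < p)%N by lia.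
have := hsum_shift m1p tz.
have -> : (1 + m.-1.*2)%:R + P * t = - 1 - - (1 / 3).
  rewrite (_ : 1 + m.-1.*2 = m.*2 - 1)%N; last by lia.
  by rewrite natrB; [rewrite pR -mul2n natrM; field|lia].
rewrite hsum_sym; set W := \prod_(i < m.-1) _.
rewrite (_ : 1%:R = 1) // => H1.
have Bu := zu_bin; have B0 := zu_neq0 Bu.
pose V : rat := \prod_(i < m.-1) (i.*2.+2%:R / i.*2.+3%:R).
have WV : W - V \in pk p 1.
  apply: eqp_prod => i _; have im := ltn_ord i.
    by zpt; apply: zu_small; lia.
  rewrite -[(1 + i.*2.+1)%N]/(i.*2.+2) -[(1 + i.*2.+2)%N]/(i.*2.+3).
  have au : i.*2.+3%:R \in zu p by apply: zu_small; lia.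
  have bu : i.*2.+3%:R + P * t \in zu p by apply: zu_lin => //; lia.
  have a0 := zu_neq0 au; have b0 := zu_neq0 bu.
  rewrite [X in X \in _](_ : _ = P * t * ((i.*2.+3%:R - i.*2.+2%:R) / (i.*2.+3%:R * (i.*2.+3%:R + P * t)))).
    by apply: (pkMr (pkMr pkP tz)); zpt; exact: zuM.
  move: (P * t) (i.*2.+2%:R : rat) (i.*2.+3%:R : rat) a0 b0 => x y z a0 b0.
  by field; rewrite a0 b0.
have m0 : m%:R != 0 :> rat by rewrite pnatr_eq0; lia.
pose N : rat := \prod_(i < m) (i.*2.+2%:R / (P - i.*2.+1%:R)).
pose N' : rat := \prod_(i < m) (i.*2.+2%:R / (- i.*2.+1%:R)).
have NB : N = (2 * B)^-1.
  rewrite bin_half_prod -prodfV; apply: eq_bigr => i _; by rewrite invf_div.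
have NN : N - N' \in pk p 1.
  apply: eqp_prod => i _; have im := ltn_ord i.
    by zpt; apply/zuN/zu_small; lia.
  have au : i.*2.+1%:R \in zu p by apply: zu_small; lia.
  have bu : P - i.*2.+1%:R \in zu p by rewrite addrC; exact: (zuD (zuN au) pkP).
  have a0 := zu_neq0 au; have b0 := zu_neq0 bu.
  rewrite [X in X \in _](_ : _ = P * (i.*2.+2%:R / (i.*2.+1%:R * (P - i.*2.+1%:R)))).
    by apply: (pkMr pkP); zpt; exact: zuM.
  move: (i.*2.+2%:R : rat) (i.*2.+1%:R : rat) a0 b0 => y z a0 b0.
  have c0 : - z != 0 by rewrite oppr_eq0.
  by field; rewrite a0 b0.
(* Up to sign, V lacks only the last numerator 2m of N'. As 3 (2m) = p + 1, this factor is 1/3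
   modulo p, whence the 9 in [W2]. *)
have VN : N' ^+ 2 = (V * (2 * m%:R)) ^+ 2.
  have -> : V * (2 * m%:R) = \prod_(i < m) (i.*2.+2%:R / i.*2.+1%:R).
    have mE : m = m.-1.+1 by lia.
    rewrite /V !prodf_div [in RHS]mE big_ord_recr big_ord_recl /= mul1r.
    have -> : m.-1.*2.+2%:R = 2 * m%:R :> rat by rewrite -natrM; congr (_%:R); lia.
    by rewrite mulrAC.
  rewrite -!prodrXl; apply: eq_bigr => i _.
  have a0 : i.*2.+1%:R != 0 :> rat by rewrite pnatr_eq0.
  by move: (i.*2.+1%:R : rat) a0 => x a0; field.
have mu : 2 * m%:R \in zu p by rewrite -natrM zu_small //; lia.
have Wz : W \in zp p.
  apply: zp_prod => i _; have im := ltn_ord i; zpt; apply: zu_lin => //; lia.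
have Vz := eqp_zp (eqp_sym WV) Wz.
have Nz : N \in zp p by rewrite NB; apply/zuV_zp/zuM => //; exact: zu2.
have N'z := eqp_zp (eqp_sym NN) Nz.
have W2 : W ^+ 2 - 9 / 4 * B ^- 2 \in pk p 1.
  have h1 := eqpX 2 Wz Vz WV; have h2 := eqpX 2 Nz N'z NN.
  rewrite VN NB in h2.
  have pm : P + 1 = 3 * (2 * m%:R) by rewrite pR; ring.
  have h3 : W ^+ 2 * (2 * m%:R) ^+ 2 - (2 * B) ^- 2 \in pk p 1.
    have := pkB (pkMl (zpX 2 (zu_zp mu)) h1) (h2).
    rewrite [X in X \in _ -> _](_ : _ = W ^+ 2 * (2 * m%:R) ^+ 2 - (2 * B) ^- 2) //.
    by rewrite -exprVn; ring.
  rewrite -(pk_mulu _ _ (zuX 2 mu)).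
  rewrite [X in X \in _](_ : _ = W ^+ 2 * (2 * m%:R) ^+ 2 - (2 * B) ^- 2 + P * (- (P + 2) / 4 * B ^- 2)).
    apply: pkD h3 _; apply: pkMr pkP _; have i4 := zuV_zp zu4.
    by zpt; exact: zuX.
  by rewrite pR; field.
rewrite [X in X \in _](_ : _ = (hsum (- (1 / 3)) - W ^+ 2 * hsum (1 + P * t))
  + W ^+ 2 * (hsum (1 + P * t) - P ^+ 2 * (t * (t + 1)))
  + P ^+ 2 * (W ^+ 2 - 9 / 4 * B ^- 2) * (t * (t + 1))).
  apply: pkD (pkD H1 (pkMl (zpX 2 Wz) (hsum_1Pt tz))) _.
  apply: (pkMr (pkM (pkX 2) W2)); exact: (zpM tz (zpD tz (zp1 p))).
move: (hsum _) (hsum _) (W ^+ 2) (B ^- 2) => x y z w.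
by field.
Qed.

Lemma lhs_five s : s - (29 / 60 * hsum (- (1 / 3)) - 2 / 3 * hsum (2 / 3)) \in pk p 3 ->
  s - (- (2 / 3) * B ^+ 2 * (1 + P * c1 + P ^+ 2 * c2) - 29 / 120 * P ^+ 2 * B ^- 2) \in pk p 3.
Proof.
move=> H; have h1 := pkMl twentynine_sixtieths_zp hsum_third_five.
have h2 := pkMl two_thirds_zp hsum_two_thirds.
have h3 := pkMl (zpM two_thirds_zp (zpX 2 (zu_zp zu_bin))) fiveR_congr.
have := pkB (pkB (pkD H h1) h2) h3.
move: (hsum _) (hsum _) fiveR B c1 c2 => x y r b d e.
rewrite [X in X \in _ -> _](_ : _ = s - (- (2 / 3) * b ^+ 2 * (1 + P * d + P ^+ 2 * e) - 29 / 120 * P ^+ 2 * b ^- 2)) //.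
by rewrite -exprVn; move: b^-1 => f; field.
Qed.

End FinalFiveModSix.

(** * The explicit Jacobi sum, for p = 6m + 1 *)

(** For a natural number c this is the binomial coefficient C(c p + n, n). *)
Definition risprod (c : rat) (n : nat) : rat := \prod_(i < n) (1 + c * P / i.+1%:R).

Lemma fact_risprod k n :
  (k * p + n)`!%:R = (k * p)`!%:R * n`!%:R * risprod k%:R n :> rat.
Proof.
elim: n => [|n IHn]; first by rewrite addn0 /risprod big_ord0 !mulr1.
rewrite addnS factS natrM IHn /risprod big_ord_recr /= factS natrM -addnS natrD natrM.
have : n.+1%:R != 0 :> rat by rewrite pnatr_eq0.
by move: (n.+1%:R : rat) => x x0; field.
Qed.

Lemma risprod_u1 c n : c \in zp p -> (n < p)%N -> risprod c n \in u1.
Proof.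
move=> cz np; apply: u1_prod => i _; apply/u1D/pk_divu; first exact: (pkMl cz pkP).
by apply: zu_small; have := ltn_ord i; lia.
Qed.

Lemma ell_risprod c n : c \in zp p -> (n < p)%N ->
  ell (risprod c n) - (c * P * hs 1 n - c ^+ 2 * P ^+ 2 / 2 * hs 2 n) \in pk p 3.
Proof.
move=> cz np.
have Fu (i : 'I_n) : true -> 1 + c * P / i.+1%:R \in u1.
  move=> _; apply/u1D/pk_divu; first exact: (pkMl cz pkP).
  by apply: zu_small; have := ltn_ord i; lia.
apply: eqp_trans (ell_prod _ Fu) _.
rewrite [X in X - _](_ : _ = c * P * hs 1 n - c ^+ 2 * P ^+ 2 / 2 * hs 2 n) ?subrr ?rpred0 //.
rewrite !mulr_sumr -sumrB; apply: eq_bigr => i _; rewrite ell1D expr1.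
have : i.+1%:R != 0 :> rat by rewrite pnatr_eq0.
by move: (i.+1%:R : rat) => x x0; field.
Qed.

Lemma hsS k n : hs k n.+1 = hs k n + n.+1%:R ^- k.
Proof. exact: big_ord_recr. Qed.

Lemma exp_ell x z : x \in u1 -> z \in pk p 1 -> ell x - z \in pk p 3 ->
  x - (1 + z + z ^+ 2 / 2) \in pk p 3.
Proof.
move=> xu zk H; have z2 : z ^+ 2 \in pk p 2 := pk_exp 2 zk.
have wk : z + z ^+ 2 / 2 \in pk p 1 by apply: pkD zk _; exact: pk_le (half_pk z2).
rewrite -addrA -ell_inj //; last exact: u1D.
apply: eqp_trans H _; rewrite ell1D.
rewrite [X in X \in _](_ : _ = z ^+ 3 / 2 + z ^+ 4 / 8); last by field.
have z3 : z ^+ 3 \in pk p 3 := pk_exp 3 zk.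
have z4 : z ^+ 4 \in pk p 3 := @pk_le 4 3 _ isT (pk_exp 4 zk).
apply: pkD; first exact: half_pk.
by apply: pk_divu z4 _; rewrite (_ : 8 = 2 * 4); [exact: zuM zu2 zu4|ring].
Qed.

Lemma zu_P1 : P - 1 \in zu p. Proof. by rewrite addrC; exact: zuD (zuN zu1) pkP. Qed.

Lemma zu_5 : 5 \in zu p.
Proof. by apply: zu_small; have := p_gt5; lia. Qed.

Lemma zu_P4 : P - 4 \in zu p. Proof. by rewrite addrC; exact: zuD (zuN zu4) pkP. Qed.

Lemma zu_2P5 : 2 * P - 5 \in zu p.
Proof. by rewrite addrC; exact: (zuD (zuN zu_5) (pkMl (zp_nat p 2) pkP)). Qed.

Section OneModSix.

Variable m : nat.
Hypothesis pE : p = (6 * m).+1.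

Lemma m_gt0 : (0 < m)%N. Proof. by have := p_gt5; lia. Qed.

Local Notation X := (hs 2 (2 * m)).
Local Notation H := (hs 1 (2 * m)).
Local Notation C := ('C(4 * m, 2 * m)%:R : rat).

Lemma X_zp : X \in zp p.
Proof. by apply: hs_zp; have := m_gt0; lia. Qed.

Lemma hs_4m : hs 1 (4 * m) - (H + P * X) \in pk p 2 /\ hs 2 (4 * m) + X \in pk p 1.
Proof. by have := @hs_rev (2 * m); rewrite (_ : p.-1 - 2 * m = 4 * m)%N; [apply|]; lia. Qed.

Lemma natr_m : m%:R = (P - 1) / 6.
Proof. by rewrite [in P]pE -natr1 addrK natrM; field. Qed.

(** These stand for 2m - 2 and 4m - 2. Since p = 6m + 1, one has 8m = p + a + 1, 10m = p + b + 1,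
    14m = 2p + a and 16m = 2p + b, which splits the factorials of the binomial coefficients
    below. *)
Variables a b : nat.
Hypothesis aE : (2 * m = a.+2)%N.
Hypothesis bE : (4 * m = b.+2)%N.

Lemma natr_a2 : a.+2%:R = (P - 1) / 3 :> rat.
Proof. by rewrite -aE natrM natr_m; field. Qed.

Lemma natr_a1 : a.+1%:R = (P - 4) / 3 :> rat.
Proof. by apply: (addIr 1); rewrite natr1 natr_a2; field. Qed.

Lemma natr_b2 : b.+2%:R = 2 * (P - 1) / 3 :> rat.
Proof. by rewrite -bE natrM natr_m; field. Qed.

Lemma natr_b1 : b.+1%:R = (2 * P - 5) / 3 :> rat.
Proof. by apply: (addIr 1); rewrite natr1 natr_b2; field. Qed.

Lemma binom_C : C = b`!%:R / a`!%:R ^+ 2 * (b.+2%:R * b.+1%:R / (a.+2%:R * a.+1%:R) ^+ 2).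
Proof.
rewrite bin_factr; last by lia.
rewrite (_ : 4 * m - 2 * m = 2 * m)%N; last by lia.
rewrite aE bE !factS !natrM.
have := fact_neq0 a; have : a.+1%:R != 0 :> rat by rewrite pnatr_eq0.
have : a.+2%:R != 0 :> rat by rewrite pnatr_eq0.
move: (a`!%:R : rat) (b`!%:R : rat) (a.+1%:R : rat) (a.+2%:R : rat) (b.+1%:R : rat) (b.+2%:R : rat).
by move=> x y z t u v z0 t0 x0; field; rewrite x0 z0 t0.
Qed.

Lemma binom_10m : 'C(10 * m, 2 * m)%:R = C / 2 * (risprod 1 b.+1 / risprod 1 a.+1) :> rat.
Proof.
have p5 := p_gt5; have m0 := m_gt0.
have ap : (a.+1 < p)%N by lia.
have u0 := zu_neq0 (u1_zu (risprod_u1 (zp1 p) ap)).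
have f1 := fact_risprod 1 b.+1; have f2 := fact_risprod 1 a.+1.
rewrite bin_factr; last by lia.
rewrite (_ : 10 * m = 1 * p + b.+1)%N; last by lia.
rewrite [(_ + _ - _)%N](_ : _ = 1 * p + a.+1)%N; last by lia.
rewrite f1 f2 binom_C aE !factS !natrM.
have := zu_neq0 zu_P1; have := zu_neq0 zu_P4; have := zu_neq0 zu_2P5.
have := fact_neq0 a; have := fact_neq0 b; have := fact_neq0 p; rewrite mul1n.
rewrite natr_a1 natr_a2 natr_b1 natr_b2.
move: u0; move: (a`!%:R : rat) (b`!%:R : rat) (p`!%:R : rat) (risprod 1 b.+1) (risprod 1 a.+1).
move=> x y z u v v0 x0 y0 z0 n1 n2 n3; field.
by rewrite v0 x0 z0 n2 n3.
Qed.

Lemma binom_16m_2m : 'C(16 * m, 2 * m)%:R =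
  C * ((P - 4) / (2 * P - 5) / 2) * (risprod 2 b / risprod 2 a) :> rat.
Proof.
have p5 := p_gt5.
have ap : (a < p)%N by lia.
have u0 := zu_neq0 (u1_zu (risprod_u1 (zp_nat p 2) ap)).
have f1 := fact_risprod 2 b; have f2 := fact_risprod 2 a.
rewrite bin_factr; last by lia.
rewrite (_ : 16 * m = 2 * p + b)%N; last by lia.
rewrite [(_ + _ - _)%N](_ : _ = 2 * p + a)%N; last by lia.
rewrite f1 f2 binom_C aE !factS !natrM.
have := zu_neq0 zu_P1; have := zu_neq0 zu_P4; have := zu_neq0 zu_2P5.
have := fact_neq0 a; have := fact_neq0 b; have := fact_neq0 (2 * p).
rewrite natr_a1 natr_a2 natr_b1 natr_b2.
move: u0; move: (a`!%:R : rat) (b`!%:R : rat) ((2 * p)`!%:R : rat) (risprod 2 b) (risprod 2 a).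
move=> x y z u v v0 x0 y0 z0 n1 n2 n3; field.
by rewrite v0 x0 ?z0 n1 n2 n3.
Qed.

Lemma binom_16m_8m : 'C(16 * m, 8 * m)%:R =
  C * ((P - 1) / (2 * P - 5)) * ('C(p.*2, p)%:R / 2) * (risprod 2 b / risprod 1 a.+1 ^+ 2) :> rat.
Proof.
have p5 := p_gt5.
have ap : (a.+1 < p)%N by lia.
have u0 := zu_neq0 (u1_zu (risprod_u1 (zp1 p) ap)).
have f1 := fact_risprod 2 b; have f2 := fact_risprod 1 a.+1.
rewrite bin_factr; last by lia.
rewrite [(_ - _)%N](_ : _ = 1 * p + a.+1)%N; last by lia.
rewrite (_ : 16 * m = 2 * p + b)%N; last by lia.
rewrite (_ : 8 * m = 1 * p + a.+1)%N; last by lia.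
rewrite f1 f2 binom_C !factS !natrM bin_factr; last by lia.
rewrite (_ : p.*2 - p = p)%N; last by lia.
have := zu_neq0 zu_P1; have := zu_neq0 zu_P4; have := zu_neq0 zu_2P5.
have := fact_neq0 a; have := fact_neq0 b; have := fact_neq0 p.
rewrite mul1n -mul2n natr_a1 natr_a2 natr_b1 natr_b2.
move: u0; move: (a`!%:R : rat) (b`!%:R : rat) (p`!%:R : rat) ((2 * p)`!%:R : rat) (risprod 2 b) (risprod 1 a.+1).
move=> x y z w u v v0 x0 y0 z0 n1 n2 n3; field.
by rewrite v0 ?x0 ?y0 z0 n1 n2 n3.
Qed.

Local Notation Q1 := (risprod 1 b.+1 / risprod 1 a.+1).
Local Notation Q2 := (risprod 2 b / risprod 2 a).
Local Notation Q3 := (risprod 2 b / risprod 1 a.+1 ^+ 2).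

Local Notation e := ((P - 1)^-1).
Local Notation f := ((2 * P - 5)^-1).
Local Notation g := ((P - 4)^-1).

Lemma inv_trunc c d : d \in zu p -> c * P - d \in zu p ->
  c \in zp p ->
  (c * P - d)^-1 + d^-1 + c * P / d ^+ 2 \in pk p 2 /\
  (c * P - d)^-1 + d^-1 \in pk p 1.
Proof.
move=> du cu cz; have d0 := zu_neq0 du; have c0 := zu_neq0 cu.
have dz : (d ^+ 2)^-1 \in zp p by apply: zuV_zp; exact: zuX.
have dz1 := zuV_zp du; have cz1 := zuV_zp cu; split.
  rewrite [X in X \in _](_ : _ = P ^+ 2 * (c ^+ 2 * (d ^+ 2)^-1 * (c * P - d)^-1)).
    by apply: (pkMr (pkX 2)); zpt.
  by field; rewrite d0 c0.
rewrite [X in X \in _](_ : _ = P * (c * d^-1 * (c * P - d)^-1)).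
  by apply: (pkMr pkP); zpt.
by field; rewrite d0 c0.
Qed.

Lemma e_trunc : e + 1 + P \in pk p 2 /\ e + 1 \in pk p 1.
Proof.
have := @inv_trunc 1 1 zu1; rewrite mul1r expr1n invr1 mulr1.
by apply; [exact: zu_P1|exact: zp1].
Qed.

Lemma f_trunc : f + 1 / 5 + 2 * P / 25 \in pk p 2 /\ f + 1 / 5 \in pk p 1.
Proof.
have := @inv_trunc 2 5 zu_5 zu_2P5 (zp_nat p 2).
by rewrite (_ : 5 ^+ 2 = 25) ?div1r //; ring.
Qed.

Lemma g_trunc : g + 1 / 4 + P / 16 \in pk p 2 /\ g + 1 / 4 \in pk p 1.
Proof.
have := @inv_trunc 1 4 zu4; rewrite mul1r (_ : 4 ^+ 2 = 16) ?div1r; last by ring.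
by apply; [exact: zu_P4|exact: zp1].
Qed.

Lemma hs1_b2 : hs 1 b.+1 = hs 1 (4 * m) - 3 / 2 * e.
Proof.
rewrite bE (hsS 1 b.+1) expr1 natr_b2; have := zu_neq0 zu_P1.
by move: (hs _ _) => x p1; field; rewrite ?p1.
Qed.

Lemma hs2_b2 : hs 2 b.+1 = hs 2 (4 * m) - (3 / 2 * e) ^+ 2.
Proof.
rewrite bE (hsS 2 b.+1) natr_b2; have := zu_neq0 zu_P1.
by move: (hs _ _) => x p1; field; rewrite ?p1.
Qed.

Lemma hs1_a2 : hs 1 a.+1 = H - 3 * e.
Proof.
rewrite aE (hsS 1 a.+1) expr1 natr_a2; have := zu_neq0 zu_P1.
by move: (hs _ _) => x p1; field; rewrite ?p1.
Qed.

Lemma hs2_a2 : hs 2 a.+1 = X - (3 * e) ^+ 2.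
Proof.
rewrite aE (hsS 2 a.+1) natr_a2; have := zu_neq0 zu_P1.
by move: (hs _ _) => x p1; field; rewrite ?p1.
Qed.

Lemma hs1_b1 : hs 1 b = hs 1 (4 * m) - 3 / 2 * e - 3 * f.
Proof.
rewrite -hs1_b2 (hsS 1 b) expr1 natr_b1; have := zu_neq0 zu_2P5.
by move: (hs _ _) => x p1; field; rewrite ?p1.
Qed.

Lemma hs2_b1 : hs 2 b = hs 2 (4 * m) - (3 / 2 * e) ^+ 2 - (3 * f) ^+ 2.
Proof.
rewrite -hs2_b2 (hsS 2 b) natr_b1; have := zu_neq0 zu_2P5.
by move: (hs _ _) => x p1; field; rewrite ?p1.
Qed.

Lemma hs1_a1 : hs 1 a = H - 3 * e - 3 * g.
Proof.
rewrite -hs1_a2 (hsS 1 a) expr1 natr_a1; have := zu_neq0 zu_P4.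
by move: (hs _ _) => x p1; field; rewrite ?p1.
Qed.

Lemma hs2_a1 : hs 2 a = X - (3 * e) ^+ 2 - (3 * g) ^+ 2.
Proof.
rewrite -hs2_a2 (hsS 2 a) natr_a1; have := zu_neq0 zu_P4.
by move: (hs _ _) => x p1; field; rewrite ?p1.
Qed.

Lemma ell_div x y s t : x \in u1 -> y \in u1 ->
  ell x - s \in pk p 3 -> ell y - t \in pk p 3 -> ell (x / y) - (s - t) \in pk p 3.
Proof.
move=> xu yu xs yt; have := pkB (pkD (pkD (ellM xu (u1V yu)) (ellV yu)) xs) yt.
rewrite [X in X \in _ -> _](_ : _ = ell (x / y) - (s - t)) //.
by move: (ell _) (ell _) (ell _) (ell _) => *; ring.
Qed.

Local Notation z1 := (- (3 / 2) * P + (2 * X - 39 / 8) * P ^+ 2).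
Local Notation z2 := (- (33 / 10) * P + (6 * X - 84 / 5) * P ^+ 2).
Local Notation z3 := (- (9 / 5) * P + (5 * X - 63 / 10) * P ^+ 2).

Lemma sqr_trunc c d : c \in zp p -> d \in zp p -> c + d \in pk p 1 -> c ^+ 2 - d ^+ 2 \in pk p 1.
Proof. by move=> cz dz cd; rewrite subr_sqr pkMl // zpD ?zpN. Qed.

Lemma e2_trunc : e ^+ 2 - 1 \in pk p 1.
Proof.
have [_ k] := e_trunc; have := sqr_trunc (zuV_zp zu_P1) (zp1 p) k.
by rewrite expr1n.
Qed.

Lemma f2_trunc : f ^+ 2 - (1 / 5) ^+ 2 \in pk p 1.
Proof.
have [_ k] := f_trunc; apply: sqr_trunc k; first exact: zuV_zp zu_2P5.
by rewrite div1r; exact: zuV_zp zu_5.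
Qed.

Lemma g2_trunc : g ^+ 2 - (1 / 4) ^+ 2 \in pk p 1.
Proof.
have [_ k] := g_trunc; apply: sqr_trunc k; first exact: zuV_zp zu_P4.
by rewrite div1r; exact: zuV_zp zu4.
Qed.

(** Reflection replaces the harmonic sums up to 4m by those up to 2m; the first-order sums [H] then
    cancel and [X] is the only unknown left. The rational constants come from the end terms cut off
    at [a] and [b]. The same mechanism serves Q2 and Q3. *)
Lemma ell_Q1 : Q1 \in u1 /\ ell Q1 - z1 \in pk p 3.
Proof.
have p5 := p_gt5; have ap : (a.+1 < p)%N by lia.
have bp : (b.+1 < p)%N by lia.
have ub := risprod_u1 (zp1 p) bp; have ua := risprod_u1 (zp1 p) ap.
split; first exact: u1M ub (u1V ua).
apply: eqp_trans (ell_div ub ua (ell_risprod (zp1 p) bp) (ell_risprod (zp1 p) ap)) _.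
rewrite hs1_b2 hs2_b2 hs1_a2 hs2_a2; have [h1 h2] := hs_4m.
have [e1 _] := e_trunc; have e2 := e2_trunc; have Xz := X_zp.
have i2 := zuV_zp zu2; have i4 := zuV_zp zu4.
move: h1 h2 Xz e1 e2; move: (hs 1 (4 * m)) (hs 2 (4 * m)) H X e => h4 x4 h x y h1 h2 xz e1 e2.
rewrite [X in X \in _](_ : _ = P * ((h4 - (h + P * x)) + 3 / 2 * (y + 1 + P))
  - P ^+ 2 * ((x4 + x) / 2 + 27 / 8 * (y ^+ 2 - 1))); last by field.
have i8 : 8^-1 \in zp p by rewrite (_ : 8 = 2 * 4); [rewrite invfM; zpt|ring].
apply: pkB.
  apply: (pkM pkP); apply: (pkD h1); apply: pkMl e1; zpt.
apply: (pkM (pkX 2)); apply: (pkD (half_pk h2)); apply: pkMl e2; zpt.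
Qed.

Lemma ell_Q2 : Q2 \in u1 /\ ell Q2 - z2 \in pk p 3.
Proof.
have p5 := p_gt5; have ap : (a < p)%N by lia.
have bp : (b < p)%N by lia.
have z2p := zp_nat p 2.
have ub := risprod_u1 z2p bp; have ua := risprod_u1 z2p ap.
split; first exact: u1M ub (u1V ua).
apply: eqp_trans (ell_div ub ua (ell_risprod z2p bp) (ell_risprod z2p ap)) _.
rewrite hs1_b1 hs2_b1 hs1_a1 hs2_a1; have [h1 h2] := hs_4m.
have [e1 _] := e_trunc; have e2 := e2_trunc; have Xz := X_zp.
have [f1 _] := f_trunc; have f2 := f2_trunc.
have [g1 _] := g_trunc; have g2 := g2_trunc.
have i2 := zuV_zp zu2; have i4 := zuV_zp zu4.
move: h1 h2 Xz e1 e2 f1 f2 g1 g2; move: (hs 1 (4 * m)) (hs 2 (4 * m)) H X e f g.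
move=> h4 x4 h x y u v h1 h2 xz e1 e2 f1 f2 g1 g2.
rewrite [X in X \in _](_ : _ = 2 * P * ((h4 - (h + P * x)) + 3 / 2 * (y + 1 + P)
    - 3 * (u + 1 / 5 + 2 * P / 25) + 3 * (v + 1 / 4 + P / 16))
  - 2 * P ^+ 2 * ((x4 + x) + 27 / 4 * (y ^+ 2 - 1) - 9 * (u ^+ 2 - (1 / 5) ^+ 2)
      + 9 * (v ^+ 2 - (1 / 4) ^+ 2))); last by field.
have k32 : 3 / 2 \in zp p by zpt.
have k274 : 27 / 4 \in zp p by zpt.
apply: pkB.
  apply: (pkM (pkMl z2p pkP)).
  exact: (pkD (pkB (pkD h1 (pkMl k32 e1)) (pkMl (zp_nat p 3) f1)) (pkMl (zp_nat p 3) g1)).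
apply: (pkM (pkMl z2p (pkX 2))).
exact: (pkD (pkB (pkD h2 (pkMl k274 e2)) (pkMl (zp_nat p 9) f2)) (pkMl (zp_nat p 9) g2)).
Qed.

Lemma ell_Q3 : Q3 \in u1 /\ ell Q3 - z3 \in pk p 3.
Proof.
have p5 := p_gt5; have ap : (a.+1 < p)%N by lia.
have bp : (b < p)%N by lia.
have z2p := zp_nat p 2.
have ub := risprod_u1 z2p bp; have ua := risprod_u1 (zp1 p) ap.
split; first exact: u1M ub (u1V (u1X 2 ua)).
have q2 : ell (risprod 1 a.+1 ^+ 2) - 2 * (1 * P * hs 1 a.+1 - 1 ^+ 2 * P ^+ 2 / 2 * hs 2 a.+1) \in pk p 3.
  apply: eqp_trans (ellX 2 ua) _; rewrite -mulrBr.
  exact: (pkMl z2p (ell_risprod (zp1 p) ap)).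
apply: eqp_trans (ell_div ub (u1X 2 ua) (ell_risprod z2p bp) q2) _.
rewrite hs1_b1 hs2_b1 hs1_a2 hs2_a2; have [h1 h2] := hs_4m.
have [e1 _] := e_trunc; have e2 := e2_trunc; have Xz := X_zp.
have [f1 _] := f_trunc; have f2 := f2_trunc.
have i2 := zuV_zp zu2.
move: h1 h2 Xz e1 e2 f1 f2; move: (hs 1 (4 * m)) (hs 2 (4 * m)) H X e f.
move=> h4 x4 h x y u h1 h2 xz e1 e2 f1 f2.
rewrite [X in X \in _](_ : _ = 2 * P * ((h4 - (h + P * x)) + 3 / 2 * (y + 1 + P)
    - 3 * (u + 1 / 5 + 2 * P / 25))
  - P ^+ 2 * (2 * (x4 + x) + 9 / 2 * (y ^+ 2 - 1) - 18 * (u ^+ 2 - (1 / 5) ^+ 2))); last by field.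
have k32 : 3 / 2 \in zp p by zpt.
have k92 : 9 / 2 \in zp p by zpt.
apply: pkB.
  apply: (pkM (pkMl z2p pkP)).
  exact: (pkB (pkD h1 (pkMl k32 e1)) (pkMl (zp_nat p 3) f1)).
apply: (pkM (pkX 2)).
exact: (pkB (pkD (pkMl z2p h2) (pkMl k92 e2)) (pkMl (zp_nat p 18) f2)).
Qed.

Lemma exp_trunc x c d : c \in zp p -> d \in zp p -> x \in u1 ->
  ell x - (c * P + d * P ^+ 2) \in pk p 3 ->
  x - 1 - (c * P + (d + c ^+ 2 / 2) * P ^+ 2) \in pk p 3.
Proof.
move=> cz dz xu H; have i2 := zuV_zp zu2.
have zk : c * P + d * P ^+ 2 \in pk p 1.
  by apply: pkD (pkMl cz pkP) _; apply: pkMl dz _; exact: pk_le (pkX 2).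
have k : P ^+ 3 * (c * d + P * d ^+ 2 / 2) \in pk p 3 by apply: (pkMr (pkX 3)); zpt.
have := pkD (exp_ell xu zk H) k.
rewrite [X in X \in _ -> _](_ : _ = x - 1 - (c * P + (d + c ^+ 2 / 2) * P ^+ 2)) //.
by field.
Qed.

(* The weights sum to 1, so only their residues modulo p^2 matter. *)
Lemma jacobi_weights x1 x2 x3 w M w2 c1 c2 c3 d1 d2 d3 : w - 1 \in pk p 3 ->
  M = 2 / 3 * (P ^+ 2 - 1) -> w2 = M * (M - 1) / 2 ->
  c1 \in zp p -> c2 \in zp p -> c3 \in zp p -> d1 \in zp p -> d2 \in zp p -> d3 \in zp p ->
  x1 - (c1 * P + d1 * P ^+ 2) \in pk p 3 ->
  x2 - (c2 * P + d2 * P ^+ 2) \in pk p 3 ->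
  x3 - (c3 * P + d3 * P ^+ 2) \in pk p 3 ->
  1 + M * x1 + w2 * ((P - 4) * f * (1 + x2) + (P - 1) * f * w * (1 + x3) - 2 * x1 - 1)
  - (1 + (- (16 / 9) * c1 + 4 / 9 * c2 + c3 / 9) * P
     + (- (16 / 9) * d1 + 4 / 9 * d2 + d3 / 9 + (c2 - c3) / 15) * P ^+ 2) \in pk p 3.
Proof.
move=> wk ME w2E c1z c2z c3z d1z d2z d3z k1 k2 k3.
have i2 := zuV_zp zu2; have i3 := zuV_zp zu3; have i5 := zuV_zp zu_5.
have i9 : 9^-1 \in zp p by rewrite (_ : 9 = 3 * 3); [rewrite invfM; zpt|ring].
have i15 : 15^-1 \in zp p by rewrite (_ : 15 = 3 * 5); [rewrite invfM; zpt|ring].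
have i25 : 25^-1 \in zp p by rewrite (_ : 25 = 5 * 5); [rewrite invfM; zpt|ring].
have f0 := zu_neq0 zu_2P5; have fz := zuV_zp zu_2P5.
have [ft _] := f_trunc.
have lin c d x : c \in zp p -> d \in zp p -> x - (c * P + d * P ^+ 2) \in pk p 3 -> x \in pk p 1.
  move=> cz dz H; rewrite -(subrK (c * P + d * P ^+ 2) x); apply: pkD.
    exact: (@pk_le 3 1 _ isT H).
  by apply: pkD (pkMl cz pkP) _; apply: (pkMl dz); exact: (@pk_le 2 1 _ isT (pkX 2)).
have x1k := lin _ _ _ c1z d1z k1; have x2k := lin _ _ _ c2z d2z k2.
have x3k := lin _ _ _ c3z d3z k3.
have Mk : M + 2 / 3 \in pk p 2.
  by rewrite ME (_ : _ + _ = 2 / 3 * P ^+ 2); [apply: pkMl (pkX 2); zpt|ring].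
have Mz : M \in zp p by rewrite ME; zpt.
have w2k : w2 - 5 / 9 \in pk p 2.
  rewrite w2E (_ : _ - _ = (M + 2 / 3) * ((M - 5 / 3) / 2)); last by field.
  by apply: (pkMr Mk); zpt.
have w2z : w2 \in zp p by rewrite w2E; zpt.
have aE' : (P - 4) * f = (1 - 3 * f) / 2.
  by field.
have bE' : (P - 1) * f = (1 + 3 * f) / 2.
  by field.
set y := (P - 4) * f * x2 + (P - 1) * f * x3 - 2 * x1.
have yk : y \in pk p 1.
  apply: pkB; last exact: (pkMl (zp_nat p 2) x1k).
  by apply: pkD; [apply: pkMl x2k|apply: pkMl x3k]; zpt.
have k4 : (M + 2 / 3) * x1 \in pk p 3 := pkM Mk x1k.
have k5 : (w2 - 5 / 9) * y \in pk p 3 := pkM w2k yk.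
have k6 : w2 * ((P - 1) * f * (1 + x3)) * (w - 1) \in pk p 3.
  by have x3z := pkW x3k; apply: pkMl wk; zpt.
have k7 : (f + 1 / 5 + 2 * P / 25) * (x2 - x3) \in pk p 3 := pkM ft (pkB x2k x3k).
have k8 : P ^+ 3 * ((d2 - d3) / 15) \in pk p 3 by apply: (pkMr (pkX 3)); zpt.
have h1 : - (16 / 9) \in zp p by zpt.
have h2 : 4 / 9 + P / 15 \in zp p by zpt.
have h3 : 1 / 9 - P / 15 \in zp p by zpt.
have h7 : - (5 / 9 * (3 / 2)) \in zp p by zpt.
have := pkD (pkD (pkD (pkD (pkD (pkD (pkD (pkMl h1 k1) (pkMl h2 k2)) (pkMl h3 k3)) k4) k5) k6) (pkMl h7 k7)) k8.
rewrite [X in X \in _ -> _](_ : _ = 1 + M * x1 + w2 * ((P - 4) * f * (1 + x2) + (P - 1) * f * w * (1 + x3) - 2 * x1 - 1)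
  - (1 + (- (16 / 9) * c1 + 4 / 9 * c2 + c3 / 9) * P
     + (- (16 / 9) * d1 + 4 / 9 * d2 + d3 / 9 + (c2 - c3) / 15) * P ^+ 2)) //.
by rewrite /y aE' bE'; move: f => v; clear; field.
Qed.

(** The Jacobi sum divided by 4^(4 m p^2) (p - 1) C(4m, 2m), the other binomial coefficients being
    written as multiples of C(4m, 2m). *)
Definition jacobi_ratio : rat :=
  1 + 2 / 3 * (P ^+ 2 - 1) * (Q1 - 1)
  + 2 / 3 * (P ^+ 2 - 1) * (2 / 3 * (P ^+ 2 - 1) - 1) / 2 *
    ((P - 4) * f * Q2 + (P - 1) * f * ('C(p.*2, p)%:R / 2) * Q3 - 2 * (Q1 - 1) - 1).

(** The constants of the three logarithms combine to 1 + p + p^2, the inverse of 1 - p modulo p^3.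
    Hence (1 - p) times this ratio is 1 - p^2 X / 3, ready for comparison with [oneG]. *)
Lemma jacobi_ratioE : jacobi_ratio - (1 + P + P ^+ 2 * (1 - X / 3)) \in pk p 3.
Proof.
have [u1Q k1] := ell_Q1; have [u2Q k2] := ell_Q2; have [u3Q k3] := ell_Q3.
have Xz := X_zp.
have i2 := zuV_zp zu2; have i4 := zuV_zp zu4; have i5 := zuV_zp zu_5.
have i8 : 8^-1 \in zp p by rewrite (_ : 8 = 2 * 4); [rewrite invfM; zpt|ring].
have i10 : 10^-1 \in zp p by rewrite (_ : 10 = 2 * 5); [rewrite invfM; zpt|ring].
have c1z : - (3 / 2) \in zp p by zpt.
have c2z : - (33 / 10) \in zp p by zpt.
have c3z : - (9 / 5) \in zp p by zpt.
have d1z : 2 * X - 39 / 8 \in zp p by zpt.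
have d2z : 6 * X - 84 / 5 \in zp p by zpt.
have d3z : 5 * X - 63 / 10 \in zp p by zpt.
have l1 := exp_trunc c1z d1z u1Q k1.
have l2 := exp_trunc c2z d2z u2Q k2.
have l3 := exp_trunc c3z d3z u3Q k3.
have wk : 'C(p.*2, p)%:R / 2 - 1 \in pk p 3.
  rewrite (_ : _ - 1 = ('C(p.*2, p)%:R - 2) / 2); last by field.
  exact: half_pk bin_p2.
have sz c d : c \in zp p -> d \in zp p -> d + c ^+ 2 / 2 \in zp p.
  by move=> cz dz; zpt.
have := jacobi_weights wk erefl erefl c1z c2z c3z (sz _ _ c1z d1z) (sz _ _ c2z d2z) (sz _ _ c3z d3z) l1 l2 l3.
have E q : 1 + (q - 1) = q :> rat by rewrite addrC subrK.
rewrite (E Q2) (E Q3) -/jacobi_ratio.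
rewrite [X in _ - X \in _ -> _](_ : _ = 1 + P + P ^+ 2 * (1 - X / 3)) //.
by move: X => x; field.
Qed.

End OneModSix.

(* Modulo p^3 this is the sum over u in F_p of the cubic Teichmueller character
   of 1 - u^2, obtained by expanding (1 - tau)^(4 m p^2) to second order around
   exponents congruent to 4m modulo p - 1. *)
Definition jacobi_int (m : nat) : int :=
  (4 ^ (4 * m * p ^ 2))%N%:Z * (p%:Z - 1) *
  ('C(4 * m, 2 * m)%:Z
   + (4 * m * p.+1)%N%:Z * (2 * 'C(10 * m, 2 * m)%:Z - 'C(4 * m, 2 * m)%:Z)
   + 'C(4 * m * p.+1, 2)%:Z * (2 * 'C(16 * m, 2 * m)%:Z + 'C(16 * m, 8 * m)%:Z
       - 2 * (2 * 'C(10 * m, 2 * m)%:Z) + 'C(4 * m, 2 * m)%:Z)).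

Section HsumOneModSix.

Variables m a b : nat.
Hypothesis pE : p = (6 * m).+1.
Hypothesis aE : (2 * m = a.+2)%N.
Hypothesis bE : (4 * m = b.+2)%N.

Local Notation X := (hs 2 (2 * m)).
Local Notation H := (hs 1 (2 * m)).
Local Notation C := ('C(4 * m, 2 * m)%:R : rat).
Local Notation t := (- (2 / 3) : rat).
Local Notation J := (jacobi_ratio a b).

Lemma bin2_natr n : 'C(n, 2)%:R = n%:R * (n%:R - 1) / 2 :> rat.
Proof.
have E : ('C(n, 2) * 2 = n * n.-1)%N by have := bin_ffact n 2; rewrite ffactnS ffactn1.
have := congr1 (fun k : nat => k%:R : rat) E; rewrite !natrM => E'.
case: n {E} E' => [|n] E'; first by rewrite bin_small // mul0r mul0r.
apply: (mulIf (zu_neq0 zu2)); rewrite E' -[n.+1%:R]natr1 /=; by field.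
Qed.

Lemma intr_jacobi (S : comNzRingType) (x q c0 k c1 w c2 c3 : nat) :
  (x%:Z * (q%:Z - 1) * (c0%:Z + k%:Z * (2 * c1%:Z - c0%:Z)
    + w%:Z * (2 * c2%:Z + c3%:Z - 2 * (2 * c1%:Z) + c0%:Z)))%:~R
  = x%:R * (q%:R - 1) * (c0%:R + k%:R * (2 * c1%:R - c0%:R)
    + w%:R * (2 * c2%:R + c3%:R - 2 * (2 * c1%:R) + c0%:R)) :> S.
Proof. by ring. Qed.

Lemma jacobi_intE : (jacobi_int m)%:~R = 4 ^+ (4 * m * p ^ 2) * (P - 1) * (C * J).
Proof.
rewrite /jacobi_int intr_jacobi bin2_natr natrX.
have -> : (4 * m * p.+1)%:R = 2 / 3 * (P ^+ 2 - 1) :> rat.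
  by rewrite !natrM (natr_m pE) -[p.+1%:R]natr1; field.
rewrite (binom_10m pE aE bE) (binom_16m_2m pE aE bE) (binom_16m_8m pE aE bE) /jacobi_ratio.
have := zu_neq0 zu_2P5; move: (4 ^+ _) C (risprod 1 b.+1 / _) (risprod 2 b / _) (risprod 2 b / _) ('C(p.*2, p)%:R : rat).
by move=> x c y z w v n0; field.
Qed.

Local Notation Y := (4 ^+ p.-1 : rat).

(** The 1-unit left of S(-1/3) modulo p^3 after removal of C(4m, 2m)^2 / 4^(4m). It comes from the
    2m steps between -2/3 = 4m - 2p/3 and -2p/3, a chain in which the binomial coefficient of the
    Jacobi sum appears. *)
Definition oneG : rat :=
  (\prod_(i < 2 * m) ((1 + P * t / i.*2.+1%:R) * (1 + P * t / i.*2.+2%:R)^-1)) ^+ 2 * hsum (P * t).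

Lemma hsum_third_one : hsum (- (1 / 3)) - C ^+ 2 / 4 ^+ (4 * m) * oneG \in pk p 3.
Proof.
have m2 : (0 + (2 * m).*2 < p)%N by have := m_gt0 pE; lia.
have := hsum_shift m2 (zpN two_thirds_zp).
have -> : (0 + (2 * m).*2)%:R + P * t = - 1 - - (1 / 3).
  by rewrite add0n -mul2n !natrM (natr_m pE); field.
rewrite hsum_sym [0%:R + _]add0r.
have -> : C ^+ 2 / 4 ^+ (4 * m) = (\prod_(i < 2 * m) (i.*2.+1%:R / i.*2.+2%:R)) ^+ 2.
  have := half_prod (2 * m); rewrite (_ : (2 * m).*2 = 4 * m)%N; last by lia.
  have F : \prod_(i < 2 * m) (i%:R + 1) = (2 * m)`!%:R :> rat.
    by rewrite fact_prod big_add1 big_mkord natr_prod; apply: eq_bigr => j _; rewrite natr1.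
  move=> E; have -> : \prod_(i < 2 * m) (i.*2.+1%:R / i.*2.+2%:R) = C / 4 ^+ (2 * m).
    transitivity ((\prod_(i < 2 * m) (i%:R + 1 / 2)) / (2 * m)`!%:R : rat).
      rewrite -F -prodf_div; apply: eq_bigr => i _.
      have -> : i.*2.+1%:R = 2 * (i%:R + 1 / 2) :> rat.
        by rewrite -[i.*2.+1%:R]natr1 -mul2n natrM; field.
      have -> : i.*2.+2%:R = 2 * (i%:R + 1) :> rat.
        by rewrite natr1 -natrM; congr (_%:R); lia.
      have n0 : i%:R + 1 != 0 :> rat by rewrite natr1 pnatr_eq0.
      by move: (i%:R : rat) n0 => x n0; field.
    by rewrite E natrM; have := fact_neq0 (2 * m); move: (_`!%:R) (4 ^+ _)^-1 => x y x0; field.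
  rewrite exprMn exprVn -exprM; congr (_ / _ ^+ _); lia.
rewrite /oneG mulrA -exprMn -big_split /=.
rewrite [X in _ - X ^+ 2 * _ \in _ -> _](eq_bigr (fun i : 'I_(2 * m) => i.*2.+1%:R / i.*2.+2%:R *
   ((1 + P * t / i.*2.+1%:R) * (1 + P * t / i.*2.+2%:R)^-1))) // => i _.
have ip := ltn_ord i.
have n1 : i.*2.+1%:R != 0 :> rat by rewrite pnatr_eq0.
have n2 : i.*2.+2%:R != 0 :> rat by rewrite pnatr_eq0.
have n3 : i.*2.+2%:R + P * t != 0.
  by apply/zu_neq0/zuD; [apply: zu_small; lia|exact: (pkMr pkP (zpN two_thirds_zp))].
rewrite -[(0 + i.*2.+1)%N]/(i.*2.+1) -[(0 + i.*2.+2)%N]/(i.*2.+2).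
move: (P * t) (i.*2.+1%:R : rat) (i.*2.+2%:R : rat) n1 n2 n3 => x y z n1 n2 n3.
have -> : 1 + x / z = (z + x) / z by rewrite mulrDl divff.
by field; rewrite n1 n2 n3.
Qed.

Lemma ell_oneG : oneG \in u1 /\
  ell oneG - (- (2 / 3) * P ^+ 2 * X + 2 / 3 * ell Y) \in pk p 3.
Proof.
have m1 := m_gt0 pE; have tz := (zpN two_thirds_zp).
pose o (i : nat) : rat := i.*2.+1%:R; pose e (i : nat) : rat := i.*2.+2%:R.
have ou (i : 'I_(2 * m)) : o i \in zu p by apply: zu_small; have := ltn_ord i; lia.
have eu (i : 'I_(2 * m)) : e i \in zu p by apply: zu_small; have := ltn_ord i; lia.
have Ptk : P * t \in pk p 1 by apply: pkMr pkP tz.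
have oP (i : 'I_(2 * m)) : 1 + P * t / o i \in u1 by apply/u1D/pk_divu.
have eP (i : 'I_(2 * m)) : 1 + P * t / e i \in u1 by apply/u1D/pk_divu.
pose F (i : 'I_(2 * m)) := (1 + P * t / o i) * (1 + P * t / e i)^-1.
have Fu (i : 'I_(2 * m)) : true -> F i \in u1 by move=> _; exact: u1M (oP i) (u1V (eP i)).
pose L := \sum_(i < 2 * m) (ell (1 + P * t / o i) - ell (1 + P * t / e i)).
have PFu : \prod_i F i \in u1 by apply: u1_prod.
have PFe : ell (\prod_i F i) - L \in pk p 3.
  apply: eqp_trans (ell_prod _ Fu) _.
  rewrite /L -sumrB; apply: rpred_sum => i _.
  have s3 x : x - x \in pk p 3 by rewrite subrr rpred0.
  exact: (ell_div (oP i) (eP i) (s3 _) (s3 _)).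
have OE k : \sum_(i < 2 * m) (o i) ^- k = hs k (4 * m) - \sum_(i < 2 * m) (e i) ^- k.
  rewrite (_ : 4 * m = (2 * m).*2)%N; last by lia.
  by rewrite /hs (big_ord_double _ (2 * m) (fun i => i.+1%:R ^- k : rat)) /= addrK.
have E1 : \sum_(i < 2 * m) (e i) ^- 1 = H / 2.
  rewrite mulr_suml; apply: eq_bigr => i _; rewrite /e !expr1 -doubleS -mul2n natrM.
  by rewrite invfM mulrC.
have E2 : \sum_(i < 2 * m) (e i) ^- 2 = X / 4.
  by rewrite mulr_suml; apply: eq_bigr => i _; rewrite /e -doubleS inv_double_sqr.
have LE : L = P * t * (hs 1 (4 * m) - H) - (P * t) ^+ 2 / 2 * (hs 2 (4 * m) - X / 2).
  transitivity (P * t * (\sum_(i < 2 * m) (o i) ^- 1) - (P * t) ^+ 2 / 2 * (\sum_(i < 2 * m) (o i) ^- 2)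
    - P * t * (\sum_(i < 2 * m) (e i) ^- 1) + (P * t) ^+ 2 / 2 * (\sum_(i < 2 * m) (e i) ^- 2)).
    rewrite /L !mulr_sumr -!sumrN -!big_split; apply: eq_bigr => i _ /=.
    rewrite !ell1D; move: (zu_neq0 (ou i)) (zu_neq0 (eu i)).
    by move: (o i) (e i) => x y x0 y0; field; rewrite x0 y0.
  rewrite !OE E1 E2; move: (hs 1 (4 * m)) (hs 2 (4 * m)) H X => *.
  by field.
have [Su Se] := hsum_Pt tz.
have RE : oneG = (\prod_i F i) ^+ 2 * hsum (P * t) by [].
split; first by rewrite RE; exact: (u1M (u1X 2 PFu) Su).
have h1 := ellM (u1X 2 PFu) Su; rewrite -RE in h1.
have h2 := ellX 2 PFu.
have [k1 k2] := @hs_4m m pE.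
move: h1 h2 Se PFe k1 k2; rewrite LE.
move: (ell oneG) (ell (_ ^+ 2)) (ell (hsum _)) (ell (\prod_i F i)) (ell (4 ^+ _)).
move: (hs 1 (4 * m)) (hs 2 (4 * m)) H X.
move=> h4 x4 h x r f2 sp f y h1 h2 Se PFe k1 k2.
have j1 := pkM pkP k1; have j2 := pkM (pkX 2) k2.
have := pkB (pkB (pkD (pkD (pkD h1 h2) (pkMl (zp_nat p 2) PFe)) Se) (pkMl (zpM (zp_nat p 4) (zuV_zp zu3)) j1))
   (pkMl (zpM (zp_nat p 4) (zuV_zp (zuM zu3 zu3))) j2).
rewrite [X in X \in _ -> _](_ : _ = r - (- (2 / 3) * P ^+ 2 * x + 2 / 3 * y)) //.
by field.
Qed.

(** Both sides share the factor C^2 / 4^(4m). The logarithms of the remaining 1-units agree: each is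
    -2/3 p^2 X plus 2/3 of the logarithm of 4^(p-1). *)
Lemma jacobi_sqr : (jacobi_int m)%:~R ^+ 2 - hsum (- (1 / 3)) \in pk p 3.
Proof.
have m1 := m_gt0 pE; have Xz := X_zp pE.
have [Gu Ge] := ell_oneG; have Yu := pow4_u1.
have Cz : C \in zp p := zp_nat p _.
have i4 := zuV_zp zu4.
have JE := jacobi_ratioE pE aE bE.
have PJ : (1 - P) * J - (1 - P ^+ 2 * X / 3) \in pk p 3.
  have i3 := zuV_zp zu3.
  have h : P ^+ 3 * (1 - X / 3) \in pk p 3 by apply: (pkMr (pkX 3)); zpt.
  have n1 : 1 - P \in zp p by zpt.
  have := pkB (pkMl n1 JE) h.
  rewrite [Z in Z \in _ -> _](_ : _ = (1 - P) * J - (1 - P ^+ 2 * X / 3)) //.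
  by move: J X => j x; field.
have x2 : - (P ^+ 2 * X / 3) \in pk p 2.
  by apply: pkN; apply: pk_divu zu3; exact: (pkMr (pkX 2) Xz).
have x1 : - (P ^+ 2 * X / 3) \in pk p 1 := @pk_le 2 1 _ isT x2.
have PJu : (1 - P) * J \in u1.
  by have := eqp_trans (@pk_le 3 1 _ isT PJ) (u1D x1).
have PJe : ell ((1 - P) * J) + P ^+ 2 * X / 3 \in pk p 3.
  have := eqp_trans (ell_congr _ PJu (u1D x1) PJ) (ell_small x2).
  by rewrite opprK; apply.
(* This exponent satisfies (p - 1) e = 8 m p^2 + 4m, which collects the powers of 4, and it is 2/3
   modulo p^2. *)
pose e := (8 * m * p.+1 + 2)%N.
have KE : (jacobi_int m)%:~R ^+ 2 = C ^+ 2 / 4 ^+ (4 * m) * (Y ^+ e * ((1 - P) * J) ^+ 2).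
  rewrite jacobi_intE -exprM.
  have -> : 4 ^+ (p.-1 * e) = (4 ^+ (4 * m * p ^ 2)) ^+ 2 * 4 ^+ (4 * m) :> rat.
    rewrite -exprM -exprD; congr (_ ^+ _); rewrite /e.
    have -> : p.-1 = (6 * m)%N by rewrite pE.
    rewrite -mulnn {1 2}pE [in RHS]pE; clear; nia.
  have q0 : 4 ^+ (4 * m) != 0 :> rat by rewrite expf_neq0.
  by move: (4 ^+ (4 * m)) (4 ^+ (4 * m * p ^ 2)) C J q0 => u v c j q0; field.
have Kc : Y ^+ e * ((1 - P) * J) ^+ 2 - oneG \in pk p 3.
  have Ku := u1M (u1X e Yu) (u1X 2 PJu).
  rewrite -ell_inj //.
  have := pkB (pkD (pkD (ellM (u1X e Yu) (u1X 2 PJu)) (ellX e Yu)) (ellX 2 PJu)) Ge.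
  have := pkMl (zp_nat p 2) PJe.
  have : 4 / 3 * (P ^+ 2 * ell Y) \in pk p 3.
    apply: pkMl; first by apply: zpM; [exact: zp_nat|exact: zuV_zp zu3].
    exact: (pkM (pkX 2) (ell_pk1 Yu)).
  have -> : e%:R = 2 / 3 + 4 / 3 * P ^+ 2 :> rat.
    by rewrite /e natrD !natrM (natr_m pE) -[p.+1%:R]natr1; field.
  move: (ell (_ * _)) (ell (Y ^+ e)) (ell (((1 - P) * J) ^+ 2)) (ell ((1 - P) * J)) (ell oneG) (ell Y) X.
  move=> k ye j2 j g y x h1 h2 h3; have := pkD (pkD h1 h2) h3.
  rewrite [Z in Z \in _ -> _](_ : _ = k - g) //.
  by field.
have CZ : C ^+ 2 / 4 ^+ (4 * m) \in zp p.
  by apply: zpM; [exact: zpX|apply: zuV_zp; exact: zuX zu4].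
apply: eqp_trans (eqp_sym hsum_third_one).
by rewrite KE -mulrBr; exact: pkMl.
Qed.

End HsumOneModSix.

(** * Teichmueller representatives and cubic Jacobi sums modulo p^3 *)

Local Notation R := 'Z_(p ^ 3).
Local Notation F := 'F_p.
Local Notation pR := (p%:R : R).

Lemma p3_gt1 : (1 < p ^ 3)%N.
Proof. by rewrite -{1}(exp1n 3) ltn_exp2r // prime_gt1. Qed.

Lemma pR3 : pR ^+ 3 = 0.
Proof. by rewrite -natrX pchar_Zp // p3_gt1. Qed.

Definition eqR (k : nat) (x y : R) : Prop := exists z, x = y + pR ^+ k * z.

Lemma eqR_refl k x : eqR k x x.
Proof. by exists 0; rewrite mulr0 addr0. Qed.

Lemma eqR_sym k x y : eqR k x y -> eqR k y x.
Proof. by case=> z ->; exists (- z); ring. Qed.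

Lemma eqR_trans k x y z : eqR k x y -> eqR k y z -> eqR k x z.
Proof. by case=> u -> [v ->]; exists (u + v); ring. Qed.

Lemma eqRM k x y u v : eqR k x y -> eqR k u v -> eqR k (x * u) (y * v).
Proof. by case=> z -> [w ->]; exists (z * v + y * w + z * (pR ^+ k * w)); ring. Qed.

Lemma eqRB k x y u v : eqR k x y -> eqR k u v -> eqR k (x - u) (y - v).
Proof. by case=> z -> [w ->]; exists (z - w); ring. Qed.

Lemma eqRX k n x y : eqR k x y -> eqR k (x ^+ n) (y ^+ n).
Proof.
by move=> xy; elim: n => [|n IHn]; [exact: eqR_refl|rewrite !exprS; exact: eqRM].
Qed.

(** The cofactor of x - y in x^p - y^p is p y^(p-1) = 0 modulo p, so a p-th power raises the level
    of a congruence by 1. *)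
Lemma eqR_powp k x y : (0 < k)%N -> eqR k x y -> eqR k.+1 (x ^+ p) (y ^+ p).
Proof.
move=> k0 xy; case: (xy) => z E.
have [w W] : eqR 1 (\sum_(i < p) x ^+ (p.-1 - i) * y ^+ i) 0.
  have x1 : eqR 1 x y by exists (pR ^+ k.-1 * z); rewrite E expr1 mulrA -exprS prednK.
  have [v V] : eqR 1 (\sum_(i < p) x ^+ (p.-1 - i) * y ^+ i) (\sum_(i < p) y ^+ p.-1).
    apply: (big_ind2 (eqR 1)) => [|a b c d [u ->] [v ->]|i _].
    - exact: eqR_refl.
    - by exists (u + v); ring.
    - have -> : p.-1 = (p.-1 - i + i)%N by have := ltn_ord i; lia.
      by rewrite addnK exprD; exact: eqRM (eqRX _ x1) (eqR_refl _ _).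
  exists (y ^+ p.-1 + v); rewrite V sumr_const card_ord -mulr_natl; ring.
exists (z * w); have -> : x ^+ p = y ^+ p + (x ^+ p - y ^+ p) by rewrite subrKC.
rewrite subrXX W (_ : x - y = pR ^+ k * z); last by rewrite E addrC addKr.
by rewrite [pR ^+ k.+1]exprS; ring.
Qed.

Lemma eqR_powp2 x y : eqR 1 x y -> x ^+ (p ^ 2) = y ^+ (p ^ 2).
Proof.
move=> xy; have [z] := @eqR_powp 2 _ _ isT (@eqR_powp 1 _ _ isT xy).
by rewrite pR3 mul0r addr0 -!exprM mulnn.
Qed.

Lemma eqR1_unit x y : eqR 1 x y -> y \is a GRing.unit -> x \is a GRing.unit.
Proof.
case=> z -> yu; rewrite (_ : _ + _ = y * (1 + pR * (y^-1 * z))); last first.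
  by rewrite mulrDr mulr1 mulrCA mulVKr.
rewrite unitrM yu /=; apply/unitrPr; set w := pR * _.
exists (1 - w + w ^+ 2).
rewrite (_ : _ * _ = 1 + w ^+ 3); last by ring.
by rewrite exprMn pR3 mul0r addr0.
Qed.

(** Any lift of a would give the same p^2-th power, by [eqR_powp2]; this is what makes the map
    multiplicative. *)
Definition teich (a : F) : R := (nat_of_ord a)%:R ^+ (p ^ 2).

Lemma natr_F_R (n : nat) : eqR 1 (nat_of_ord (n%:R : F))%:R n%:R.
Proof.
rewrite val_Fp_nat //; apply: eqR_sym; exists (n %/ p)%:R.
by rewrite expr1 -natrM -natrD addnC mulnC -divn_eq.
Qed.

Lemma teich_nat (n : nat) : teich n%:R = n%:R ^+ (p ^ 2).
Proof. by apply: eqR_powp2; exact: natr_F_R. Qed.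

Lemma natr_ordF (a : F) : a = (nat_of_ord a)%:R.
Proof. by rewrite natr_Zp. Qed.

Lemma teichM a b : teich (a * b) = teich a * teich b.
Proof.
rewrite {1}(natr_ordF a) {1}(natr_ordF b) -natrM teich_nat natrM exprMn.
by [].
Qed.

Lemma teich1 : teich 1 = 1.
Proof. by rewrite -[1]/(1%:R) teich_nat expr1n. Qed.

Lemma teich0 : teich 0 = 0.
Proof. by rewrite -[0]/(0%:R) teich_nat expr0n expn_eq0 -[p == 0]negbK -lt0n prime_gt0. Qed.

Lemma teichX a n : teich (a ^+ n) = teich a ^+ n.
Proof. by elim: n => [|n IHn]; rewrite ?expr0 ?teich1 // !exprS teichM IHn. Qed.

Lemma teich_eqR a : eqR 1 (teich a) (nat_of_ord a)%:R.
Proof.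
have E (n : nat) : eqR 1 (n%:R ^+ p) (n%:R : R).
  have := fermat_little n p_pr => /eqP E; rewrite -natrX.
  apply: eqR_trans (eqR_sym (natr_F_R _)) _; apply: eqR_trans (natr_F_R n).
  by rewrite !val_Fp_nat // (eqP E); exact: eqR_refl.
rewrite /teich -mulnn exprM -natrX; apply: eqR_trans (E _) _.
by rewrite natrX; exact: E.
Qed.

Lemma teichB a b : eqR 1 (teich (a - b)) (teich a - teich b).
Proof.
have E c : eqR 1 (teich c) (nat_of_ord c)%:R := teich_eqR c.
apply: eqR_trans (E _) _; apply: eqR_trans _ (eqR_sym (eqRB (E a) (E b))).
have : eqR 1 (nat_of_ord ((nat_of_ord (a - b) + nat_of_ord b)%:R : F))%:R (nat_of_ord (a - b) + nat_of_ord b)%:R := natr_F_R _.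
rewrite natrD -!natr_ordF subrK natrD => /eqR_sym /eqRB /(_ (eqR_refl 1 (nat_of_ord b)%:R)).
by rewrite addrK.
Qed.

Lemma teich_unit a : a != 0 -> teich a \is a GRing.unit.
Proof.
move=> a0; apply/unitrPr; exists (teich a^-1).
by rewrite -teichM mulfV // teich1.
Qed.

(** As [R] has zero divisors, this takes the place of cancellation in a field, both for character
    sums and for the equation of the cube root of unity. *)
Lemma teich_sub_unit a b : a != b -> teich a - teich b \is a GRing.unit.
Proof.
move=> ab; apply: eqR1_unit (eqR_sym (teichB a b)) _.
by rewrite teich_unit // subr_eq0.
Qed.

Lemma card_F : #|F| = p.
Proof. by rewrite card_Fp. Qed.

Lemma expf_prime (a : F) : a ^+ p = a.
Proof.
have E (n : nat) : (n%:R : F) ^+ p = n%:R.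
  by rewrite -natrX -(Fp_nat_mod p_pr (n ^ p)) fermat_little // Fp_nat_mod.
by rewrite (natr_ordF a) E.
Qed.

Lemma expf_pred (a : F) : a != 0 -> a ^+ p.-1 = 1.
Proof.
move=> a0; apply: (mulfI a0); rewrite mulr1 -exprS prednK ?prime_gt0 //.
exact: expf_prime.
Qed.

(** Otherwise X^r - 1, with r the remainder of e modulo p - 1, would have more than r roots. *)
Lemma ex_expf_neq1 e : ~~ (p.-1 %| e)%N -> exists2 a : F, a != 0 & a ^+ e != 1.
Proof.
move=> ne; have p1 : (0 < p.-1)%N by have := p_gt5; lia.
have r0 : (0 < e %% p.-1)%N by rewrite lt0n.
have D (a : F) : a != 0 -> a ^+ e = a ^+ (e %% p.-1).
  by move=> a0; rewrite {1}(divn_eq e p.-1) exprD mulnC exprM expf_pred // expr1n mul1r.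
apply/exists_inP; apply: contraT; rewrite negb_exists_in => /forall_inP H.
have U : uniq (enum [pred a : F | a != 0]) := enum_uniq _.
have A : all (e %% p.-1)%N.-unity_root (enum [pred a : F | a != 0]).
  apply/allP => a; rewrite mem_enum => a0; apply/unity_rootP.
  by have := H a a0; rewrite negbK => /eqP <-; rewrite D.
have := max_unity_roots r0 A U; rewrite -cardE (cardC1 (0 : F)) card_F.
by rewrite leqNgt ltn_pmod.
Qed.

Lemma sum_teichX e : (0 < e)%N ->
  \sum_(a : F) teich a ^+ e = if (p.-1 %| e)%N then (p.-1)%:R else 0.
Proof.
move=> e0; case: ifP => [/dvdnP[q eE]|/negbT /ex_expf_neq1[g g0 ge]].
  rewrite (bigD1 0) //= teich0 expr0n (gtn_eqF e0) add0r.
  rewrite (eq_bigr (fun=> 1)) => [|a a0]; last first.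
    by rewrite -teichX eE mulnC exprM expf_pred // expr1n teich1.
  by rewrite sumr_const (cardC1 (0 : F)) card_F.
have gi : injective ( *%R g) := mulfI g0.
have E : (teich (g ^+ e) - teich 1) * (\sum_(a : F) teich a ^+ e) = 0.
  rewrite teich1 mulrBl mul1r [X in _ - X](reindex_inj gi) /= mulr_sumr -sumrB big1 // => a _.
  by rewrite teichM exprMn teichX subrr.
by apply: (mulrI (teich_sub_unit ge)); rewrite E mulr0.
Qed.

Section CubicCharacter.

Variable m : nat.
Hypothesis pE : p = (6 * m).+1.

(** A cubic character, since 4m = 2 (p - 1) / 3. *)
Definition psi (a : F) : R := teich a ^+ (4 * m).

Lemma psi_gt0 : (0 < 4 * m)%N. Proof. by have := p_gt5; lia. Qed.

Lemma psiM a b : psi (a * b) = psi a * psi b.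
Proof. by rewrite /psi teichM exprMn. Qed.

Lemma psi1 : psi 1 = 1. Proof. by rewrite /psi teich1 expr1n. Qed.

Lemma psi0 : psi 0 = 0.
Proof. by rewrite /psi teich0 expr0n (gtn_eqF psi_gt0). Qed.

Lemma psi_teich a : psi a = teich (a ^+ (4 * m)). Proof. by rewrite teichX. Qed.

Lemma ndvd_pred4 : ~~ (p.-1 %| 4 * m)%N.
Proof.
have := psi_gt0; rewrite pE /= => m0; apply/negP => /dvdnP[q E].
by case: q E => [|q] E; nia.
Qed.

Lemma ndvd_pred8 : ~~ (p.-1 %| 8 * m)%N.
Proof.
have := psi_gt0; rewrite pE /= => m0; apply/negP => /dvdnP[q E].
by case: q E => [|[|q]] E; nia.
Qed.

Lemma sum_psi : \sum_(a : F) psi a = 0.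
Proof. by rewrite sum_teichX ?psi_gt0 // (negPf ndvd_pred4). Qed.

Lemma sum_psi_sqr : \sum_(a : F) psi a ^+ 2 = 0.
Proof.
rewrite (eq_bigr (fun a => teich a ^+ (8 * m))) => [|a _].
  by rewrite sum_teichX ?(negPf ndvd_pred8) //; have := psi_gt0; lia.
by rewrite -exprM; congr (_ ^+ _); lia.
Qed.

Lemma psiV a : psi a^-1 = psi a ^+ 2.
Proof.
have [->|a0] := eqVneq a 0; first by rewrite invr0 psi0 expr0n.
have : psi a ^+ 3 = 1.
  by rewrite -exprM -teichX (_ : 4 * m * 3 = p.-1 * 2)%N ?exprM ?expf_pred ?expr1n ?teich1 //; lia.
have : psi a^-1 * psi a = 1 by rewrite -psiM mulVf // psi1.
by rewrite exprSr => E /(congr1 ( *%R (psi a^-1))); rewrite mulrCA E !mulr1.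
Qed.

(* The inverse of 0 is 0, so the terms with b = 0 or b = 1 vanish as they
   should. Substituting a = b c leaves, for each c, the values of a Moebius
   transformation of b. *)
Lemma jacobi_norm :
  (\sum_(a : F) psi (a * (1 - a))) * (\sum_(b : F) psi (b * (1 - b))^-1) = p%:R.
Proof.
have cardFR : \sum_(b : F) (1 : R) = p%:R by rewrite sumr_const card_F.
pose d c (b : F) : F := c + (1 - c) / (1 - b).
have D c : \sum_b psi (d c b) = if c == 1 then p%:R else 0.
  have [->|c1] := eqVneq.
    by rewrite -cardFR; apply: eq_bigr => b _; rewrite /d subrr mul0r addr0 psi1.
  have di : injective (d c).
    move=> x y /addrI /(mulfI _) E; have := E (_ : 1 - c != 0).
    by rewrite subr_eq0 eq_sym => /(_ c1) /invr_inj /addrI /oppr_inj.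
  by rewrite -[RHS]sum_psi [RHS](reindex_inj di).
have S c : \sum_b psi ((1 - b * c) / (1 - b)) = (if c == 1 then p%:R else 0) - psi c.
  rewrite -D (bigD1 1) //= [in RHS](bigD1 1) //= /d subrr invr0 !mulr0 psi0 addr0 add0r addrC addrK.
  apply: eq_bigr => b b1; congr (psi _).
  have : 1 - b != 0 by rewrite subr_eq0 eq_sym.
  by move=> b0; field.
transitivity (\sum_(b : F | b != 0) \sum_(c : F) psi c * psi ((1 - b * c) / (1 - b))).
  rewrite mulr_sumr (bigD1 0) //= mul0r invr0 psi0 mulr0 add0r.
  apply: eq_bigr => b b0; rewrite mulr_suml (reindex_inj (mulfI b0)) /=.
  apply: eq_bigr => c _; rewrite -!psiM; congr (psi _).
  have [->|b1] := eqVneq b 1; first by rewrite subrr !(mulr0, invr0, mul0r).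
  have : 1 - b != 0 by rewrite subr_eq0 eq_sym.
  by move=> b2; field; rewrite b0 b2.
transitivity (\sum_(c : F) psi c * ((if c == 1 then p%:R else 0) - psi c - 1)).
  rewrite exchange_big; apply: eq_bigr => c _ /=; rewrite -mulr_sumr -S.
  by rewrite [in RHS](bigD1 0) //= mul0r subr0 divr1 psi1 [in RHS]addrAC subrr add0r.
under eq_bigr => c _ do rewrite !mulrBr mulr1 -expr2.
rewrite !sumrB sum_psi sum_psi_sqr !subr0 (bigD1 1) //= psi1 mul1r.
by rewrite big1 ?addr0 // => c /negPf ->; rewrite mulr0.
Qed.

End CubicCharacter.

Lemma expr_nil3 (x : R) n : x ^+ 3 = 0 -> (1 + x) ^+ n = 1 + n%:R * x + 'C(n, 2)%:R * x ^+ 2.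
Proof.
move=> x3; elim: n => [|n IHn]; first by rewrite !mul0r !addr0.
rewrite exprSr IHn binS bin1 natrD -[n.+1%:R]natr1.
have -> : (1 + n%:R * x + 'C(n, 2)%:R * x ^+ 2) * (1 + x)
  = 1 + (n%:R + 1) * x + ('C(n, 2)%:R + n%:R) * x ^+ 2 + 'C(n, 2)%:R * x ^+ 3 by ring.
by rewrite x3 mulr0 addr0.
Qed.

Lemma teich_powp2 a : teich a ^+ (p ^ 2) = teich a.
Proof.
by rewrite -mulnn exprM -!teichX !expf_prime.
Qed.

Lemma teich_sub1 a : teich (1 - a) = (1 - teich a) ^+ (p ^ 2).
Proof. by rewrite -(teich_powp2 (1 - a)) -teich1; apply/eqR_powp2/teichB. Qed.

Lemma Fp_nat_neq0 n : (0 < n < p)%N -> n%:R != 0 :> F.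
Proof. by move=> /andP[n0 np]; rewrite -(dvdn_pcharf (pchar_Fp p_pr)) gtnNdvd. Qed.

(** Substitute u = 1 - 2v. The form in u shows a summand even in u, the form in v a Jacobi sum with
    an extra factor 4. *)
Lemma sum_one_sub_sqr (f : F -> R) :
  \sum_(u : F) f (1 - u ^+ 2) = \sum_(v : F) f (4%:R * (v * (1 - v))).
Proof.
have i2 : injective (fun v : F => 1 - v * 2%:R).
  by move=> x y /addrI /oppr_inj /mulIf; apply; apply: Fp_nat_neq0; have := p_gt5; lia.
by rewrite (reindex_inj i2); apply: eq_bigr => v _; congr f; ring.
Qed.

Section JacobiValue.

Variable m : nat.
Hypothesis pE : p = (6 * m).+1.

Let m0 : (0 < m)%N. Proof. by have := p_gt5; lia. Qed.

Local Notation M := (4 * m * p.+1)%N.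

(** Write s = 1 - teich a. Unless a = 1, s^(6m) is 1 plus a multiple of p, and 4 m p^2 = 4m + 6m M.
    The M-th power of s^(6m) is then expanded to second order and rewritten in powers of s^(6m),
    which keeps the exponents below 18m. *)
Lemma psi_sub1 a : psi m (1 - a) =
  (1 - teich a) ^+ (4 * m) * (1 - M%:R + 'C(M, 2)%:R)
  + (1 - teich a) ^+ (10 * m) * (M%:R - 2 * 'C(M, 2)%:R)
  + (1 - teich a) ^+ (16 * m) * 'C(M, 2)%:R.
Proof.
rewrite /psi teich_sub1 -exprM; have [->|a1] := eqVneq a 1.
  rewrite teich1 subrr !expr0n !gtn_eqF ?mul0r ?addr0 //.
  - by lia.
  - by lia.
  - by lia.
  - by rewrite muln_gt0 expn_gt0 prime_gt0 //; lia.
set s := 1 - teich a.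
have [z Z] : eqR 1 (s ^+ (6 * m)) 1.
  have : eqR 1 (s ^+ (6 * m)) (teich (1 - a) ^+ (6 * m)).
    by apply/eqRX/eqR_sym; rewrite /s -teich1; exact: teichB.
  by rewrite -teichX (_ : 6 * m = p.-1)%N ?expf_pred ?teich1 ?pE // subr_eq0 eq_sym.
have -> : (p ^ 2 * (4 * m) = 4 * m + 6 * m * M)%N by rewrite pE; clear; nia.
have x3 : (pR ^+ 1 * z) ^+ 3 = 0 by rewrite exprMn pR3 mul0r.
have V : s ^+ (6 * m * M) = (s ^+ (6 * m)) ^+ M by rewrite exprM.
have U : s ^+ (10 * m) = s ^+ (4 * m) * s ^+ (6 * m) by rewrite -exprD; congr (_ ^+ _); lia.
have W : s ^+ (16 * m) = s ^+ (4 * m) * s ^+ (6 * m) ^+ 2.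
  by rewrite -exprM -exprD; congr (_ ^+ _); lia.
rewrite exprD V U W Z (expr_nil3 _ x3).
by move: (pR ^+ 1 * z) (s ^+ _) (M%:R) ('C(M, 2)%:R) => *; ring.
Qed.

(** After binomial expansion the exponents 4m + k stay below 22m, and p - 1 = 6m divides them only
    for k = 2m, 8m, 14m; these are even, so all signs are positive. *)
Lemma sum_jacobi n : (n < 18 * m)%N ->
  \sum_(a : F) teich a ^+ (4 * m) * (1 - teich a) ^+ n
  = p.-1%:R * ('C(n, 2 * m) + 'C(n, 8 * m) + 'C(n, 14 * m))%:R.
Proof.
move=> n18; pose e k : R := if (p.-1 %| 4 * m + k)%N then p.-1%:R else 0.
have E k : \sum_(a : F) teich a ^+ (4 * m + k) = e k by rewrite sum_teichX //; lia.
transitivity (\sum_(k < n.+1) (-1) ^+ k * e k * 'C(n, k)%:R).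
  under eq_bigr => a _ do rewrite exprBn mulr_sumr.
  rewrite exchange_big; apply: eq_bigr => k _ /=.
  rewrite -E mulr_sumr mulr_suml; apply: eq_bigr => a _.
  by rewrite expr1n mulr1 -mulr_natr exprD; ring.
rewrite -(big_mkord xpredT (fun k => (-1) ^+ k * e k * 'C(n, k)%:R)).
have -> : \sum_(0 <= k < n.+1) (-1) ^+ k * e k * 'C(n, k)%:R
   = \sum_(0 <= k < 18 * m) (-1) ^+ k * e k * 'C(n, k)%:R.
  rewrite [RHS](big_cat_nat (n := n.+1)) //= [X in _ + X]big_nat [X in _ + X]big1 ?addr0 // => k /andP[k1 _].
  by rewrite bin_small // mulr0.
have e2 : e (2 * m)%N = p.-1%:R by rewrite /e pE /= (_ : _ + _ = 6 * m)%N ?dvdnn //; lia.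
have e8 : e (8 * m)%N = p.-1%:R.
  by rewrite /e pE /= (_ : 4 * m + 8 * m = 2 * (6 * m))%N; [rewrite dvdn_mull|lia].
have e14 : e (14 * m)%N = p.-1%:R.
  by rewrite /e pE /= (_ : 4 * m + 14 * m = 3 * (6 * m))%N; [rewrite dvdn_mull|lia].
have e0 k : (k < 18 * m)%N -> k != (2 * m)%N -> k != (8 * m)%N -> k != (14 * m)%N -> e k = 0.
  move=> k18 k2 k8 k14; rewrite /e pE /=; case: ifP => // /dvdnP[q Q].
  by case: q Q => [|[|[|[|q]]]] Q; move: k2 k8 k14; nia.
have sg k : (-1) ^+ (2 * k) = 1 :> R by rewrite exprM sqrrN !expr1n.
have l2 : (2 * m < 18 * m)%N by lia.
have l8 : (8 * m < 18 * m)%N by lia.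
have l14 : (14 * m < 18 * m)%N by lia.
rewrite big_mkord (bigD1 (Ordinal l2)) //= (bigD1 (Ordinal l8)) /=; last by rewrite -val_eqE /=; lia.
rewrite (bigD1 (Ordinal l14)) /=; last by rewrite -!val_eqE /=; apply/andP; split; lia.
rewrite big1 => [|i /andP[/andP[i2 i8] i14]]; last by rewrite (e0 i) // mulr0 mul0r.
rewrite e2 e8 e14 (sg m) (_ : 8 * m = 2 * (4 * m))%N ?sg; last by lia.
rewrite (_ : 14 * m = 2 * (7 * m))%N ?sg; last by lia.
by rewrite addr0 !mul1r !natrD !mulrDr addrA.
Qed.

Lemma sum_psi_jacobi : \sum_(a : F) psi m (a * (1 - a)) = p.-1%:R *
  ('C(4 * m, 2 * m)%:R * (1 - M%:R + 'C(M, 2)%:R)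
   + (2 * 'C(10 * m, 2 * m))%:R * (M%:R - 2 * 'C(M, 2)%:R)
   + (2 * 'C(16 * m, 2 * m) + 'C(16 * m, 8 * m))%:R * 'C(M, 2)%:R).
Proof.
have E4 : \sum_(a : F) teich a ^+ (4 * m) * (1 - teich a) ^+ (4 * m)
    = p.-1%:R * 'C(4 * m, 2 * m)%:R.
  rewrite sum_jacobi; last lia.
  rewrite (@bin_small (4 * m) (8 * m)); last lia.
  by rewrite (@bin_small (4 * m) (14 * m)) ?addn0 //; lia.
have E10 : \sum_(a : F) teich a ^+ (4 * m) * (1 - teich a) ^+ (10 * m)
    = p.-1%:R * (2 * 'C(10 * m, 2 * m))%:R.
  rewrite sum_jacobi; last lia; rewrite (@bin_small (10 * m) (14 * m)); last lia.
  rewrite -(@bin_sub (10 * m) (8 * m)); last lia.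
  rewrite (_ : 10 * m - 8 * m = 2 * m)%N; last lia.
  by rewrite addn0 addnn -mul2n.
have E16 : \sum_(a : F) teich a ^+ (4 * m) * (1 - teich a) ^+ (16 * m)
    = p.-1%:R * (2 * 'C(16 * m, 2 * m) + 'C(16 * m, 8 * m))%:R.
  rewrite sum_jacobi; last lia; rewrite -(@bin_sub (16 * m) (14 * m)); last lia.
  rewrite (_ : 16 * m - 14 * m = 2 * m)%N; last lia.
  by rewrite addnAC addnn -mul2n.
rewrite !mulrDr ![p.-1%:R * (_ * _)]mulrA -E4 -E10 -E16 !mulr_suml -!big_split.
by apply: eq_bigr => a _ /=; rewrite psiM psi_sub1 {1}/psi !mulrDr !mulrA.
Qed.

Lemma jacobi_int_sum : (jacobi_int m)%:~R = \sum_(u : F) psi m (1 - u ^+ 2) :> R.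
Proof.
rewrite sum_one_sub_sqr; under eq_bigr => v _ do rewrite psiM.
rewrite -mulr_sumr sum_psi_jacobi /psi teich_nat -exprM /jacobi_int intr_jacobi natrX.
rewrite [(p ^ 2 * _)%N]mulnC -[p in p%:R - 1](prednK (prime_gt0 p_pr)) -[p.-1.+1%:R]natr1 addrK !natrD !natrM.
by move: (4 ^+ _) (p.-1%:R) ('C(4 * m, _)%:R) ('C(10 * m, _)%:R) ('C(16 * m, 2 * m)%:R)
  ('C(16 * m, 8 * m)%:R) ('C(_, 2)%:R : R) => *; ring.
Qed.

End JacobiValue.

(** * Integer coordinates and norm of the Jacobi sum *)

Lemma sum_F (f : F -> R) : \sum_(u : F) f u = \sum_(0 <= i < p) f i%:R.
Proof.
rewrite big_mkord; rewrite (reindex (fun i : 'I_p => i%:R : F)) //.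
apply: onW_bij; apply: inj_card_bij; last by rewrite card_F card_ord.
move=> i j /(congr1 (@nat_of_ord _)); rewrite !val_Fp_nat // !modn_small //.
exact: val_inj.
Qed.

Lemma sum_even (f : F -> R) : (forall u, f (- u) = f u) ->
  \sum_(u : F) f u = f 0 + 2 * \sum_(i < p./2) f i.+1%:R.
Proof.
move=> fN; have pe : p = (p./2 + p./2).+1.
  by rewrite addnn {1}p_half.
rewrite sum_F [index_iota 0 p](_ : _ = index_iota 0 (p./2 + p./2).+1); last by rewrite -pe.
rewrite big_nat_recl // big_mkord big_split_ord /=; congr (_ + _).
rewrite mulr2n mulrDl mul1r; congr (_ + _).
rewrite (reindex_inj rev_ord_inj) /=; apply: eq_bigr => i _.
rewrite -[RHS]fN; congr f; apply/eqP; rewrite -subr_eq0 opprK -natrD.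
rewrite (_ : _ + _ = p)%N; last by have := ltn_ord i; lia.
by rewrite (pcharf0 (pchar_Fp p_pr)).
Qed.

(** Since w^2 = -1 - w, each term moves each coordinate by at most 1. Squaring the values amounts to
    w -> w^2, so both sums have the same coordinates. *)
Lemma sum_root (w : R) n (f : 'I_n -> R) : 1 + w + w ^+ 2 = 0 ->
  (forall i, [\/ f i = 0, f i = 1, f i = w | f i = w ^+ 2]) ->
  exists a b : int, [/\ \sum_i f i = a%:~R + b%:~R * w,
    \sum_i f i ^+ 2 = a%:~R + b%:~R * w ^+ 2, `|a| <= n%:Z & `|b| <= n%:Z].
Proof.
move=> w0; elim: n f => [|n IHn] f fw.
  by exists 0, 0; rewrite !big_ord0 !mul0r addr0.
have [i|a [b [E1 E2 na nb]]] := IHn (fun i => f (widen_ord (leqnSn n) i)); first exact: fw.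
have w2 : w ^+ 2 = - 1 - w by apply/eqP; rewrite -subr_eq0 -[X in _ == X]w0; apply/eqP; ring.
rewrite !big_ord_recr /= E1 E2.
have w4 : (w ^+ 2) ^+ 2 = w by apply/eqP; rewrite -subr_eq0 -[X in _ == X](mulr0 (w ^+ 2 - w)) -w0; apply/eqP; ring.
case: (fw ord_max) => ->.
- by exists a, b; split=> //; [ring|ring|lia|lia].
- by exists (a + 1), b; split=> //; [ring|ring|lia|lia].
- by exists a, (b + 1); split=> //; [ring|ring|lia|lia].
- by exists (a - 1), (b - 1); rewrite w4 w2; split=> //; [ring|ring|lia|lia].
Qed.

(** As p divides (a y - x b) (a y + x b), one may assume a y - x b = k p by the choice of the sign
    of y. The identity (x a + 3 y b)^2 + 3 (a y - x b)^2 = p^2 then gives 3 k^2 <= 1, so k = 0. *)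
Lemma sqr_add_3sqr_uniq (x y a b : int) :
  x ^+ 2 + 3 * y ^+ 2 = p%:Z -> a ^+ 2 + 3 * b ^+ 2 = p%:Z -> a ^+ 2 = x ^+ 2.
Proof.
move=> xy ab; have p0 : p%:Z != 0 by rewrite eqz_nat -lt0n prime_gt0.
wlog dv : y xy / (p %| a * y - x * b)%Z.
  move=> H; have : (p %| (a * y - x * b) * (a * y + x * b))%Z.
    apply/dvdzP; exists (y ^+ 2 - b ^+ 2).
    rewrite -[RHS](_ : (a ^+ 2 + 3 * b ^+ 2) * y ^+ 2 - (x ^+ 2 + 3 * y ^+ 2) * b ^+ 2 = _); first by ring.
    by rewrite xy ab; ring.
  rewrite dvdzE abszM Euclid_dvdM // => /orP[] d; first by apply: (H y).
  by apply: (H (- y)); rewrite ?sqrrN // mulrN -opprD dvdzE abszN.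
have [k kE] := dvdzP dv.
have N : (x * a + 3 * y * b) ^+ 2 + 3 * (a * y - x * b) ^+ 2 = p%:Z ^+ 2.
  by rewrite [in RHS]expr2 -{1}xy -ab; ring.
have k0 : k = 0.
  have q0 : 0 <= (x * a + 3 * y * b) ^+ 2 by exact: sqr_ge0.
  have p2 : 0 < p%:Z ^+ 2 by rewrite exprn_even_gt0.
  move: N; rewrite kE exprMn => N.
  have k1 : 3 * k ^+ 2 <= 1.
    rewrite -(ler_pM2r p2) mul1r -mulrA -[X in _ <= X]N lerDr //.
  have [//|kn] := eqVneq k 0; have : 0 < k ^+ 2 by rewrite exprn_even_gt0.
  by move: (k ^+ 2) k1; clear; lia.
move: kE; rewrite k0 mul0r => /eqP; rewrite subr_eq0 => /eqP E.
have : p%:Z * (y ^+ 2 - b ^+ 2) = 0.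
  transitivity ((a * y) ^+ 2 - (x * b) ^+ 2); last by rewrite E subrr.
  by rewrite mulrBr -{1}ab -xy; ring.
move=> /eqP; rewrite mulf_eq0 (negPf p0) subr_eq0 => /eqP yb.
by apply: (addIr (3 * b ^+ 2)); rewrite ab -yb xy.
Qed.

Section Norm.

Variable m : nat.
Hypothesis pE : p = (6 * m).+1.

Lemma psi_root : exists2 w : R, 1 + w + w ^+ 2 = 0 &
  forall a, [\/ psi m a = 0, psi m a = 1, psi m a = w | psi m a = w ^+ 2].
Proof.
have [g g0 g1] := ex_expf_neq1 (ndvd_pred4 pE); pose z := g ^+ (4 * m).
have z3 (a : F) : a != 0 -> (a ^+ (4 * m)) ^+ 3 = 1.
  by move=> a0; rewrite -exprM (_ : _ * 3 = p.-1 * 2)%N ?exprM ?expf_pred ?expr1n //; lia.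
have rt (a : F) (c : F) : c ^+ 3 = 1 -> c != 1 -> c ^+ 2 + c + 1 = 0.
  move=> c3 c1; apply: (@mulfI _ (c - 1)); first by rewrite subr_eq0.
  by rewrite mulr0 (_ : _ * _ = c ^+ 3 - 1); [rewrite c3 subrr|ring].
exists (teich z).
  apply: (mulrI (teich_sub_unit g1)); rewrite mulr0 teich1 -/z.
  rewrite (_ : _ * _ = teich z ^+ 3 - 1); last by ring.
  by rewrite -teichX z3 // teich1 subrr.
move=> a; rewrite psi_teich; have [->|a0] := eqVneq a 0.
  by apply: Or41; rewrite expr0n (gtn_eqF (psi_gt0 pE)) teich0.
have : (a ^+ (4 * m) - 1) * (a ^+ (4 * m) - z) * (a ^+ (4 * m) - z ^+ 2) = 0.
  have Z := rt g z (z3 g g0) g1.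
  have A : z ^+ 3 = 1 := z3 g g0.
  move: (a ^+ _) (z3 a a0) => c C.
  have -> : (c - 1) * (c - z) * (c - z ^+ 2) = c ^+ 3 - (z ^+ 2 + z + 1) * c ^+ 2
     + (z ^+ 3 + z ^+ 2 + z) * c - z ^+ 3 by ring.
  by rewrite A C Z (_ : 1 + z ^+ 2 + z = z ^+ 2 + z + 1); [rewrite Z !mul0r subr0 addr0 subrr|ring].
move=> /eqP; rewrite !mulf_eq0 !subr_eq0 -orbA => /or3P[] /eqP ->.
- by apply: Or42; rewrite teich1.
- exact: Or43.
- by apply: Or44; rewrite teichX.
Qed.

(* The summand is even in u and equals 1 at u = 0, so the sum is 1 + 2 (c + d w)
   with c, d integers of absolute value at most (p - 1) / 2: its norm is
   congruent to p modulo p^3 and smaller than p^3. *)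
Lemma jacobi_int_norm : exists a b : int, [/\ a ^+ 2 + 3 * b ^+ 2 = p%:Z &
  ((jacobi_int m)%:~R ^+ 2 + p%:R = 2 * a%:~R * (jacobi_int m)%:~R :> R)].
Proof.
have [w w0 wP] := psi_root; rewrite jacobi_int_sum //.
pose f (u : F) := psi m (1 - u ^+ 2).
have fN u : f (- u) = f u by rewrite /f sqrrN.
have f2N u : f (- u) ^+ 2 = f u ^+ 2 by rewrite fN.
have [c [d [E1 E2 nc nd]]] := sum_root w0 (fun i : 'I_(p./2) => wP (1 - i.+1%:R ^+ 2)).
have K1 : \sum_(u : F) f u = 1 + 2 * (c%:~R + d%:~R * w).
  by rewrite (sum_even fN) E1 /f expr0n subr0 psi1.
have K2 : \sum_(u : F) f u ^+ 2 = 1 + 2 * (c%:~R + d%:~R * w ^+ 2).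
  by rewrite (sum_even f2N) E2 /f expr0n subr0 psi1 expr1n.
have J : (\sum_(u : F) f u) * (\sum_(u : F) f u ^+ 2) = p%:R.
  have n4 : 4%:R != 0 :> F by apply: Fp_nat_neq0; have := p_gt5; lia.
  rewrite -(jacobi_norm pE) /f sum_one_sub_sqr (sum_one_sub_sqr (fun x => psi m x ^+ 2)).
  under eq_bigr => v _ do rewrite psiM.
  under [X in _ * X = _]eq_bigr => v _ do rewrite -(psiV pE) invfM psiM.
  by rewrite -!mulr_sumr mulrACA -psiM mulfV // psi1 mul1r.
have w2 : w ^+ 2 = - 1 - w by apply/eqP; rewrite -subr_eq0 -[X in _ == X]w0; apply/eqP; ring.
(* With w^2 = -1 - w, the element 1 + 2c + 2d w has norm a^2 + 3 d^2 and trace 2a for a = 1 + 2c -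
   d. *)
exists (1 + 2 * c - d), d; split; last first.
  rewrite -/f -J K2 w2 (_ : \sum_(u : F) f u = 1 + 2 * (c%:~R + d%:~R * w)) //; ring.
have NR : ((1 + 2 * c - d) ^+ 2 + 3 * d ^+ 2)%:~R = p%:R :> R.
  rewrite -J K1 K2 w2.
  rewrite [RHS](_ : _ = (1 + 2 * c%:~R - d%:~R) ^+ 2 + 3 * d%:~R ^+ 2
      - (2 * d%:~R) ^+ 2 * (1 + w + w ^+ 2)); [rewrite w0|]; ring.
have N0 : 0 <= (1 + 2 * c - d) ^+ 2 + 3 * d ^+ 2
  by apply: addr_ge0; [exact: sqr_ge0|apply: mulr_ge0 => //; exact: sqr_ge0].
have NB : (1 + 2 * c - d) ^+ 2 + 3 * d ^+ 2 < (p ^ 3)%:Z.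
  have ph := p_half; have h0 : (0 < p./2)%N by have := p_gt5; lia.
  have sq (x y : int) : `|x| <= y -> x ^+ 2 <= y ^+ 2.
    by move=> xy; rewrite -subr_ge0 subr_sqr; apply: mulr_ge0; lia.
  have q1 : (1 + 2 * c - d) ^+ 2 <= (1 + 3 * (p./2)%:Z) ^+ 2 by apply: sq; lia.
  have q2 : d ^+ 2 <= (p./2)%:Z ^+ 2 by exact: sq.
  have -> : (p ^ 3)%N%:Z = (1 + 2 * (p./2)%:Z) ^+ 3.
    by rewrite -[LHS]natz natrX {1}ph natz intS -mul2n PoszM.
  have q3 : 0 < (p./2)%:Z ^+ 3 by rewrite exprn_gt0 // ltz_nat.
  have q23 : 3 * d ^+ 2 <= 3 * (p./2)%:Z ^+ 2 by rewrite ler_pM2l.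
  (* For h = (p - 1) / 2 the bound (1 + 3h)^2 + 3 h^2 falls short of p^3 = (1 + 2h)^3 by exactly 8
     h^3. *)
  apply: le_lt_trans (lerD q1 q23) _; rewrite -subr_gt0.
  by rewrite (_ : _ - _ = 8 * (p./2)%:Z ^+ 3); [exact: mulr_gt0|move: (p./2)%:Z => x; ring].
case: (_ + _) N0 NR NB => // n _ NR NB; congr Posz.
have := congr1 (@nat_of_ord _) NR; rewrite !val_Zp_nat ?p3_gt1 //.
rewrite !modn_small //; by rewrite -[X in (X < _)%N]expn1 ltn_exp2l // prime_gt1.
Qed.

End Norm.

(** * The case p = 1 modulo 3 *)

Section OneModThree.

Variable m : nat.
Hypothesis pE : p = (6 * m).+1.

Local Notation t := (- (1 / 3) : rat).
Local Notation hs3 := (hsum (- (1 / 3))).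

Lemma pk3_int (z : int) : (z%:~R : 'Z_(p ^ 3)) = 0 -> (z%:~R : rat) \in pk p 3.
Proof.
have N (n : nat) : (n%:R : 'Z_(p ^ 3)) = 0 -> (n%:R : rat) \in pk p 3.
  move=> /(congr1 (@nat_of_ord _)); rewrite val_Zp_nat ?p3_gt1 // => /eqP/dvdnP[q ->].
  by rewrite natrM natrX; exact: (pkMl (zp_nat p _) (pkX 3)).
case: z => n; first exact: N.
by rewrite NegzE !rmorphN /= => /eqP; rewrite oppr_eq0 => /eqP /N /pkN.
Qed.

(** Squaring K^2 + p = 2 a K removes the sign of a, so a^2 can be replaced by x^2 and only K^2,
    known to be S(-1/3), remains. *)
Lemma jacobi_int_quadratic (x y : int) : p%:Z = x ^+ 2 + 3 * y ^+ 2 ->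
  ((jacobi_int m)%:~R ^+ 2 + P) ^+ 2 - 4 * x%:~R ^+ 2 * (jacobi_int m)%:~R ^+ 2 \in pk p 3.
Proof.
move=> xy; have [a [b [ab E]]] := jacobi_int_norm pE; move: (jacobi_int m) E => A E.
have ax := sqr_add_3sqr_uniq (esym xy) ab.
have : (A ^+ 2 + p%:Z - 2 * a * A)%:~R \in pk p 3.
  apply: pk3_int; have -> : (A ^+ 2 + p%:Z - 2 * a * A)%:~R
     = A%:~R ^+ 2 + p%:R - 2 * a%:~R * A%:~R :> 'Z_(p ^ 3) by ring.
  by rewrite E subrr.
move=> H; have := pkMr H (zp_int p (A ^+ 2 + p%:Z + 2 * a * A)).
rewrite -rmorphM [X in X%:~R \in _](_ : _ = (A ^+ 2 + p%:Z) ^+ 2 - 4 * x ^+ 2 * A ^+ 2).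
  by rewrite [X in X \in _](_ : _ = (A%:~R ^+ 2 + P) ^+ 2 - 4 * x%:~R ^+ 2 * A%:~R ^+ 2) //; ring.
by rewrite -ax; move: (p%:Z) => q; ring.
Qed.

Let u0 i : rat := i%:R + P * t.

Lemma u0_zu i : (0 < i < p)%N -> u0 i \in zu p.
Proof. by move=> ip; apply: zuD; [exact: zu_small|exact: (pkMr pkP neg_third_zp)]. Qed.

Lemma hs_prod : hs3 - (\prod_(i < m) (u0 i.*2.+1 / u0 i.*2.+2)) ^+ 2 * hsum (P * t) \in pk p 3.
Proof.
have m2 : (0 + m.*2 < p)%N by lia.
have := hsum_shift m2 neg_third_zp; rewrite [0%:R + _]add0r.
rewrite (_ : (0 + m.*2)%:R + _ = t) //.
by rewrite add0n -mul2n natrM (natr_m pE); field.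
Qed.

Lemma hs_two_thirds_prod : hsum (2 / 3) - (\prod_(i < m) (u0 i.*2.+2 / u0 i.*2.+3)) ^+ 2 * hsum (1 + P * t) \in pk p 3.
Proof.
have m2 : (1 + m.*2 < p)%N by have := p_gt5; lia.
have := hsum_shift m2 neg_third_zp.
rewrite (_ : (1 + m.*2)%:R + _ = 2 / 3) //.
by rewrite natrD -mul2n natrM (natr_m pE); field.
Qed.

(** The two chains interleave: everything cancels except the first factor 1 + p t and the last
    denominator 2m + 1 + p t = 2/3. *)
Lemma prod_u0 : \prod_(i < m) (u0 i.*2.+1 / u0 i.*2.+2) * \prod_(i < m) (u0 i.*2.+2 / u0 i.*2.+3)
  = (1 + P * t) * (3 / 2).
Proof.
have -> : 3 / 2 = (u0 m.*2.+1)^-1.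
  rewrite (_ : u0 _ = 2 / 3); first by field.
  by rewrite /u0 -[m.*2.+1%:R]natr1 -mul2n natrM (natr_m pE); field.
rewrite -[1 + P * t]/(u0 1) -big_split /=.
have : (m.*2.+1 < p)%N by have := p_gt5; lia.
move: (m) => k; elim: k => [|k IHk] kp; first by rewrite big_ord0 divff // zu_neq0 // u0_zu //; have := p_gt5; lia.
rewrite big_ord_recr /= IHk; last lia.
have a1 : u0 k.*2.+1 != 0 by apply/zu_neq0/u0_zu; lia.
have a2 : u0 k.*2.+2 != 0 by apply/zu_neq0/u0_zu; lia.
have a3 : u0 k.*2.+3 != 0 by apply/zu_neq0/u0_zu; lia.
rewrite doubleS; move: (u0 1) (u0 _.+1) (u0 _.+2) (u0 _.+3) a1 a2 a3 => a b c d *.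
by field; apply/and3P.
Qed.

Lemma hs_zu : hs3 \in zu p.
Proof.
apply: (eqp_zu _ hs_prod) => //; apply: zuM; last exact: (u1_zu (hsum_Pt neg_third_zp).1).
apply/zuX/zu_prod => i _; have := ltn_ord i => im.
by apply: zuM; [|apply: zuV]; apply: u0_zu; lia.
Qed.

(** Up to a 1-unit the squared chains multiply to 9/4, and S(1 + p t) is p^2 t (t + 1) = -2 p^2 / 9.
    The 1-units do not affect a multiple of p^2 modulo p^3. *)
Lemma hs_mul : hs3 * hsum (2 / 3) + P ^+ 2 / 2 \in pk p 3.
Proof.
have [Hu _] := hsum_Pt neg_third_zp; have H1 := hsum_1Pt neg_third_zp.
have := hs_prod; have := hs_two_thirds_prod; have := prod_u0.
set A := \prod_(i < m) _; set B := \prod_(i < m) (_ / u0 _.+3).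
have Hz := zu_zp (u1_zu Hu); have Sz := zu_zp hs_zu.
have Az : A \in zp p by apply: zp_prod => i _; have := ltn_ord i => im;
  apply: zpM; [apply: zu_zp|apply: zuV_zp]; apply: u0_zu; lia.
have Bz : B \in zp p by apply: zp_prod => i _; have := ltn_ord i => im;
  apply: zpM; [apply: zu_zp|apply: zuV_zp]; apply: u0_zu; lia.
move=> AB h2 h1; have tz := neg_third_zp.
have H1z : hsum (1 + P * t) \in zp p by apply: (eqp_zp H1); zpt; exact: pkW pkP.
have e := eqpM Sz (zpM (zpX 2 Bz) H1z) h1 h2.
have vu : (1 + P * t) ^+ 2 * hsum (P * t) \in u1.
  exact: u1M (u1X 2 (u1D (pkMr pkP tz))) Hu.
have q1 := pkMl (zpM (zp_nat p 9) (zuV_zp zu4)) (pkMl (zu_zp (u1_zu vu)) H1).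
have q2 := half_pk (pkM (pkX 2) vu).
have := pkB (pkD e q1) q2.
rewrite [X in X \in _ -> _](_ : _ = hs3 * hsum (2 / 3) + P ^+ 2 / 2) //.
have -> : A ^+ 2 * hsum (P * t) * (B ^+ 2 * hsum (1 + P * t)) = (A * B) ^+ 2 * (hsum (P * t) * hsum (1 + P * t)) by ring.
rewrite AB.
move: hs3 (hsum (2 / 3)) (hsum (P * t)) (hsum (1 + P * t)) => s r u v.
by field.
Qed.

(** As W = S(-1/3) is a unit, (W + p)^2 = 4 x^2 W reads W = 4 x^2 - 2p - p^2 / W, where W may be
    replaced by 4 x^2 in the last term. With S(2/3) = -p^2 / (2 W) the coefficient of p^2 / (4 x^2)
    is 1/3 - 29/60 = -3/20, hence the 3/80. *)
Lemma lhs_one (x y : int) s : p%:Z = x ^+ 2 + 3 * y ^+ 2 ->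
  s - (29 / 60 * hs3 - 2 / 3 * hsum (2 / 3)) \in pk p 3 ->
  s - (29 / 15 * x%:~R ^+ 2 - 29 / 30 * P - 3 * P ^+ 2 / (80 * x%:~R ^+ 2)) \in pk p 3.
Proof.
move=> xy sE; have Wu := hs_zu; have Wz := zu_zp Wu; have M := hs_mul.
have aE : (2 * m = (2 * m - 2).+2)%N by have := p_gt5; lia.
have bE : (4 * m = (4 * m - 2).+2)%N by have := p_gt5; lia.
have Q := jacobi_int_quadratic xy; have JW := jacobi_sqr pE aE bE.
move: (hsum (2 / 3)) hs3 (x%:~R : rat) ((jacobi_int m)%:~R ^+ 2) sE Wu Wz M Q JW (zp_int p x).
move=> S W X A sE Wu Wz M Q JW Xz.
have Az : A \in zp p := eqp_zp JW Wz.
have Q2 : (W + P) ^+ 2 - 4 * X ^+ 2 * W \in pk p 3.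
  have c : A + W + 2 * P - 4 * X ^+ 2 \in zp p by zpt.
  have := pkB Q (pkMr JW c); rewrite [Z in Z \in _ -> _](_ : _ = (W + P) ^+ 2 - 4 * X ^+ 2 * W) //; ring.
have W0 := zu_neq0 Wu.
have k1 := pk_divu Q2 Wu; have k2 := pk_divu M Wu.
have X4 : 4 * X ^+ 2 - W \in pk p 1.
  have c : 2 + P / W \in zp p by zpt.
  have := pkB (pkMr pkP c) (@pk_le 3 1 _ isT k1).
  rewrite [Z in Z \in _ -> _](_ : _ = 4 * X ^+ 2 - W) //; by field.
have X4u : 4 * X ^+ 2 \in zu p := @eqp_zu 1 _ _ isT X4 Wu.
have k3 := pkM (pkX 2) (eqpV Wu X4u (eqp_sym X4)).
have X0 : X != 0 by apply: contraTneq X4u => ->; rewrite expr0n mulr0 unfold_in eqxx.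
have k4 : 29 / 60 - 1 / 3 \in zp p by apply: zpD twentynine_sixtieths_zp (zpN (zpM (zp1 _) (zuV_zp zu3))).
apply: eqp_trans sE _.
have := pkB (pkB (pkMl twentynine_sixtieths_zp k1) (pkMl two_thirds_zp k2)) (pkMl k4 k3).
rewrite [Z in Z \in _ -> _](_ : _ = 29 / 60 * W - 2 / 3 * S - (29 / 15 * X ^+ 2 - 29 / 30 * P - 3 * P ^+ 2 / (80 * X ^+ 2))) //.
by field; rewrite X0 W0.
Qed.

End OneModThree.

End Main.

Theorem theorem8p3 (p : nat) (hp : prime p) (hp5 : (5 < p)%N) :
  let lhs : rat := \sum_(0 <= k < (p - 3).+1)
    ('C(2 * k, k) ^ 2 * 'C(3 * k, k))%:R / (108 ^+ k * (k + 2)%:R) in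
  let B : rat := 'C((p - 1) %/ 2, (p - 5) %/ 6)%:R in
  let q2 : rat := fermat_quotient p 2 in
  let q3 : rat := fermat_quotient p 3 in
  let P : rat := p%:R in
  (p = 1 %[mod 3] ->
   forall x y : int, p%:Z = x ^+ 2 + 3 * y ^+ 2 ->
   congr_mod_pow p 3 lhs
     (29 / 15 * x%:~R ^+ 2 - 29 / 30 * P - 3 * P ^+ 2 / (80 * x%:~R ^+ 2)))
  /\
  (p = 2 %[mod 3] ->
   congr_mod_pow p 3 lhs
     (- (2 / 3) * B ^+ 2 *
        (1 + P * (2 + 4 / 3 * q2 - 3 / 2 * q3)
         + P ^+ 2 * (1 + 8 / 3 * q2 + 2 / 9 * q2 ^+ 2 - 3 * q3
                     - 2 * q2 * q3 + 15 / 8 * q3 ^+ 2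
                     + 3 / 4 * (U (p - 3))%:~R))
      - 29 / 120 * P ^+ 2 * B ^- 2)).
Proof.
move=> lhs B q2 q3 P; have L := lhs_hsum hp hp5.
have lz : lhs \in zp p.
  apply: (eqp_zp hp L); apply: zpD; [|apply: zpN]; apply: zpM.
  - exact: (twentynine_sixtieths_zp hp hp5).
  - exact: (hsum_zp hp hp5 (neg_third_zp hp hp5)).
  - exact: (two_thirds_zp hp hp5).
  - exact: (hsum_zp hp hp5 (two_thirds_zp hp hp5)).
have op : odd p by case: (even_prime hp) => // p2; move: hp5; rewrite p2.
split=> [p1 x y xy|p2]; apply: congr_mod_powE => //.
  have pE : p = (6 * (p %/ 6)).+1 by lia.
  exact: (lhs_one hp hp5 pE xy L).
have pE : p.+1 = (6 * (p.+1 %/ 6))%N by lia.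
exact: (lhs_five hp hp5 pE L).
Qed.
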